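(* Suppose that $H$ is a graph in which every block is a $K_3$, $K_2$, or $K_1$, except for up to one block per connected component of $H$, which can be a $K_4$, $K_{1,1,2}$, $K_{1,1,3}$, $K_{2,3}$, or a cycle (of any length). Then $H$ is contractible.
   Context: All graphs are finite and simple (no loops or multiple edges). A block of a graph is a maximal subgraph that has no cut-vertex. Let $G$ and $H$ be graphs with $V(H)\subseteq V(G)$. An $H$-scheme in $G$ is a collection of paths $\{P_{uv}: uv\in E(H)\}$ such that (1) each $P_{uv}$ is a $u,v$-path in $G$ with $V(P_{uv})\cap V(H)=\{u,v\}$, and (2) whenever $e_1,\dots,e_k\in E(H)$ satisfy $V(P_{e_1})\cap\dots\cap V(P_{e_k})\neq\emptyset$, there is a vertex $u\in V(H)$ incident with each of $e_1,\dots,e_k$. $G$ has a rooted $H$-minor if there are pairwise vertex-disjoint connected subgraphs $C_v$ of $G$, one for each $v\in V(H)$, such that $v\in V(C_v)$ for all $v\in V(H)$ and for each edge $uv\in E(H)$ there is an edge of $G$ joining $C_u$ and $C_v$. A graph $H$ is contractible if every graph $G$ with $V(H)\subseteq V(G)$ that contains an $H$-scheme has a rooted $H$-minor. *)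

(* Defs.v *)
From mathcomp Require Import all_boot.

Set Implicit Arguments.
Unset Strict Implicit.
Unset Printing Implicit Defensive.

Record sgraph := SGraph {
  vert :> finType;
  adj : rel vert;
  adj_sym : symmetric adj;
  adj_irrefl : irreflexive adj
}.

(* Not necessarily induced. *)
Record subgraph (G : sgraph) := Subgraph {
  sverts : {set G};
  sadj : rel G;
  sadj_sym : symmetric sadj;
  sadj_sub : forall x y, sadj x y -> [/\ x \in sverts, y \in sverts & adj x y]
}.

Section Subgraphs.
Variable G : sgraph.
Implicit Types B : subgraph G.

Definition subgraph_le B1 B2 : Prop :=
  sverts B1 \subset sverts B2 /\ subrel (sadj B1) (sadj B2).

Definition subgraph_eq B1 B2 : Prop :=
  sverts B1 = sverts B2 /\ sadj B1 =2 sadj B2.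

Definition connected B : Prop :=
  sverts B != set0 /\
  forall x y, x \in sverts B -> y \in sverts B -> connect (sadj B) x y.

(* v separates two other vertices lying in the same component of B. *)
Definition cut_vertex B (v : G) : Prop :=
  v \in sverts B /\
  exists x y, [/\ x \in sverts B :\ v, y \in sverts B :\ v,
    connect (sadj B) x y &
    ~~ connect [rel a b | [&& sadj B a b, a != v & b != v]] x y].

Definition nonseparable B : Prop := connected B /\ forall v, ~ cut_vertex B v.

(* "Maximal subgraph with no cut-vertex" is meant among connected subgraphs:
   otherwise any disjoint union of 2-connected graphs would be one block. *)
Definition block B : Prop :=
  nonseparable B /\
  forall B', nonseparable B' -> subgraph_le B B' -> subgraph_le B' B.

Definition isomorphic_to B (F : sgraph) : Prop :=
  exists f : F -> G,
    [/\ injective f, f @: [set: F] = sverts B &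
        forall x y, sadj B (f x) (f y) = adj x y].

Definition is_path_between (x y : G) (p : seq G) : bool :=
  if p is z :: q then [&& z == x, path (@adj G) z q, last z q == y & uniq p]
  else false.

End Subgraphs.

Lemma neq_sym (T : eqType) : symmetric [rel x y : T | x != y].
Proof. by move=> x y /=; rewrite eq_sym. Qed.

Lemma neq_irrefl (T : eqType) : irreflexive [rel x y : T | x != y].
Proof. by move=> x /=; rewrite eqxx. Qed.

Definition complete_graph (n : nat) : sgraph :=
  SGraph (@neq_sym 'I_n) (@neq_irrefl 'I_n).

Section Multipartite.
Variable s : seq nat.

(* The i-th part is the fibre over i, of size nth 0 s i. *)
Definition multipartite_vert : finType :=
  {i : 'I_(size s) & 'I_(nth 0 s i)}.

Definition multipartite_adj : rel multipartite_vert :=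
  [rel x y | tag x != tag y].

Lemma multipartite_sym : symmetric multipartite_adj.
Proof. by move=> x y; rewrite /multipartite_adj /= eq_sym. Qed.

Lemma multipartite_irrefl : irreflexive multipartite_adj.
Proof. by move=> x; rewrite /multipartite_adj /= eqxx. Qed.

Definition complete_multipartite : sgraph :=
  SGraph multipartite_sym multipartite_irrefl.

End Multipartite.

Section Cycle.
Variable n : nat.

(* ordS is the cyclic successor; the result is a cycle only for n >= 3. *)
Definition cycle_adj : rel 'I_n :=
  [rel i j | (i != j) && ((ordS i == j) || (ordS j == i))].

Lemma cycle_adj_sym : symmetric cycle_adj.
Proof. by move=> i j; rewrite /cycle_adj /= eq_sym orbC. Qed.

Lemma cycle_adj_irrefl : irreflexive cycle_adj.
Proof. by move=> i; rewrite /cycle_adj /= eqxx. Qed.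

Definition cycle_graph : sgraph := SGraph cycle_adj_sym cycle_adj_irrefl.

End Cycle.

(* The inclusion V(H) \subseteq V(G) is given as an injection iota : H -> G;
   it need not send edges of H to edges of G. *)
Section Contractible.
Variables (H G : sgraph) (iota : H -> G).

(* P u v and P v u list the same path in opposite directions, so that P is a
   family indexed by the unordered edges of H. *)
Definition is_scheme (P : H -> H -> seq G) : Prop :=
  [/\ forall u v, adj u v -> P v u = rev (P u v),
      forall u v, adj u v -> is_path_between (iota u) (iota v) (P u v),
      forall u v, adj u v ->
        forall w : H, iota w \in P u v <-> w = u \/ w = v
    & forall es : seq (H * H),
        es <> [::] ->
        (forall e, e \in es -> adj e.1 e.2) ->
        (exists x : G, forall e, e \in es -> x \in P e.1 e.2) ->
        exists u : H, forall e, e \in es -> u = e.1 \/ u = e.2].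

Definition has_scheme : Prop := exists P, is_scheme P.

Definition has_rooted_minor : Prop :=
  exists C : H -> subgraph G,
    [/\ forall v, connected (C v),
        forall v, iota v \in sverts (C v),
        forall u v, u != v -> [disjoint sverts (C u) & sverts (C v)]
      & forall u v, adj u v ->
          exists x y, [/\ x \in sverts (C u), y \in sverts (C v) & adj x y]].

End Contractible.

Definition contractible (H : sgraph) : Prop :=
  forall (G : sgraph) (iota : H -> G),
    injective iota -> has_scheme iota -> has_rooted_minor iota.

Definition ordinary_block (H : sgraph) (B : subgraph H) : Prop :=
  [\/ isomorphic_to B (complete_graph 3),
      isomorphic_to B (complete_graph 2)
    | isomorphic_to B (complete_graph 1)].

Definition exceptional_block (H : sgraph) (B : subgraph H) : Prop :=
  isomorphic_to B (complete_graph 4) \/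
  isomorphic_to B (complete_multipartite [:: 1; 1; 2]) \/
  isomorphic_to B (complete_multipartite [:: 1; 1; 3]) \/
  isomorphic_to B (complete_multipartite [:: 2; 3]) \/
  exists2 n, 3 <= n & isomorphic_to B (cycle_graph n).

Definition same_component (H : sgraph) (B1 B2 : subgraph H) : Prop :=
  exists x y, [/\ x \in sverts B1, y \in sverts B2 & connect (@adj H) x y].

(* Main.v *)
(** By monotonicity, leaf vertices and pendant triangles can be split off a
    scheme (contract the initial part of their paths into the vertex they hang
    on), and disjoint graphs can be treated separately.  In a graph as in the
    theorem, the end of a longest path leaving an exceptional block is such a
    leaf or triangle, so everything reduces to cycles, K4 and K_{1,1,k}; the
    latter contains K_{2,3} and K_{1,1,3}, and K4 contains K_{1,1,2}.

    Cycles.  In a contraction-minimal scheme that does not consist of edges, the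
    vertex following each root also lies on the next path; these vertices form
    the roots of a smaller cycle scheme.

    K_{2,k}, with hubs a and b.  In a contraction-minimal scheme the inner
    vertices shared by an a-path and a b-path are edges of two auxiliary graphs,
    one on the remaining vertices of the a-paths and one on those of the
    b-paths.  Every such vertex lies on at least two paths, so each of the two
    cycle matroids has rank at most half the number of edges, also after
    contraction, and matroid union yields two disjoint spanning sets.

    K_{1,1,k}.  Take a K_{2,k} minor with A and B as large as possible.  If A and
    B are not adjacent, then every other branch set has a single vertex adjacent
    to A or B, and this vertex is adjacent to both.  Hence the scheme can be
    rerouted to end at A and B.  The a-b path leaves A through such a vertex z,
    which cannot lie on both an a-path and a b-path of the same root, so z may be
    contracted into A (or B), and the new K_{2,k} minor has adjacent hubs.

    K4.  From a rooted 4-cycle minor and the two remaining paths one obtains a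
    rooted K4 minor, or a root r and a further connected set, each adjacent to the
    three other root sets.  In a minimal scheme no two vertices separate three of
    the roots from each other, and under this condition the second configuration
    contracts to one with at most two non-root vertices, where K4 is found. *)

Require Import Defs.
From Stdlib Require Import Classical_Prop.
From mathcomp Require Import all_boot all_algebra zify.

Set Implicit Arguments.
Unset Strict Implicit.
Unset Printing Implicit Defensive.

(** * Connected sets and contractions *)

(** Each vertex on the paths of a scheme has a label: a vertex of [H] incident with all edges whose
    paths pass through it. Identifying two adjacent vertices that admit a common label yields a
    scheme again, and a rooted minor of the quotient lifts back. So in a minimal counterexample no
    edge has ends that admit a common label; this local rule dictates the shape of minimal schemes
    for cycles, K_{2,k} and K4. Identification would change the vertex type at every step. Quotients
    are therefore taken on the same type, where merged or deleted vertices stay behind without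
    edges, and the induction counts the vertices that have a neighbour. Having at most one
    exceptional block per component is what makes pruning possible: on a path that starts at this
    block, the far end can only meet ordinary blocks. *)

Lemma connect_inv (T : finType) (e : rel T) (W : pred T) :
  (forall x y, W x -> e x y -> W y) -> forall x y, connect e x y -> W x -> W y.
Proof.
move=> cl x y /connectP[p]; elim: p x => [|z p IH] x /=; first by move=> _ ->.
by case/andP=> xz pz ly Wx; apply: (IH z) => //; apply: cl xz.
Qed.

Section Sets.
Variables (T : finType).
Implicit Types (g : rel T) (S U W : {set T}).

Definition ind g S : rel T := [rel x y | [&& x \in S, y \in S & g x y]].
Definition cset g S : Prop := {in S &, forall x y, connect (ind g S) x y}.
Definition touch g S U : Prop := exists x y, [/\ x \in S, y \in U & g x y].
Definition cc g S x : {set T} := [set y in S | connect (ind g S) x y].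

Lemma ind_sym g S : symmetric g -> symmetric (ind g S).
Proof. by move=> sg x y; rewrite /ind /= sg andbCA. Qed.

Lemma touch_sym g S U : symmetric g -> touch g S U -> touch g U S.
Proof. by move=> sg [x [y [xS yU xy]]]; exists y, x; rewrite sg. Qed.

Lemma touch_sub g S U S' U' :
  S \subset S' -> U \subset U' -> touch g S U -> touch g S' U'.
Proof.
move=> /subsetP sS /subsetP sU [x [y [xS yU xy]]]; exists x, y.
by rewrite sS ?sU.
Qed.

Lemma connect_ind_sub g g' S S' x y :
  S \subset S' -> (forall u v, u \in S -> v \in S -> g u v -> g' u v) ->
  connect (ind g S) x y -> connect (ind g' S') x y.
Proof.
move=> /subsetP sS sg; apply: connect_sub => u v /and3P[uS vS uv].
by apply: connect1; rewrite /ind /= (sS u) ?(sS v) ?sg.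
Qed.

Lemma cset_root g S r : symmetric g ->
  (forall x, x \in S -> connect (ind g S) r x) -> cset g S.
Proof.
move=> sg cr x y xS yS; apply: (connect_trans (y := r)); last exact: cr.
by rewrite (sym_connect_sym (ind_sym S sg)) cr.
Qed.

Lemma cset1 g x : cset g [set x].
Proof. by move=> y z /set1P-> /set1P->. Qed.

Lemma mem_cc g S x : x \in S -> x \in cc g S x.
Proof. by move=> xS; rewrite inE xS connect0. Qed.

Lemma cc_sub g S x : cc g S x \subset S.
Proof. by apply/subsetP=> y; rewrite inE => /andP[]. Qed.

Lemma cc_closed g S x y z :
  y \in cc g S x -> z \in S -> g y z -> z \in cc g S x.
Proof.
rewrite !inE => /andP[yS xy] zS yz; rewrite zS (connect_trans xy) //.
by apply: connect1; rewrite /ind /= yS zS.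
Qed.

Lemma cset_cc g S x : symmetric g -> x \in S -> cset g (cc g S x).
Proof.
move=> sg xS; apply: (@cset_root _ _ x) => // y; rewrite inE => /andP[yS xy].
have := @connect_inv _ (ind g S)
  (fun z => (z \in cc g S x) && connect (ind g (cc g S x)) x z) _ x y xy.
rewrite mem_cc //= connect0 => /(_ _ isT)/andP[//|_ //] u v /andP[uC xu].
case/and3P=> uS vS uv; have vC := cc_closed uC vS uv; rewrite vC.
by apply: connect_trans xu (connect1 _); rewrite /ind /= uC vC.
Qed.

Lemma cset_cut g S W u v : cset g S -> u \in S -> u \in W -> v \in S ->
  v \notin W -> exists x y, [/\ x \in S, x \in W, y \in S, y \notin W & g x y].
Proof.
move=> cS uS uW vS vW.
case: (boolP [exists x, [exists y, [&& x \in S, x \in W, y \in S, y \notin W & g x y]]]).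
  by case/existsP=> x /existsP[y /and5P[? ? ? ? ?]]; exists x, y.
move=> nx; case/negP: vW; apply: (@connect_inv _ _ [in W] _ u v (cS u v uS vS)) => //.
move=> x y xW /and3P[xS yS xy]; apply: contraNT nx => yW.
by apply/existsP; exists x; apply/existsP; exists y; apply/and5P.
Qed.

Lemma csetP g S r : symmetric g -> r \in S ->
  (forall W : {set T}, r \in W ->
     (forall x y, x \in W -> x \in S -> y \in S -> g x y -> y \in W) -> S \subset W) ->
  cset g S.
Proof.
move=> sg rS cl; apply: (@cset_root _ _ r) => // x xS.
have /subsetP/(_ x xS) : S \subset cc g S r; last by rewrite inE => /andP[].
apply: cl; first exact: mem_cc.
by move=> u v uC uS vS uv; apply: cc_closed uv.
Qed.

Lemma cset_sub g S (W : {set T}) r : cset g S -> r \in S -> r \in W ->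
  (forall x y, x \in W -> x \in S -> y \in S -> g x y -> y \in W) -> S \subset W.
Proof.
move=> cS rS rW cl; apply/subsetP=> x xS; apply/negPn/negP=> xW.
have [u [v [uS uW vS /negP vW uv]]] := cset_cut cS rS rW xS xW.
by apply: vW; apply: (cl u).
Qed.

Lemma csetU g S U : symmetric g -> cset g S -> cset g U ->
  (exists2 x, x \in S & x \in U) \/ touch g S U -> cset g (S :|: U).
Proof.
move=> sg cS cU H.
have [x xS HH] : exists2 x, x \in S & (x \in U \/ exists2 y, y \in U & g x y).
  by case: H => [[x xS xU]|[x [y [xS yU xy]]]]; exists x => //; [left|right; exists y].
apply: (@csetP _ _ x) => //; first by rewrite inE xS.
move=> W xW cl; have sS : S \subset W.
  by apply: (cset_sub cS xS xW) => u v uW uS vS; apply: cl => //; rewrite inE ?uS ?vS.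
rewrite subUset sS /=.
have [y yU yW] : exists2 y, y \in U & y \in W.
  case: HH => [xU|[y yU xy]]; first by exists x.
  by exists y => //; apply: (cl x) => //; rewrite inE ?xS ?yU ?orbT.
by apply: (cset_sub cU yU yW) => u v uW uS vS; apply: cl => //; rewrite inE ?uS ?vS orbT.
Qed.

Lemma csetU1 g S x y : symmetric g -> cset g S -> y \in S -> g x y -> cset g (x |: S).
Proof.
move=> sg cS yS xy; apply: csetU => //; first exact: cset1.
by right; exists x, y; rewrite set11.
Qed.

Lemma cset_mono g g' S : (forall x y, x \in S -> y \in S -> g x y -> g' x y) ->
  cset g S -> cset g' S.
Proof. by move=> sg cS x y xS yS; apply: connect_ind_sub (cS x y xS yS). Qed.

Lemma cset2 g x y : symmetric g -> g x y -> cset g [set x; y].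
Proof. by move=> sg xy; apply: (@csetU1 _ _ _ y) => //; [exact: cset1 | rewrite set11]. Qed.

Lemma cc_max g S A x : cset g A -> x \in A -> A \subset S -> A \subset cc g S x.
Proof.
move=> cA xA sA; apply/subsetP=> y yA; rewrite inE (subsetP sA y yA).
exact: connect_ind_sub (cA x y xA yA).
Qed.

Lemma cc_touch g S x y : symmetric g -> cset g S -> x \in S -> y \in S -> x != y ->
  exists2 z, z \in cc g (S :\ y) x & g z y.
Proof.
move=> sg cS xS yS nxy.
have xC : x \in cc g (S :\ y) x by rewrite mem_cc // !inE nxy.
have yC : y \notin cc g (S :\ y) x by rewrite !inE eqxx.
have [u [v [uS uC vS vC uv]]] := cset_cut cS xS xC yS yC; exists u => //.
case: (eqVneq v y) => [<- //|vy]; case/negP: vC.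
by apply: cc_closed uv => //; rewrite !inE vy.
Qed.

(** The component of [x] is attached to the rest of [S] only at [y], so no vertex outside it needs
    the component to reach [y]. *)
Lemma cset_rest g S x y : symmetric g -> cset g S -> x \in S -> y \in S -> x != y ->
  cset g (S :\: cc g (S :\ y) x).
Proof.
move=> sg cS xS yS nxy; have [z] := cc_touch sg cS xS yS nxy.
have : forall u v, u \in cc g (S :\ y) x -> v \in S -> v != y -> g u v ->
    v \in cc g (S :\ y) x.
  by move=> u v uC vS vy; apply: cc_closed => //; rewrite !inE vy.
have : y \notin cc g (S :\ y) x by rewrite !inE eqxx.
move: (cc _ _ _) => C yC cC zC zy.
apply: (@csetP _ _ y) => //; first by rewrite inE yC.
move=> W yW cl; apply/subsetP=> t; rewrite inE => /andP[tC tS].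
suff : S \subset W :|: C by move/subsetP/(_ t tS); rewrite inE (negPf tC) orbF.
apply: (cset_sub cS yS); first by rewrite inE yW.
move=> u v; rewrite !inE => uWC uS vS uv.
case: (boolP (v \in C)) => vC; rewrite ?orbT ?orbF //.
case: (eqVneq v y) => [-> //|vy].
case: (boolP (u \in C)) uWC => uC; first by case/negP: vC; apply: (cC u).
by rewrite orbF => uW; apply: (cl u) => //; rewrite inE ?uC ?vC.
Qed.

(** The measure of all inductions over graphs: a vertex absorbed by a quotient becomes isolated and
    is no longer counted. *)
Definition nz g := #|[pred x | [exists y, g x y]]|.

(* The quotient by the fibres of an idempotent rho, on the same vertex type:
   the vertices outside the image of rho become isolated. *)
Definition ctr g (rho : T -> T) : rel T :=
  fun x y => (x != y) && [exists x', [exists y', [&& rho x' == x, rho y' == y & g x' y']]].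

Lemma ctrP g rho x y :
  reflect (x != y /\ exists x' y', [/\ rho x' = x, rho y' = y & g x' y']) (ctr g rho x y).
Proof.
apply: (iffP andP) => -[nxy H]; split=> //.
  by case/existsP: H => x' /existsP[y' /and3P[/eqP ? /eqP ? ?]]; exists x', y'.
case: H => x' [y' [<- <- xy]]; apply/existsP; exists x'; apply/existsP; exists y'.
by rewrite !eqxx.
Qed.

Lemma ctr_sym g rho : symmetric g -> symmetric (ctr g rho).
Proof.
by move=> sg x y; apply/ctrP/ctrP; rewrite eq_sym => -[nxy [u [v [? ? ?]]]];
  split=> //; exists v, u; rewrite sg.
Qed.

Lemma cset_image g rho S : cset g S -> cset (ctr g rho) (rho @: S).
Proof.
move=> cS _ _ /imsetP[x xS ->] /imsetP[y yS ->].
apply: (@connect_inv _ _ [pred z | connect (ind (ctr g rho) (rho @: S)) (rho x) (rho z)]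
         _ x y (cS x y xS yS)) => [u v /= xu|]; last exact: connect0.
case/and3P=> uS vS uv; apply: connect_trans xu _.
case: (eqVneq (rho u) (rho v)) => [->|nuv]; first exact: connect0.
apply: connect1; apply/and3P; split; [exact: imset_f|exact: imset_f|].
by apply/ctrP; split=> //; exists u, v.
Qed.

Lemma cset_preimage g rho S : symmetric g -> cset (ctr g rho) S ->
  (forall x, x \in S -> rho x = x) ->
  (forall x, x \in S -> cset g [set y | rho y == x]) -> cset g (rho @^-1: S).
Proof.
move=> sg cS rS cf x y; rewrite !inE => xS yS.
apply: (@connect_trans _ _ (rho x)).
  apply: (@connect_ind_sub g _ [set y | rho y == rho x]) => //.
    by apply/subsetP=> z; rewrite !inE => /eqP->.
  by apply: (cf (rho x)) => //; rewrite inE ?eqxx ?(rS _ xS) ?eqxx.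
(* Reachability is carried for a whole fibre at once, because an edge of the quotient lifts to an
   edge between unspecified members of two fibres. *)
pose Q := [pred z | (z \in S) && [forall t, (rho t == z) ==> connect (ind g (rho @^-1: S)) (rho x) t]].
suff /andP[_ /forallP/(_ y)] : Q (rho y) by rewrite eqxx.
apply: (@connect_inv _ _ Q _ (rho x) (rho y) (cS _ _ xS yS)).
  move=> u v /andP[uS /forallP Hu] /and3P[_ vS /ctrP[_ [u' [v' [eu ev uv]]]]].
  rewrite /Q /= vS; apply/forallP=> t; apply/implyP=> /eqP et.
  apply: (@connect_trans _ _ u'); first by move: (Hu u'); rewrite eu eqxx.
  apply: (@connect_trans _ _ v').
    by apply: connect1; apply/and3P; rewrite !inE eu ev.
  apply: (@connect_ind_sub g _ [set y | rho y == v]) => //.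
    by apply/subsetP=> z; rewrite !inE => /eqP->.
  by apply: (cf v vS); rewrite inE ?ev ?et ?eqxx.
rewrite /Q /= xS; apply/forallP=> t; apply/implyP=> /eqP et.
apply: (@connect_ind_sub g _ [set y | rho y == rho x]) => //.
  by apply/subsetP=> z; rewrite !inE => /eqP->.
by apply: (cf (rho x)) => //; rewrite inE ?et ?(rS _ xS) ?eqxx.
Qed.

(** A vertex with a neighbour in the quotient had one before: it is an end of the lifted edge, or
    its connected fibre has a second element. The moved vertex [j] loses all its edges. *)
Lemma nz_ctr g rho j : symmetric g -> (forall x, rho (rho x) = rho x) ->
  (forall x, cset g [set y | rho y == rho x]) -> rho j != j -> nz (ctr g rho) < nz g.
Proof.
move=> sg rr cf rj; apply: proper_card; apply/properP; split.
  apply/subsetP=> x /existsP[y /ctrP[nxy [x' [y' [ex ey xy]]]]].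
  apply/existsP; case: (eqVneq x x') => [->|nx]; first by exists y'.
  have xS : x \in [set y | rho y == rho x'] by rewrite inE -ex rr.
  have := cset_cut (cf x') xS (set11 x) (v := x'); rewrite !inE eqxx eq_sym nx.
  case=> // u [v [_ /set1P-> _ _ uv]]; by exists v.
have jS : j \in [set y | rho y == rho j] by rewrite inE.
have := cset_cut (cf j) jS (set11 j) (v := rho j); rewrite !inE rr eqxx rj.
case=> // u [v [_ /set1P-> _ _ uv]]; exists j; first by apply/existsP; exists v.
apply/negP=> /existsP[y /ctrP[_ [x' [y' [ex _ _]]]]].
by case/negP: rj; rewrite -ex rr.
Qed.


Section EdgeRho.
Variables (g : rel T) (x y : T).
Hypotheses (sg : symmetric g) (gxy : g x y) (nxy : x != y).

Definition erho z := if z == y then x else z.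

Lemma erho_y : erho y = x. Proof. by rewrite /erho eqxx. Qed.

Lemma erho_n z : z != y -> erho z = z. Proof. by rewrite /erho => /negPf->. Qed.

Lemma erho_idem z : erho (erho z) = erho z.
Proof.
case: (eqVneq z y) => [->|zy]; first by rewrite erho_y (erho_n nxy).
by rewrite (erho_n zy) (erho_n zy).
Qed.

Lemma erho_fib z : cset g [set t | erho t == erho z].
Proof.
case: (eqVneq (erho z) x) => [->|nx].
  have -> : [set t | erho t == x] = [set x; y]; last exact: cset2.
  apply/setP=> t; rewrite !inE /erho; case: (eqVneq t y) => [|ty]; rewrite ?eqxx ?orbT ?orbF //.
have zy : z != y by apply: contraNneq nx => ->; rewrite erho_y.
rewrite erho_n // in nx *.
have -> : [set t | erho t == z] = [set z]; last exact: cset1.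
apply/setP=> t; rewrite !inE /erho; case: (eqVneq t y) => [->|//].
by rewrite eq_sym (negPf nx) eq_sym (negPf zy).
Qed.

Lemma nz_erho : nz (ctr g erho) < nz g.
Proof.
by apply: (@nz_ctr _ _ y) => //; [exact: erho_idem|exact: erho_fib|rewrite erho_y].
Qed.
End EdgeRho.

End Sets.

(** * Schemes and rooted minors *)

Section SchemeMinor.
Variables (TH : finType) (h : rel TH).

(* A path is replaced by any connected set containing its ends, so that schemes
   are closed under contraction. *)
Record scheme (T : finType) (g : rel T) (iota : TH -> T) (S : TH -> TH -> {set T}) : Prop := {
  sch_sym : forall u v, S u v = S v u;
  sch_end : forall u v, h u v -> iota u \in S u v;
  sch_con : forall u v, h u v -> cset g (S u v);
  sch_root : forall u v w, h u v -> iota w \in S u v -> w = u \/ w = v;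
  sch_lab : forall x u v, h u v -> x \in S u v ->
    exists w, forall u' v', h u' v' -> x \in S u' v' -> w = u' \/ w = v' }.

Record is_minor (T : finType) (g : rel T) (iota : TH -> T) (C : TH -> {set T}) : Prop := {
  min_root : forall v, iota v \in C v;
  min_con : forall v, cset g (C v);
  min_dis : forall u v x, x \in C u -> x \in C v -> u = v;
  min_adj : forall u v, h u v -> touch g (C u) (C v) }.

Arguments sch_con [T g iota S] _ [u v] _.
Arguments min_con [T g iota C] _ v.
Arguments min_root [T g iota C] _ v.

Definition has_minor (T : finType) (g : rel T) (iota : TH -> T) : Prop :=
  exists C, is_minor g iota C.

(** Contractibility in generalised form; schemes of paths are the special case treated in
    [good_contractible]. *)
Definition good : Prop := forall (T : finType) (g : rel T) iota S,
  symmetric g -> injective iota -> scheme g iota S -> has_minor g iota.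

Section Ctr.
Variables (T : finType) (g : rel T) (iota : TH -> T) (rho : T -> T).
Hypotheses (sg : symmetric g) (rr : forall x, rho (rho x) = rho x)
  (cf : forall x, cset g [set y | rho y == rho x]) (ri : forall v, rho (iota v) = iota v).

(** The two extra hypotheses ask that the members of a fibre admit one label together, and that an
    edge of [h] whose set meets the fibre of a root is incident with that root. *)
Lemma scheme_ctr S : scheme g iota S ->
  (forall x u v, h u v -> x \in S u v -> exists w, forall u' v' y,
     h u' v' -> y \in S u' v' -> rho y = rho x -> w = u' \/ w = v') ->
  (forall x u v w, h u v -> x \in S u v -> rho x = iota w -> w = u \/ w = v) ->
  scheme (ctr g rho) iota (fun u v => rho @: S u v).
Proof.
move=> sS L R; split.
- by move=> u v; rewrite (sch_sym sS).
- by move=> u v huv; rewrite -ri imset_f ?(sch_end sS).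
- by move=> u v huv; apply/cset_image/(sch_con sS).
- by move=> u v w huv /imsetP[x xS e]; apply: (R x).
move=> _ u v huv /imsetP[x xS ->]; have [w Hw] := L x u v huv xS.
by exists w => u' v' huv' /imsetP[y yS e]; apply: (Hw u' v' y).
Qed.

Lemma minor_ctr C : is_minor (ctr g rho) iota C ->
  is_minor g iota (fun v => rho @^-1: C v).
Proof.
move=> mC; split.
- by move=> v; rewrite inE ri (min_root mC).
(* A member other than the root has an edge in the quotient, hence is a value of [rho]. *)
- move=> v; have rC x : x \in C v -> rho x = x.
    move=> xC; case: (eqVneq x (iota v)) => [->//|nx].
    have := cset_cut (min_con mC v) xC (set11 x) (min_root mC v).
    rewrite !inE eq_sym nx => /(_ isT)[y [z [_ /set1P-> _ _ /ctrP[_ [x' [y' [<- _ _]]]]]]].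
    by rewrite rr.
  apply: cset_preimage => //; first exact: (min_con mC).
  by move=> x xC; rewrite -{1}(rC x xC); apply: cf.
- by move=> u v x; rewrite !inE; apply: (min_dis mC).
move=> u v huv; have [x [y [xC yC /ctrP[_ [x' [y' [ex ey xy]]]]]]] := min_adj mC huv.
by exists x', y'; rewrite !inE ex ey.
Qed.
End Ctr.

Lemma scheme_sub (T : finType) (g : rel T) iota S (S' : TH -> TH -> {set T}) : scheme g iota S ->
  (forall u v, S' u v = S' v u) -> (forall u v, h u v -> S' u v \subset S u v) ->
  (forall u v, h u v -> iota u \in S' u v) -> (forall u v, h u v -> cset g (S' u v)) ->
  scheme g iota S'.
Proof.
move=> sS s1 s2 s3 s4; split=> // [u v w|x u v] huv xS.
  by apply: (sch_root sS huv); apply: (subsetP (s2 _ _ huv)).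
have [w Hw] := sch_lab sS huv (subsetP (s2 _ _ huv) _ xS); exists w => u' v' huv' xS'.
by apply: Hw => //; apply: (subsetP (s2 _ _ huv')).
Qed.

Lemma scheme_edges (T : finType) (g g' : rel T) iota S : scheme g iota S ->
  (forall u v x y, h u v -> x \in S u v -> y \in S u v -> g x y -> g' x y) ->
  scheme g' iota S.
Proof.
move=> sS gg; split; [exact: (sch_sym sS)|exact: (sch_end sS)| |exact: (sch_root sS)|exact: (sch_lab sS)].
by move=> u v huv; apply: cset_mono (sch_con sS huv) => x y; apply: gg.
Qed.

Lemma minor_edges (T : finType) (g g' : rel T) iota C : subrel g g' ->
  is_minor g iota C -> is_minor g' iota C.
Proof.
move=> gg mC; split; [exact: (min_root mC)| |exact: (min_dis mC)|].
  by move=> v; apply: cset_mono (min_con mC v) => x y _ _; apply: gg.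
by move=> u v /(min_adj mC)[x [y [xC yC xy]]]; exists x, y; split=> //; apply: gg.
Qed.

(** Vertices are deleted by removing their edges. This controls what remains of them: a deleted
    vertex occurs in a branch set only as its root. *)
Lemma minor_isolated (T : finType) (g : rel T) iota C v x : is_minor g iota C ->
  (forall y, ~~ g y x) -> x \in C v -> x = iota v.
Proof.
move=> mC ix xC; apply/eqP/negPn/negP=> nx.
have [y [z [yC yW zC zW yz]]] := cset_cut (W := ~: [set x]) (min_con mC v) (min_root mC v)
  (ltac:(by rewrite !inE eq_sym)) xC (ltac:(by rewrite !inE eqxx)).
by move: zW; rewrite !inE negbK => /eqP ez; case/negP: (ix y); rewrite -ez.
Qed.

Definition step_ok (T : finType) (g : rel T) : Prop :=
  forall (g' : rel T) iota S, nz g' < nz g -> symmetric g' -> injective iota ->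
  scheme g' iota S -> has_minor g' iota.

Lemma good_ind : (forall (T : finType) (g : rel T) iota S,
  symmetric g -> injective iota -> scheme g iota S -> step_ok g -> has_minor g iota) -> good.
Proof.
move=> H T g iota S; have [n] := ubnP (nz g).
elim: n g iota S => // n IH g iota S ng sg ii sS; apply: (H T g iota S) => //.
move=> g' iota' S' lg sg' ii' sS'; apply: (IH g' iota' S') => //.
by rewrite (leq_trans lg) // -ltnS.
Qed.

(** The working form of minimality: the edge [x y] can be contracted as soon as both ends admit the
    label [w]. The absorbed end [y] must not be a root, and [x] may only be the root of [w]. *)
Lemma edge_contract (T : finType) (g : rel T) iota S x y w : symmetric g -> injective iota ->
  scheme g iota S -> step_ok g -> g x y -> x != y -> (forall v, iota v != y) ->
  (forall r, iota r = x -> r = w) ->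
  (forall u v, h u v -> (x \in S u v) || (y \in S u v) -> w = u \/ w = v) ->
  has_minor g iota.
Proof.
move=> sg ii sS ok gxy nxy ny rx lab.
have ri v : erho x y (iota v) = iota v by apply/erho_n/ny.
have lab2 z u v : h u v -> z \in S u v -> erho x y z = x -> w = u \/ w = v.
  move=> huv zS rz; apply: lab => //; move: rz; rewrite /erho.
  by case: (eqVneq z y) => [<- _|_ <-]; rewrite zS ?orbT.
have [||C mC] := ok (ctr g (erho x y)) iota (fun u v => erho x y @: S u v) _
    (ctr_sym (erho x y) sg) ii.
- exact: nz_erho.
- apply: scheme_ctr => // [z u v huv zS|z u v r huv zS rz].
    case: (eqVneq (erho x y z) x) => [->|zx].
      by exists w => u' v' t huv' tS; apply: lab2.
    have [r Hr] := sch_lab sS huv zS; exists r => u' v' t huv' tS tz.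
    apply: Hr => //; suff -> : z = t by [].
    have ne s : erho x y s != x -> s != y by apply: contraNneq => ->; rewrite erho_y.
    by rewrite -(erho_n x (ne z zx)) -tz erho_n //; apply: ne; rewrite tz.
  case: (eqVneq (erho x y z) x) => [e|zx].
    by rewrite (rx r); [exact: (lab2 z)|rewrite -rz].
  apply: (sch_root sS huv); rewrite -rz erho_n //.
  by apply: contraNneq zx => ->; rewrite erho_y.
by exists (fun v => erho x y @^-1: C v); apply: minor_ctr => //;
  [exact: erho_idem|exact: erho_fib].
Qed.
End SchemeMinor.

Arguments sch_con [TH h T g iota S] _ [u v] _.
Arguments min_con [TH h T g iota C] _ v.
Arguments min_root [TH h T g iota C] _ v.

Lemma scheme_pull (TH0 TH T : finType) (e : TH0 -> TH) (h0 : rel TH0) (h : rel TH)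
  (g : rel T) iota S : injective e -> (forall x y, h0 x y -> h (e x) (e y)) ->
  scheme h g iota S -> scheme h0 g (iota \o e) (fun x y => S (e x) (e y)).
Proof.
move=> ie sub sS; split=> [x y|x y|x y|x y w|t x y] /=.
- exact: (sch_sym sS).
- by move/sub/(sch_end sS).
- by move/sub; apply: (sch_con sS).
- by move/sub => hxy /(sch_root sS hxy)[/ie|/ie]; auto.
move/sub => hxy tS; have [w Hw] := sch_lab sS hxy tS.
have [x0 ex0] : exists x0, e x0 = w by case: (Hw _ _ hxy tS) => ->; [exists x|exists y].
exists x0 => x' y' /sub hxy' /(Hw _ _ hxy'); rewrite -ex0.
by case=> /ie; auto.
Qed.

Section Mono.
Variables (TH : finType) (h h' : rel TH).
Hypotheses (sh : symmetric h) (ih : irreflexive h) (sh' : symmetric h') (hh : subrel h' h).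

(** Each surplus edge of [h] is realised by a new edge between its two roots. Such an edge does not
    help a minor of [h']: inside a branch set it would bring two roots together, and between two
    branch sets it only serves the surplus edge. *)
Lemma good_mono : good h -> good h'.
Proof.
move=> gh T g iota S sg ii sS.
pose new (x y : T) := [exists u, [exists v, [&& h u v, ~~ h' u v, iota u == x & iota v == y]]].
have newP x y : reflect (exists u v, [/\ h u v, ~~ h' u v, iota u = x & iota v = y]) (new x y).
  apply: (iffP existsP) => [[u /existsP[v /and4P[? ? /eqP ? /eqP ?]]]|[u [v [? ? <- <-]]]].
    by exists u, v.
  by exists u; apply/existsP; exists v; apply/and4P.
have snew : symmetric new.
  by move=> x y; apply/newP/newP => -[u [v [? ? ? ?]]]; exists v, u; rewrite sh sh'.
pose g' : rel T := fun x y => g x y || new x y.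
have sg' : symmetric g' by move=> x y; rewrite /g' sg snew.
pose S' u v := if h' u v then S u v else [set iota u; iota v].
have [|C mC] := gh T g' iota S' sg' ii.
  split.
  - by move=> u v; rewrite /S' sh' (sch_sym sS) setUC.
  - by move=> u v huv; rewrite /S'; case: ifP => h'uv; rewrite ?set21 // (sch_end sS).
  - move=> u v huv; rewrite /S'; case: ifP => h'uv.
      by apply: cset_mono (sch_con sS h'uv) => x y _ _ xy; rewrite /g' xy.
    by apply: cset2 => //; apply/orP; right; apply/newP; exists u, v; rewrite h'uv.
  - move=> u v w huv; rewrite /S'; case: ifP => h'uv; first exact: (sch_root sS).
    by case/set2P=> /ii; auto.
  move=> x u v huv xS.
  have aux u' v' : h u' v' -> x \in S' u' v' -> (exists w, iota w = x) \/ h' u' v' /\ x \in S u' v'.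
    by rewrite /S'; case: ifP => h'uv' _; [right|case/set2P=> ->; left; [exists u'|exists v']].
  case: (pickP (fun w => iota w == x)) => [w /eqP ew|nw].
    exists w => u' v' huv'; rewrite -ew /S'; case: ifP => h'uv'; first exact: (sch_root sS).
    by case/set2P=> /ii; auto.
  have aux' u' v' : h u' v' -> x \in S' u' v' -> h' u' v' /\ x \in S u' v'.
    by move=> a b; case: (aux u' v' a b) => // -[w ew]; have := nw w; rewrite ew eqxx.
  have [h'uv xS'] := aux' u v huv xS; have [w Hw] := sch_lab sS h'uv xS'.
  by exists w => u' v' huv' /(aux' u' v' huv')[]; apply: Hw.
have noin v x y : x \in C v -> y \in C v -> ~~ new x y.
  move=> xC yC; apply/negP=> /newP[u [w [huw _ eu ew]]].
  have e1 : u = v by apply: (min_dis mC (min_root mC u)); rewrite eu.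
  have e2 : w = v by apply: (min_dis mC (min_root mC w)); rewrite ew.
  by move: huw; rewrite e1 e2 ih.
exists C; split; [exact: (min_root mC)| |exact: (min_dis mC)|].
  move=> v; apply: cset_mono (min_con mC v) => x y xC yC /orP[//|].
  by rewrite (negPf (noin v x y xC yC)).
move=> u v huv; have [x [y [xC yC /orP[xy|/newP[u' [v' [_ nh eu ev]]]]]]] := min_adj mC (hh huv).
  by exists x, y.
have e1 : u' = u by apply: (min_dis mC (min_root mC u')); rewrite eu.
have e2 : v' = v by apply: (min_dis mC (min_root mC v')); rewrite ev.
by move: nh; rewrite e1 e2 huv.
Qed.
End Mono.

Section Embed.
Variables (TH0 TH : finType) (h0 : rel TH0) (e : TH0 -> TH).
Hypothesis ie : injective e.

Definition push_rel : rel TH := fun u v =>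
  [exists x, [exists y, [&& h0 x y, e x == u & e y == v]]].

Lemma push_relP u v : reflect (exists x y, [/\ h0 x y, e x = u & e y = v]) (push_rel u v).
Proof.
apply: (iffP existsP) => [[x /existsP[y /and3P[? /eqP ? /eqP ?]]]|[x [y [? <- <-]]]].
  by exists x, y.
by exists x; apply/existsP; exists y; apply/and3P.
Qed.

Lemma good_embed : good h0 -> good push_rel.
Proof.
move=> gh T g iota S sg ii sS.
(* Roots outside the image of [e] are deleted before the minor is taken, and then become branch sets
   of one vertex. *)
pose ok (t : T) := ~~ [exists v, (v \notin codom e) && (iota v == t)].
pose g' : rel T := fun x y => [&& g x y, ok x & ok y].
have sg' : symmetric g' by move=> x y; rewrite /g' sg [ok x && _]andbC.
have pushE x y : h0 x y -> push_rel (e x) (e y) by move=> xy; apply/push_relP; exists x, y.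
have sS0 := scheme_pull ie pushE sS.
have okS u v t : push_rel u v -> t \in S u v -> ok t.
  move=> uv tS; apply/existsPn=> w; apply/negP=> /andP[wn /eqP ew].
  have := uv => /push_relP[x [y [_ ex ey]]]; move: tS; rewrite -ew => /(sch_root sS uv).
  by case=> ewv; case/negP: wn; rewrite ewv -?ex -?ey codom_f.
have [||C0 mC0] := gh T g' (iota \o e) (fun x y => S (e x) (e y)) sg'.
- exact: inj_comp.
- apply: (scheme_edges sS0) => x y s t /pushE xy sS' tS' st.
  by rewrite /g' st !(okS _ _ _ xy).
pose C v := if [pick x | e x == v] is Some x then C0 x else [set iota v].
have Ce x : C (e x) = C0 x.
  by rewrite /C; case: pickP => [y /eqP/ie->//|/(_ x)]; rewrite eqxx.
have Cn v : v \notin codom e -> C v = [set iota v].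
  by move=> vn; rewrite /C; case: pickP => // x /eqP ex; case/negP: vn; rewrite -ex codom_f.
have C0ok x t : t \in C0 x -> ok t.
  move=> tC; case: (boolP (ok t)) => // nt.
  have et : t = iota (e x) by apply: (minor_isolated mC0) tC => s; rewrite /g' (negPf nt) !andbF.
  case/negP: nt; apply/existsPn=> w; apply/negP=> /andP[wn /eqP ew].
  by case/negP: wn; rewrite (ii w (e x)) ?codom_f // ew.
have sub : subrel g' g by move=> s t /and3P[].
have mC := minor_edges sub mC0.
have vP v : (exists x, v = e x) \/ v \notin codom e.
  by case: (boolP (v \in codom e)) => [/codomP[x ->]|]; [left; exists x|right].
exists C; split.
- by move=> v; case: (vP v) => [[x ->]|vn]; rewrite ?Ce ?Cn ?set11 //; apply: (min_root mC).
- by move=> v; case: (vP v) => [[x ->]|vn]; rewrite ?Ce ?Cn //; [apply: (min_con mC)|apply: cset1].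
- move=> u v t; case: (vP u) => [[x ->]|un]; case: (vP v) => [[y ->]|vn]; rewrite ?Ce ?(Cn _ un) ?(Cn _ vn).
  + by move=> t1 t2; rewrite (min_dis mC t1 t2).
  + by move=> /C0ok ot /set1P et; case/negP: ot; apply/existsP; exists v; rewrite vn et eqxx.
  + by move=> /set1P et /C0ok ot; case/negP: ot; apply/existsP; exists u; rewrite un et eqxx.
  + by move=> /set1P-> /set1P/ii.
by move=> u v /push_relP[x [y [xy <- <-]]]; rewrite !Ce; apply: (min_adj mC).
Qed.
End Embed.

(** * Matroid union *)

Section MatroidUnion.
Variable T : finType.
Implicit Types (F E A B : {set T}) (r : {set T} -> nat).

Definition submodular r : Prop := forall F E, r (F :|: E) + r (F :&: E) <= r F + r E.
Definition monotone r : Prop := forall F E, F \subset E -> r F <= r E.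

(** [S] and [U] hold the elements already assigned to the two sides. If both choices for [e] violate
    the bound, with witnesses [F1] and [F2], uncross these into [e |: (F1 :|: F2)] and [F1 :&: F2]:
    by submodularity the ranks do not grow, the cardinality terms grow by one, and the two
    violations leave a gap of two, a contradiction. *)
Lemma matroid_split_rec ra rb n (R S U : {set T}) :
  submodular ra -> submodular rb -> monotone ra -> monotone rb ->
  (forall F, F \subset R -> n <= #|R :\: F| + ra (F :|: S) + rb (F :|: U)) ->
  exists2 A : {set T}, A \subset R & n <= ra (A :|: S) + rb ((R :\: A) :|: U).
Proof.
move=> suba subb ma mb; have [m] := ubnP #|R|.
elim: m R S U => // m IH R S U Rm H.
case: (set_0Vmem R) => [R0|[e eR]].
  exists set0; rewrite ?sub0set //; have := H set0 (sub0set _).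
  by rewrite R0 setD0 cards0.
have cR := cardsD1 e R; rewrite eR in cR.
have Re : #|R :\ e| < m by lia.
case: (boolP [forall F : {set T}, (F \subset R :\ e) ==>
    (n <= #|(R :\ e) :\: F| + ra (F :|: (e |: S)) + rb (F :|: U))]) => [/forallP Ha|].
  have [|A sA HA] := IH (R :\ e) (e |: S) U Re.
    by move=> F sF; have := Ha F; rewrite sF.
  exists (e |: A).
    by apply/subsetP=> x /setU1P[->//|/(subsetP sA)]; rewrite inE => /andP[].
  apply: leq_trans HA _; apply: leq_add.
    by apply: ma; apply/subsetP=> x; rewrite !inE; case: (x == e); do ?case: (_ \in _).
  apply: mb; apply/subsetP=> x; rewrite !inE.
  by case: (x == e); do ?case: (_ \in _).
case/forallPn=> F1; rewrite negb_imply => /andP[sF1]; rewrite -ltnNge => L1.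
case: (boolP [forall F : {set T}, (F \subset R :\ e) ==>
    (n <= #|(R :\ e) :\: F| + ra (F :|: S) + rb (F :|: (e |: U)))]) => [/forallP Hb|].
  have [|A sA HA] := IH (R :\ e) S (e |: U) Re.
    by move=> F sF; have := Hb F; rewrite sF.
  exists A; first by apply: subset_trans sA (subsetDl _ _).
  apply: leq_trans HA _; rewrite leq_add2l.
  apply: mb; apply/subsetP=> x; rewrite !inE.
  case: (eqVneq x e) => [->|_]; last by do ?case: (_ \in _).
  by rewrite eR; move: (subsetP sA e); rewrite !inE eqxx /=; case: (e \in A) => // /(_ isT).
case/forallPn=> F2; rewrite negb_imply => /andP[sF2]; rewrite -ltnNge => L2.
have sU : e |: (F1 :|: F2) \subset R.
  apply/subsetP=> x /setU1P[->//|/setUP[/(subsetP sF1)|/(subsetP sF2)]];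
  by rewrite inE => /andP[].
have sI : F1 :&: F2 \subset R.
  by apply/subsetP=> x /setIP[/(subsetP sF1)]; rewrite inE => /andP[].
have HU := H _ sU; have HI := H _ sI.
have S1 : ra ((e |: (F1 :|: F2)) :|: S) + ra ((F1 :&: F2) :|: S) <=
          ra (F1 :|: (e |: S)) + ra (F2 :|: S).
  apply: leq_trans (suba _ _); apply: leq_add; apply: ma; apply/subsetP=> x;
  by rewrite !inE; case: (x == e); do ?case: (_ \in _).
have S2 : rb ((e |: (F1 :|: F2)) :|: U) + rb ((F1 :&: F2) :|: U) <=
          rb (F1 :|: U) + rb (F2 :|: (e |: U)).
  apply: leq_trans (subb _ _); apply: leq_add; apply: mb; apply/subsetP=> x;
  by rewrite !inE; case: (x == e); do ?case: (_ \in _).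
have eF : e \notin F1 :|: F2.
  apply/negP=> /setUP[/(subsetP sF1)|/(subsetP sF2)]; by rewrite !inE eqxx.
have c1 := cardsD (R :\ e) F1; have c2 := cardsD (R :\ e) F2.
have c3 := cardsD R (e |: (F1 :|: F2)); have c4 := cardsD R (F1 :&: F2).
rewrite (setIidPr sF1) in c1; rewrite (setIidPr sF2) in c2.
rewrite (setIidPr sU) cardsU1 eF in c3; rewrite (setIidPr sI) in c4.
have c5 := cardsUI F1 F2.
have := subset_leq_card sF1; have := subset_leq_card sF2.
have := subset_leq_card sU; have := subset_leq_card sI.
rewrite cardsU1 eF; lia.
Qed.

Lemma matroid_split ra rb E :
  submodular ra -> submodular rb -> monotone ra -> monotone rb ->
  (forall F, F \subset E -> ra E + rb E <= #|E :\: F| + ra F + rb F) ->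
  exists A : {set T}, [/\ A \subset E, ra A = ra E & rb (E :\: A) = rb E].
Proof.
move=> suba subb ma mb H.
have [|A sA] := @matroid_split_rec ra rb (ra E + rb E) E set0 set0 suba subb ma mb.
  by move=> F sF; rewrite !setU0; apply: H.
rewrite !setU0 => HA; exists A.
have := ma _ _ sA; have := mb _ _ (subsetDl E A) => h1 h2.
by split=> //; lia.
Qed.

(** Take [B] in [D] maximal independent over [F]; then [r E - r F] is at most [#|B|]. The part of
    [B] in [X i] lies in the span of [F] and [Ei i], so it has at most [#|Ei i :\: F|] elements.
    Summing over the disjoint [Ei i] counts every element of [B] at least twice. *)
Lemma double_span_count (I : finType) r (D E : {set T}) (X Ei : I -> {set T}) :
  submodular r -> monotone r -> (forall x (F : {set T}), r (x |: F) <= (r F).+1) ->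
  r (D :|: E) = r D ->
  (forall i, r (X i :|: Ei i) = r (Ei i)) ->
  (forall i, Ei i \subset E) ->
  (forall i j x, x \in Ei i -> x \in Ei j -> i = j) ->
  (forall x, x \in D -> 1 < #|[set i | x \in X i]|) ->
  forall F : {set T}, F \subset E -> 2 * (r E - r F) <= #|E :\: F|.
Proof.
move=> sr mr r1 rD rX sE dE twoX F sF.
have UD A B : A :|: (B :\: A) = A :|: B by apply/setP=> x; rewrite !inE; case: (x \in A).
have rU A B : r (A :|: B) <= r A + #|B|.
  have [n] := ubnP #|B|; elim: n A B => // n IH A B Bn.
  case: (set_0Vmem B) => [->|[e eB]]; first by rewrite setU0 leq_addr.
  have cB := cardsD1 e B; rewrite eB in cB.
  have -> : A :|: B = e |: (A :|: B :\ e).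
    by apply/setP=> x; rewrite !inE; case: eqVneq => [->|]; rewrite ?eB ?orbT.
  by apply: leq_trans (r1 _ _) _; have := IH A (B :\ e); lia.
pose ok (B : {set T}) := (B \subset D) && (r (F :|: B) == r F + #|B|).
have ok0 : ok set0 by rewrite /ok sub0set setU0 cards0 addn0 eqxx.
have [B /maxsetP[/andP[sB /eqP rB] maxB] _] := maxset_exists ok0.
have rFD : r (F :|: D) = r (F :|: B).
  suff H : forall A : {set T}, A \subset D -> r (F :|: B :|: A) = r (F :|: B).
    by rewrite -(H D (subxx _)) -setUA (setUidPr sB).
  move=> A; have [n] := ubnP #|A|; elim: n A => // n IH A An sA.
  case: (set_0Vmem A) => [->|[e eA]]; first by rewrite setU0.
  have cA := cardsD1 e A; rewrite eA in cA.
  have IHe : r (F :|: B :|: A :\ e) = r (F :|: B).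
    by apply: IH; [lia|apply: subset_trans (subsetDl _ _) sA].
  have re : r (e |: (F :|: B)) = r (F :|: B).
    have m1 : r (F :|: B) <= r (e |: (F :|: B)) by apply: mr; apply: subsetUr.
    apply/eqP; rewrite eqn_leq m1 andbT leqNgt; apply/negP=> lt.
    have eB : e \notin B.
      apply/negP=> eB; move: lt; have -> : e |: (F :|: B) = F :|: B.
        by apply/setUidPr; rewrite sub1set inE eB orbT.
      by rewrite ltnn.
    have := maxB (e |: B); rewrite /ok subUset sub1set (subsetP sA e eA) sB /=.
    have -> : F :|: (e |: B) = e |: (F :|: B) by rewrite setUCA.
    rewrite cardsU1 eB; have := r1 e (F :|: B) => le1.
    have -> : r (e |: (F :|: B)) == r F + (1 + #|B|) by lia.
    move=> /(_ isT (subsetUr _ _)) eq; case/negP: eB; by rewrite -eq setU11.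
  apply/eqP; rewrite eqn_leq (mr (F :|: B)) ?subsetUl // andbT.
  have := sr (e |: (F :|: B)) (F :|: B :|: A :\ e); rewrite re IHe.
  have -> : (e |: (F :|: B)) :|: (F :|: B :|: A :\ e) = F :|: B :|: A.
    apply/setP=> x; rewrite !inE; case: (eqVneq x e) => [->|]; rewrite ?eA ?orbT //=.
    by do ?case: (_ \in _).
  have : r (F :|: B) <= r ((e |: (F :|: B)) :&: (F :|: B :|: A :\ e)).
    by apply: mr; rewrite subsetI subsetUr subsetUl.
  by lia.
have hE : r E <= r F + #|B|.
  rewrite -rB -rFD; apply: (leq_trans (mr E (D :|: E) (subsetUr _ _))).
  by rewrite rD; apply: mr; apply: subsetUr.
have her A : A \subset B -> r (F :|: A) = r F + #|A|.
  move=> sA; apply/eqP; rewrite eqn_leq rU /=.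
  have := rU (F :|: A) (B :\: A); rewrite -setUA UD (setUidPr sA).
  by rewrite rB cardsD (setIidPr sA); have := subset_leq_card sA; lia.
have perI i : #|B :&: X i| <= #|Ei i :\: F|.
  have e1 := her (B :&: X i) (subsetIl _ _).
  have l1 : r (F :|: (B :&: X i)) <= r (F :|: (X i :|: Ei i)).
    by apply: mr; rewrite setUS // subsetU // subsetIr.
  have l2 : r (F :|: (X i :|: Ei i)) <= r (F :|: Ei i).
    have := sr (F :|: Ei i) (X i :|: Ei i); rewrite rX.
    have -> : F :|: Ei i :|: (X i :|: Ei i) = F :|: (X i :|: Ei i).
      by apply/setP=> x; rewrite !inE; do ?case: (_ \in _).
    have : r (Ei i) <= r ((F :|: Ei i) :&: (X i :|: Ei i)).
      by apply: mr; rewrite subsetI !subsetUr.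
    by lia.
  have := rU F (Ei i :\: F); rewrite UD.
  by lia.
have dbl : 2 * #|B| <= \sum_i #|B :&: X i|.
  have -> : \sum_i #|B :&: X i| = \sum_(x in B) #|[set i | x \in X i]|.
    transitivity (\sum_i \sum_(x in B | x \in X i) 1).
      by apply: eq_bigr => i _; rewrite sum1_card; apply: eq_card => x; rewrite !inE.
    rewrite (exchange_big_dep (mem B)) /=; last by move=> i x _ /andP[].
    apply: eq_bigr => x xB; rewrite sum1_card; apply: eq_card => i.
    by rewrite !inE [x \in B]xB.
  rewrite mulnC -sum_nat_const; apply: leq_sum => x xB.
  by apply: twoX; apply: (subsetP sB).
have tot : \sum_i #|Ei i :\: F| <= #|E :\: F|.
  have -> : \sum_i #|Ei i :\: F| = #|\bigcup_i (Ei i :\: F)|.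
    rewrite -sum1_card partition_disjoint_bigcup.
      by apply: eq_bigr => i _; rewrite sum1_card.
    move=> i j nij; rewrite -setI_eq0; apply/eqP/setP=> x; rewrite !inE.
    case: (boolP (x \in Ei i)) => xi; rewrite ?andbF //=.
    by case: (boolP (x \in Ei j)) => xj; rewrite ?andbF //; case/eqP: nij; apply: (dE i j x).
  by apply: subset_leq_card; apply/bigcupsP=> i _; apply: setSD; apply: sE.
apply: leq_trans (leq_trans (leq_trans _ dbl) (leq_sum _ (fun i _ => perI i))) tot.
by rewrite leq_mul2l /=; lia.
Qed.
End MatroidUnion.

(** * The rank function of a family of rational vectors *)

Section LinearRank.
Variables (T : finType) (n : nat) (vec : T -> 'rV[rat]_n).
Implicit Types (F A : {set T}).
Import GRing.Theory.

Definition vspan F := (\sum_(x in F) <<vec x>>)%MS.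
Definition vrank F := \rank (vspan F).

Lemma vec_span F x : x \in F -> (vec x <= vspan F)%MS.
Proof. by move=> xF; rewrite /vspan (sumsmx_sup x) // genmxE. Qed.

Lemma vspan_sub F m (M : 'M_(m, n)) : (forall x, x \in F -> (vec x <= M)%MS) -> (vspan F <= M)%MS.
Proof. by move=> H; apply/sumsmx_subP => x xF; rewrite genmxE H. Qed.

Lemma vspan_mono F A : F \subset A -> (vspan F <= vspan A)%MS.
Proof. by move=> /subsetP s; apply: vspan_sub => x /s; apply: vec_span. Qed.

Lemma vspanU F A : (vspan (F :|: A) :=: vspan F + vspan A)%MS.
Proof.
apply/eqmxP/andP; split.
  apply: vspan_sub => x /setUP[] xF.
    by apply: submx_trans (addsmxSl _ _); apply: vec_span.
  by apply: submx_trans (addsmxSr _ _); apply: vec_span.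
by rewrite addsmx_sub !vspan_mono ?subsetUl ?subsetUr.
Qed.

Lemma vrank_mono : monotone vrank.
Proof. by move=> F A s; apply/mxrankS/vspan_mono. Qed.

Lemma vrank_submod : submodular vrank.
Proof.
move=> F A; rewrite /vrank vspanU -(mxrank_sum_cap (vspan F) (vspan A)) leq_add2l.
by apply: mxrankS; rewrite sub_capmx !vspan_mono ?subsetIl ?subsetIr.
Qed.

Lemma vrank1 x F : vrank (x |: F) <= (vrank F).+1.
Proof.
rewrite /vrank vspanU -add1n; apply: leq_trans (mxrank_adds_leqif _ _) _.
rewrite leq_add2r; apply: leq_trans (_ : \rank (vec x) <= 1); last exact: rank_leq_row.
by apply/mxrankS/vspan_sub => y /set1P->.
Qed.

Lemma vrank_closed F A : (forall x, x \in A -> (vec x <= vspan F)%MS) -> vrank (A :|: F) = vrank F.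
Proof.
move=> H; apply/eqP; rewrite eqn_leq (vrank_mono (subsetUr A F)) andbT.
by apply: mxrankS; apply: vspan_sub => x /setUP[/H//|]; apply: vec_span.
Qed.

Lemma vrank_spans F A x : F \subset A -> vrank F = vrank A -> x \in A -> (vec x <= vspan F)%MS.
Proof.
move=> sF e xA; apply: submx_trans (vec_span xA) _.
by rewrite -(geq_leqif (mxrank_leqif_sup (vspan_mono sF))); move: e; rewrite /vrank => ->.
Qed.
End LinearRank.

(** * Connectivity from spanning sets of a cycle matroid *)

Section Links.
Variables (T : finType) (g : rel T) (I : finType) (a : T).
Variables (D E : {set T}) (X Ei : I -> {set T}) (l s : T -> T).
Hypotheses (sg : symmetric g) (aD : a \in D) (dDE : forall x, x \in D -> x \notin E)
  (EiE : forall i, Ei i \subset E)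
  (dE : forall i j x, x \in Ei i -> x \in Ei j -> i = j)
  (lD : forall e, e \in E -> l e \in D) (sD : forall e, e \in E -> s e \in D)
  (gl : forall e, e \in E -> g e (l e)) (gs : forall e, e \in E -> g e (s e))
  (links : forall i (W : {set T}), a \in W ->
     (forall e, e \in Ei i -> l e \in W -> s e \in W) -> X i \subset W)
  (two : forall x, x \in D -> x != a -> 1 < #|[set i | x \in X i]|).
Import GRing.Theory.

(* The elements of E are edges of an auxiliary graph on D, which are realised
   inside g as paths of length two; the rank is that of its cycle matroid. *)
Lemma link_rank : exists r : {set T} -> nat,
  [/\ submodular r, monotone r, forall F : {set T}, F \subset E -> 2 * (r E - r F) <= #|E :\: F|
    & forall A : {set T}, A \subset E -> r A = r E -> cset g (D :|: A)].
Proof.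
(* The vertex [a] is grounded at 0, so the other vertices give independent vectors, and the edges of
   a path from [a] span the vectors of its vertices. *)
pose d x : 'rV[rat]_#|T| := if x == a then 0%R else delta_mx 0%R (enum_rank x).
pose vec x := if x \in E then (d (l x) - d (s x))%R else d x.
have vD x : x \in D -> vec x = d x by move=> xD; rewrite /vec (negPf (dDE xD)).
have spX i x : x \in X i -> (d x <= vspan vec (Ei i))%MS.
  move=> xX; have /subsetP/(_ x xX) : X i \subset [set x | (d x <= vspan vec (Ei i))%MS].
    apply: links; first by rewrite inE /d eqxx sub0mx.
    move=> e eE; rewrite !inE => le.
    have := vec_span vec eE; rewrite {1}/vec (subsetP (EiE i) _ eE) => ve.
    by rewrite -(subrK (d (l e)) (d (s e))) addmx_sub // -opprB eqmx_opp.
  by rewrite inE.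
have XD i x : x \in X i -> x \in D.
  move=> xX; have /subsetP/(_ x xX) // : X i \subset D.
  by apply: links => // e eE _; apply: sD; apply: (subsetP (EiE i)).
exists (vrank vec); split; [exact: vrank_submod|exact: vrank_mono| |].
  (* The vertex [a] is left out: its vector is 0, and it is not assumed to lie in two of the
     [X i]. *)
  apply: (@double_span_count _ I (vrank vec) (D :\ a) E X Ei) => //.
  - exact: vrank_submod.
  - exact: vrank_mono.
  - by move=> x F; apply: vrank1.
  - rewrite setUC; apply: vrank_closed => e eE; rewrite {1}/vec eE.
    have h x : x \in D -> (d x <= vspan vec (D :\ a))%MS.
      move=> xD; case: (eqVneq x a) => [->|xa]; first by rewrite /d eqxx sub0mx.
      by rewrite -vD // vec_span // !inE xa.
    by rewrite addmx_sub ?eqmx_opp ?h ?lD ?sD.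
  - by move=> i; apply: vrank_closed => x xX; rewrite vD ?(XD i) // spX.
  by move=> x; rewrite !inE => /andP[xa xD]; apply: two.
move=> A sA rA; apply: (@csetP _ _ _ a) => //; first by rewrite inE aD.
move=> W aW cl.
(* The functional [f] indicates the complement of [W]. It kills every edge in [A], whose ends are
   both in [W] or both outside, hence also the span of [A], which contains [d x] for all [x] in
   [D]. *)
pose f : 'cV[rat]_#|T| := (\col_i (enum_val i \notin W)%:R)%R.
have fd x : (d x *m f)%R = ((x \notin W)%:R)%:M%R.
  rewrite /d; case: eqP => [->|_]; first by rewrite aW mul0mx raddf0.
  apply/matrixP=> i j; rewrite !ord1 !mxE (bigD1 (enum_rank x)) //= big1 => [|k kx].
    by rewrite !mxE !eqxx enum_rankK mul1r addr0 mulr1n.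
  by rewrite !mxE (negPf kx) andbF mul0r.
have lW e x : e \in A -> x \in D -> g e x -> (x \in W) = (e \in W).
  move=> eA xD ex; apply/idP/idP => H; first by apply: (cl x); rewrite ?inE ?xD ?eA ?orbT // sg.
  by apply: (cl e); rewrite ?inE ?xD ?eA ?orbT.
have DW x : x \in D -> x \in W.
  move=> xD; case: (eqVneq x a) => [->//|xa].
  have /card_gt0P[i] : 0 < #|[set i | x \in X i]| by apply: ltnW; apply: two.
  rewrite inE => xX.
  have sp : (d x <= vspan vec A)%MS.
    have sub : (vspan vec (Ei i) <= vspan vec A)%MS.
      apply: vspan_sub => e eE; apply: (vrank_spans sA rA).
      exact: (subsetP (EiE i)).
    exact: submx_trans (spX i x xX) sub.
  have kA : (vspan vec A <= kermx f)%MS.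
    apply: vspan_sub => e eA; apply/sub_kermxP; have eE := subsetP sA e eA.
    by rewrite /vec eE mulmxBl !fd !(lW e) ?lD ?sD ?gl ?gs // subrr.
  have /sub_kermxP := submx_trans sp kA; rewrite fd => /matrixP/(_ 0 0)%R.
  by rewrite !mxE eqxx mulr1n; case: (x \in W) => // /eqP; rewrite oner_eq0.
apply/subsetP=> x /setUP[/DW //|xA]; have xE := subsetP sA x xA.
by rewrite -(lW x (l x)) ?lD ?gl // DW ?lD.
Qed.
End Links.

(** * Two hubs *)

Lemma cset_path (T : finType) (g : rel T) (S : {set T}) x y :
  cset g S -> x \in S -> y \in S -> exists p : seq T,
    [/\ path g x p, last x p = y, uniq (x :: p) & {subset x :: p <= S}].
Proof.
move=> cS xS yS; have /connectP[p0 pp ->] := cS x y xS yS.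
case: (shortenP pp) => p pth up _; exists p; split=> //.
  by apply: sub_path pth => u v /and3P[].
move=> z; rewrite inE => /predU1P[->//|zp].
elim: p x pth {xS up pp cS} zp => // u p IH x /= /andP[/and3P[_ uS _] pp].
by rewrite inE => /predU1P[->//|]; apply: IH pp.
Qed.

Lemma cset_seq (T : finType) (g : rel T) x p : symmetric g ->
  path g x p -> cset g [set z in x :: p].
Proof.
move=> sg; elim: p x => [|y p IH] x /=.
  have -> : [set z in [:: x]] = [set x] by apply/setP=> z; rewrite !inE.
  by move=> _; apply: cset1.
case/andP=> xy /IH cS; have -> : [set z in [:: x, y & p]] = x |: [set z in y :: p].
  by apply/setP=> z; rewrite !inE.
by apply: csetU1 cS _ xy => //; rewrite !inE eqxx.
Qed.

Section Hubs.
Variable I : finType.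

(** K_{2,k} for [e = false] and K_{1,1,k} for [e = true], where k is the size of [I]. *)
Definition hub_rel (e : bool) : rel (bool + I) := fun x y =>
  match x, y with
  | inl _, inr _ | inr _, inl _ => true
  | inl b, inl b' => e && (b != b')
  | _, _ => false
  end.

Lemma good_hub2 : good (hub_rel false).
Proof.
apply: good_ind => T g iota S sg ii sS ok.
pose r b := iota (inl b); pose c i := iota (inr i).
have /fin_all_exists[P HP] : forall bi : bool * I, exists p : seq T,
    [/\ path g (r bi.1) p, last (r bi.1) p = c bi.2, uniq (r bi.1 :: p) &
    {subset r bi.1 :: p <= S (inl bi.1) (inr bi.2)}].
  case=> b i /=; apply: cset_path.
  - exact: (sch_con sS).
  - exact: (sch_end sS).
  by rewrite (sch_sym sS); apply: (sch_end sS).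
pose Q b i := r b :: P (b, i).
pose X b i := [set z in Q b i].
have XS b i : X b i \subset S (inl b) (inr i).
  by apply/subsetP=> z; rewrite inE; case: (HP (b, i)) => _ _ _; apply.
have rX b i : r b \in X b i by rewrite !inE eqxx.
have cX b i : c i \in X b i.
  by rewrite inE; case: (HP (b, i)) => _ <- _ _; apply: mem_last.
have rootX b i v : iota v \in X b i -> v = inl b \/ v = inr i.
  by move/(subsetP (XS b i)); apply: (sch_root sS).
have r_c b i : r b != c i by apply/eqP=> /ii.
(* A label common to an edge at one hub and an edge at the other can only be [inr i], with the same
   [i] in both. *)
have XY b i j z : z \in X b i -> z \in X (~~ b) j -> i = j.
  move=> /(subsetP (XS b i)) z1 /(subsetP (XS (~~ b) j)) z2.
  have [w Hw] := sch_lab sS (isT : hub_rel false (inl b) (inr i)) z1.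
  have := Hw (inl b) (inr i) isT z1; have := Hw (inl (~~ b)) (inr j) isT z2.
  by case=> -> [] // [] //; case: b {z1 z2 Hw}.
pose S' (u v : bool + I) := match u, v with
  | inl b, inr i | inr i, inl b => X b i | _, _ => set0 end.
have cX' b i : cset g (X b i) by apply: cset_seq; case: (HP (b, i)).
have sS' : scheme (hub_rel false) g iota S'.
  apply: (scheme_sub sS).
  - by move=> [b|i] [b'|j].
  - by move=> [b|i] [b'|j] //= _; rewrite ?XS // (sch_sym sS) XS.
  - by move=> [b|i] [b'|j] //= _; [apply: rX|apply: cX].
  - by move=> [b|i] [b'|j] //= _; apply: cX'.
have [//|nm] := classic (has_minor (hub_rel false) g iota).
(* A vertex may admit several labels. By [con], minimality forbids an edge whose ends admit the same
   one. *)
pose okl w z := (forall v, iota v = z -> v = w) /\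
  (forall u v, hub_rel false u v -> z \in S' u v -> w = u \/ w = v).
have con z t w : g z t -> z != t -> okl w z -> okl w t -> False.
  move=> gzt nzt [z1 z2] [t1 t2]; apply: nm.
  (* The absorbed end must not be a root. If [t] is one, then [z] is not, since both would be the
     root of [w]. *)
  case: (pickP (fun v => iota v == t)) => [v /eqP ev|nt].
    apply: (@edge_contract _ _ _ g iota S' t z w) => //.
    - by rewrite sg.
    - by rewrite eq_sym.
    - move=> v'; apply/eqP=> ev'; case/eqP: nzt.
      by rewrite -ev' -ev (z1 v') // (t1 v).
    by move=> u v' huv /orP[]; [apply: t2|apply: z2].
  apply: (@edge_contract _ _ _ g iota S' z t w) => //.
    by move=> v; rewrite nt.
  by move=> u v' huv /orP[]; [apply: z2|apply: t2].
have okI b i z : z \in X b i -> z \notin X (~~ b) i -> okl (inl b) z.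
  move=> zX zY; split=> [v ev|].
    have := zX; rewrite -ev => /rootX[//|ev']; case/negP: zY.
    by rewrite -ev ev' cX.
  have H b' j : z \in X b' j -> b = b'.
    case: (eqVneq b b') => // nb zX'; case/negP: zY.
    have eb : b' = ~~ b by move: nb; case: (b) (b') => -[].
    by move: zX'; rewrite eb => zX'; rewrite (XY b i j z).
  by move=> [b'|j] [b''|j'] //= _ /H->; [left|right].
have okC b i z : z \in X b i -> z != r b -> (forall j, z \in X b j -> j = i) -> okl (inr i) z.
  move=> zX zr zj; split=> [v ev|].
    by have := zX; rewrite -ev => /rootX[ev'|//]; case/eqP: zr; rewrite -ev ev'.
  have H b' j : z \in X b' j -> i = j.
    case: (eqVneq b b') => [<- /zj //|nb zX'].
    have eb : b' = ~~ b by move: nb; case: (b) (b') => -[].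
    by move: zX'; rewrite eb => zX'; rewrite (XY b i j z).
  by move=> [b'|j] [b''|j'] //= _ /H->; [right|left].
have okY b i z : z \in X b i -> z \in X (~~ b) i -> okl (inr i) z.
  move=> zX zY; apply: (okC b) => // [|j zj].
    by apply: contraTneq zY => ->; apply/negP=> /rootX[] // []; case: (b).
  by rewrite (XY b j i z).
pose q b i k := nth (r b) (Q b i) k.
have qX b i k : k <= size (P (b, i)) -> q b i k \in X b i.
  by move=> kn; rewrite inE mem_nth.
have qg b i k : k < size (P (b, i)) -> g (q b i k) (q b i k.+1).
  by move=> kn; case: (HP (b, i)) => /(pathP (r b)) H _ _ _; apply: H.
have qn b i k : k < size (P (b, i)) -> q b i k != q b i k.+1.
  move=> kn; case: (HP (b, i)) => _ _ u _.
  by rewrite /q nth_uniq ?ltnS ?(ltnW kn) // neq_ltn ltnSn.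
have q0 b i : q b i 0 = r b by [].
have qc b i : q b i (size (P (b, i))) = c i.
  by case: (HP (b, i)) => _ <- _ _; rewrite (last_nth (r b)).
have rY b i : r b \notin X (~~ b) i.
  by apply/negP=> /rootX[] // []; case: (b).
(* Two consecutive vertices both on the path of the other hub would share the label [inr i], two
   consecutive ones both off it the label [inl b]. So the path alternates, from off at the hub to on
   at [c i]. *)
have alt b i k : k < size (P (b, i)) ->
    (q b i k \in X (~~ b) i) = (q b i k.+1 \notin X (~~ b) i).
  move=> kn; have kn' := ltnW kn.
  case: (boolP (q b i k \in _)) => h1; case: (boolP (q b i k.+1 \in _)) => h2 //.
    by case: (con _ _ (inr i) (qg b i k kn) (qn b i k kn)); apply: (okY b); rewrite ?qX.
  by case: (con _ _ (inl b) (qg b i k kn) (qn b i k kn)); apply: (okI b i); rewrite ?qX.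
have Xq b i z : z \in X b i -> exists2 k, k <= size (P (b, i)) & z = q b i k.
  rewrite inE => zQ; exists (index z (Q b i)); last by rewrite /q nth_index.
  by rewrite -ltnS -[X in _ < X]/(size (Q b i)) index_mem.
have Psz b i : 0 < size (P (b, i)).
  by rewrite lt0n; apply: contraNneq (r_c b i) => e; rewrite -(qc b i) e.
(* Otherwise [z] also admits [inr i], a label of its predecessor, which lies on both paths by
   [alt]. *)
have two b i z : z \in X b i -> z \notin X (~~ b) i -> z != r b ->
    exists2 j, j != i & z \in X b j.
  move=> zX zY zr; have [k kn ez] := Xq b i z zX.
  case: (pickP (fun j => (j != i) && (z \in X b j))) => [j /andP[]|no]; first by exists j.
  have zj j : z \in X b j -> j = i.
    by move=> zj; have := no j; rewrite zj andbT => /negbFE/eqP.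
  have ok1 := okC b i z zX zr zj; case: k ez kn => [|k] ez kn; first by rewrite ez eqxx in zr.
  case: (con _ _ (inr i) (qg b i k kn) (qn b i k kn)); last by rewrite -ez.
  by apply: (okY b); rewrite ?qX ?(ltnW kn) // alt // -ez.
(* [D b] collects the vertices of the paths at [b] that are off the other hub's paths, [Ei i] the
   inner vertices common to the two paths of [i]. By [alt], an element of [Ei i] is flanked by [D b]
   on its path at [b], for both [b], and so acts as an edge in both auxiliary graphs. *)
pose D b := r b |: [set z | [exists i, (z \in X b i) && (z \notin X (~~ b) i)]].
pose Ei i := (X false i :&: X true i) :\ c i.
pose E := \bigcup_i Ei i.
have EiX b i z : z \in Ei i -> z \in X b i by rewrite !in_setD1 in_setI => /and3P[_]; case: b.
have Eic i z : z \in Ei i -> z != c i by rewrite in_setD1 => /andP[].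
have XEi b i z : z \in X b i -> z \in X (~~ b) i -> z != c i -> z \in Ei i.
  by move=> z1 z2 zc; rewrite in_setD1 in_setI zc; case: (b) z1 z2 => /= -> ->.
have Ei1 i j b z : z \in Ei i -> z \in X b j -> i = j.
  move=> zE zX; apply: (XY (~~ b) _ _ z); first exact: EiX.
  by rewrite negbK.
have DX b i z : z \in D b -> z \in X b i -> z \notin X (~~ b) i.
  case/setU1P=> [-> _|]; first exact: rY.
  rewrite inE => /existsP[j /andP[zj zY]] zX; apply/negP=> zi.
  by move: zY; rewrite (XY b j i z) ?zi.
have XD b i z : z \in X b i -> z \notin X (~~ b) i -> z \in D b.
  by move=> zX zY; rewrite in_setU1 inE; apply/orP; right; apply/existsP; exists i; rewrite zX.
have Er b z : z \in E -> z != r b.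
  by case/bigcupP=> i _ zE; apply: contraNneq (rY b i) => <-; apply: EiX.
pose own z := [pick i | z \in Ei i].
(* With [predn] and [succn] for [f], these are the two neighbours of [z] on its path at [b]. The
   default [z] occurs only off [E], where it does not matter. *)
pose nb (f : nat -> nat) b z := if own z is Some i then q b i (f (index z (Q b i))) else z.
have ownE i z : z \in Ei i -> own z = Some i.
  move=> zE; rewrite /own; case: pickP => [j zj|/(_ i)]; last by rewrite zE.
  by rewrite (Ei1 i j true z) ?(EiX true).
have pos b i z : z \in Ei i -> exists k,
    [/\ k.+1 < size (P (b, i)), z = q b i k.+1, nb predn b z = q b i k & nb succn b z = q b i k.+2].
  move=> zE; rewrite /nb (ownE i z zE); have [k kn ez] := Xq b i z (EiX b i z zE).
  have zr : z != r b by apply: Er; apply/bigcupP; exists i.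
  have [_ _ u _] := HP (b, i).
  have -> : index z (Q b i) = k by rewrite ez index_uniq.
  case: k kn ez => [|k] kn ez; first by rewrite ez eqxx in zr.
  exists k; split=> //; rewrite ltn_neqAle kn andbT; apply/eqP=> e.
  by have := Eic i z zE; rewrite ez e qc eqxx.
have nbD b z : z \in E -> [/\ nb predn b z \in D b, nb succn b z \in D b,
    g z (nb predn b z) & g z (nb succn b z)].
  case/bigcupP=> i _ zE; have [k [kn ez -> ->]] := pos b i z zE.
  have kn' := ltnW kn; have := EiX (~~ b) i z zE; rewrite ez => zY.
  split.
  - by apply: (XD b i); rewrite ?(alt b i k kn') ?zY ?qX ?(ltnW kn').
  - by apply: (XD b i); rewrite ?qX // -alt.
  - by rewrite sg qg.
  - by rewrite qg.
have lr b : exists rk : {set T} -> nat, [/\ submodular rk, monotone rk,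
    forall F : {set T}, F \subset E -> 2 * (rk E - rk F) <= #|E :\: F| &
    forall A : {set T}, A \subset E -> rk A = rk E -> cset g (D b :|: A)].
  apply: (@link_rank _ g I (r b) (D b) E (fun i => X b i :&: D b) Ei (nb predn b) (nb succn b)) => //.
  - by rewrite setU11.
  - move=> z zD; apply/negP=> /bigcupP[i _ zE].
    by have := DX b i z zD (EiX b i z zE); rewrite (EiX (~~ b)).
  - by move=> i; apply: bigcup_sup.
  - by move=> i j z zi zj; apply: (Ei1 i j true z) => //; apply: EiX.
  - by move=> z /(nbD b)[].
  - by move=> z /(nbD b)[].
  - by move=> z /(nbD b)[].
  - by move=> z /(nbD b)[].
  - move=> i W rW cl; apply/subsetP=> z /setIP[zX zD]; have [k kn ez] := Xq b i z zX.
    have zY := DX b i z zD zX; move: kn zY; rewrite {zX zD}ez.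
    (* The vertices of [D b] sit at even positions, so the induction goes back two steps, across one
       element of [Ei i]. *)
    have [m] := ubnP k; elim: m k => // m IH [|[|k]] km kn zY; first by rewrite q0.
      by move: zY; rewrite -alt // q0 (negPf (rY b i)).
    move: zY; rewrite -alt // => zY; have kn' := ltnW kn.
    have zE : q b i k.+1 \in Ei i.
      apply: (XEi b) => //; first exact: qX.
      rewrite -(qc b i); have [_ _ u _] := HP (b, i).
      by rewrite /q nth_uniq ?ltnS // neq_ltn kn.
    have [_ _ u _] := HP (b, i).
    have [k' [kn2 e2 e3 e4]] := pos b i _ zE.
    have ek : k' = k.
      by move/eqP: e2; rewrite /q nth_uniq ?ltnS // ?(ltnW kn2) // => /eqP[].
    rewrite ek in e3 e4; rewrite -e4; apply: cl => //; rewrite e3.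
    by apply: IH; [exact: ltnW km|exact: ltnW kn'|rewrite alt ?negbK].
  move=> z zD zr; have := zD; rewrite in_setU1 (negPf zr) inE => /existsP[i /andP[zX zY]].
  have [j nij zj] := two b i z zX zY zr.
  have <- : #|[set i; j]| = 2 by rewrite cards2 eq_sym nij.
  by apply: subset_leq_card; apply/subsetP=> t /set2P[]->; rewrite 2!inE ?zX ?zj zD.
have [rf [subf mf cf spf]] := lr false; have [rt [subt mt ct spt]] := lr true.
(* Each rank loses at most half of [#|E :\: F|], so the two losses together are covered. *)
have [F sF|A [sA eA eB]] := matroid_split (E := E) subf subt mf mt.
  have := cf F sF; have := ct F sF; have := mf _ _ sF; have := mt _ _ sF; lia.
have DD b z : z \in D b -> z \in D (~~ b) -> False.
  case/setU1P=> [->|]; first case/setU1P=> [/ii[]|]; first by case: (b).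
    rewrite inE => /existsP[j /andP[]]; have := rY (~~ b) j; rewrite negbK.
    by have := rY b j => /negP H _ /H.
  rewrite inE => /existsP[i /andP[zX zY]] /setU1P[ez|].
    by have := rY (~~ b) i; rewrite negbK -ez zX.
  by rewrite inE => /existsP[j /andP[zj _]]; move: zY; rewrite (XY b i j z) ?zj.
have DE b z : z \in D b -> z \in E -> False.
  move=> zD /bigcupP[i _ zE]; have := DX b i z zD (EiX b i z zE).
  by rewrite (EiX (~~ b)).
have cj b i j : c i \in X b j -> i = j by move=> /rootX[] // [].
have cD b i : c i \in D b -> False.
  case/setU1P=> [/ii //|]; rewrite inE => /existsP[j /andP[/cj <-]].
  by rewrite cX.
have cE i : c i \in E -> False.
  by case/bigcupP=> j _ cEj; have := Eic j _ cEj; rewrite (cj false i j) ?eqxx // EiX.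
pose C (v : bool + I) := match v with
  | inl b => D b :|: (if b then E :\: A else A) | inr i => [set c i] end.
have CD b z : z \in C (inl b) -> z \in D b \/ z \in E /\ (z \in A) = ~~ b.
  rewrite /C in_setU => /orP[zD|zH]; [by left|right]; move: zH; case: (b).
    by rewrite inE => /andP[/negPf-> ->].
  by move=> zA; rewrite (subsetP sA).
exists C; split.
- by move=> [b|i]; rewrite !inE ?eqxx.
- move=> [[]|i]; [|exact: spf|exact: cset1].
  by apply: spt => //; apply: subsetDl.
- move=> [b|i] [b'|j] z; last by move=> /set1P-> /set1P/ii[->].
  + move=> /CD h1 /CD h2; case: (eqVneq b b') => [->//|nbb].
    have eb : b' = ~~ b by move: nbb; case: (b) (b') => -[].
    move: h2; rewrite eb negbK; case: h1 => [z1|[z1 e1]] [z2|[z2 e2]].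
    * by case: (DD b z).
    * by case: (DE b z).
    * by case: (DE (~~ b) z).
    * by move: e1; rewrite e2; case: (b).
  + by move=> /CD[z1|[z1 _]] /set1P ez; move: z1; rewrite ez; [move/cD|move/cE].
  + by move=> /set1P-> /CD[/cD|[/cE]].
have adj b i : touch g (C (inl b)) (C (inr i)).
  (* The vertex before [c i] is off the other path, hence in [D b]; this is why [c i] can stand
     alone. *)
  have kn : (size (P (b, i))).-1 < size (P (b, i)) by rewrite prednK ?Psz.
  exists (q b i (size (P (b, i))).-1), (c i); split; rewrite ?set11 //.
    have le := ltnW kn; rewrite in_setU (XD b i) ?qX // (alt b i _ kn).
    by rewrite prednK ?Psz // qc cX.
  by have := qg b i _ kn; rewrite prednK ?Psz // qc.
move=> [b|i] [b'|j] //= _; first exact: adj.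
by apply: touch_sym => //; apply: adj.
Qed.
End Hubs.

(** * From K_{2,k} to K_{1,1,k} *)

Section HubsAdjacent.
Variable I : finType.
Variables (T : finType) (g : rel T) (iota : bool + I -> T)
  (S : bool + I -> bool + I -> {set T}).
Hypotheses (sg : symmetric g) (ii : injective iota)
  (sS : scheme (@hub_rel I true) g iota S).
Let r b := iota (inl b).
Let c i := iota (inr i).
Let Z := S (inl false) (inl true).

Let hub_sub u v : @hub_rel I false u v -> @hub_rel I true u v.
Proof. by case: u v => [[]|i] [[]|j]. Qed.

Let sS2 : scheme (@hub_rel I false) g iota S.
Proof.
split; first exact: (sch_sym sS).
- by move=> u v /hub_sub; apply: (sch_end sS).
- by move=> u v /hub_sub; apply: (sch_con sS).
- by move=> u v w /hub_sub; apply: (sch_root sS).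
move=> x u v /hub_sub huv xS; have [w Hw] := sch_lab sS huv xS.
by exists w => u' v' /hub_sub; apply: Hw.
Qed.

Let bneq (b b' : bool) : b != b' -> b' = ~~ b.
Proof. by case: b b' => -[]. Qed.

Lemma hub_contact C :
  is_minor (@hub_rel I false) g iota C ->
  ~ touch g (C (inl false)) (C (inl true)) ->
  (forall y b u, y \notin C (inl false) -> y \notin C (inl true) ->
     u \in C (inl b) -> g y u -> exists2 v, v \in C (inl (~~ b)) & g y v) ->
  has_minor (@hub_rel I true) g iota.
Proof.
move=> mC nt N3.
pose U := C (inl false) :|: C (inl true).
have CU b : C (inl b) \subset U by case: b; rewrite ?subsetUl ?subsetUr.
have rU b : r b \in U by apply: (subsetP (CU b)); apply: (min_root mC).
have cU i : c i \notin U.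
  by apply/negP=> /setUP[] /(min_dis mC (min_root mC (inr i))).
(* The stretch of a path around [c i] outside both hub sets. By the contact hypothesis it touches
   both of them, so it can be attached to hub [b] even if its own path reaches the other hub set
   first. *)
pose K b i := cc g (S (inl b) (inr i) :\: U) (c i).
have cS b i : c i \in S (inl b) (inr i).
  by rewrite (sch_sym sS); apply: (sch_end sS).
have KS b i x : x \in K b i -> x \in S (inl b) (inr i) /\ x \notin U.
  by move/(subsetP (cc_sub _ _ _)); rewrite inE => /andP[].
have cK b i : c i \in K b i by rewrite mem_cc // inE cU cS.
have KU b i b' : exists x y, [/\ x \in K b i, y \in C (inl b') & g x y].
  have rK : r b \notin K b i by apply/negP=> /KS[_]; rewrite rU.
  have [x [y [xS xK yS yK xy]]] := cset_cut (sch_con sS (isT : @hub_rel I true (inl b) (inr i)))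
    (cS b i) (cK b i) (sch_end sS (isT : @hub_rel I true (inl b) (inr i))) rK.
  have yU : y \in U.
    by apply: contraNT yK => yU; apply: cc_closed xK _ xy; rewrite inE yU.
  have [_] := KS b i x xK; rewrite inE negb_or => /andP[xf xt].
  have [b1 y1] : exists b1, y \in C (inl b1) by case/setUP: yU; [exists false|exists true].
  case: (eqVneq b1 b') => [e|/bneq->]; first by exists x, y; rewrite -e.
  by have [v vC xv] := N3 x b1 y xf xt y1 xy; exists x, v.
have [z [zZ zU [u0 u0C zu0] ]] : exists z, [/\ z \in Z, z \notin U &
    exists2 u, u \in C (inl false) & g z u].
  have rf : r true \notin C (inl false).
    by apply/negP=> /(min_dis mC (min_root mC (inl true))).
  have [x [z [xZ xC zZ zC xz]]] := cset_cut (sch_con sS (isT : @hub_rel I true (inl false) (inl true)))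
    (sch_end sS (isT : @hub_rel I true (inl false) (inl true))) (min_root mC (inl false))
    (ltac:(by rewrite (sch_sym sS); apply: (sch_end sS))) rf.
  exists z; split=> //; last by exists x; rewrite // sg.
  rewrite inE negb_or zC; apply/negP=> zt; apply: nt; by exists x, z.
have zadj b : exists2 u, u \in C (inl b) & g z u.
  case: b; last by exists u0.
  by move: zU; rewrite inE negb_or => /andP[zf zt]; apply: (N3 z false u0).
(* If [z] lies on a path of hub [true], its label must be [inl true], so it lies on no path of hub
   [false]. Hence it can join the hub set of [b0] without entering a path of the other hub. *)
have [b0 zK] : exists b0, forall i, z \notin K (~~ b0) i.
  case: (pickP (fun i => z \in K true i)) => [i zi|no]; last by exists false => i; rewrite no.
  exists true => j; apply/negP=> /KS[zj _]; have [zi' _] := KS true i z zi.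
  have [w Hw] := sch_lab sS (isT : @hub_rel I true (inl false) (inl true)) zZ.
  have [] := Hw (inl false) (inl true) isT zZ; have [] := Hw (inl true) (inr i) isT zi';
  by have [] := Hw (inl false) (inr j) isT zj => -> // [].
have zroot v : iota v != z.
  apply/eqP=> ev; have := zZ; rewrite -ev => /(sch_root sS (isT : @hub_rel I true (inl false) (inl true))).
  by case=> e; move: zU; rewrite -ev e rU.
pose R b := C (inl b) :|: (if b == b0 then [set z] else set0).
have RP b x : reflect (x \in C (inl b) \/ (b = b0 /\ x = z)) (x \in R b).
  rewrite inE; apply: (iffP orP) => -[->|H]; [by left| |by left|right].
    by right; move: H; case: eqP => [->|_]; rewrite inE // => /eqP->.
  by case: H => -> ->; rewrite eqxx set11.
have CR b x : x \in C (inl b) -> x \in R b by move=> xC; apply/RP; left.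
have RD b b' x : x \in R b -> x \in R b' -> b = b'.
  move=> /RP[x1|[-> e1]] /RP[x2|[-> e2]] //.
  - by have [] := min_dis mC x1 x2.
  - by move: zU; rewrite -e2 (subsetP (CU b)).
  - by move: zU; rewrite -e1 (subsetP (CU b')).
have Rc b : cset g (R b).
  rewrite /R; case: eqP => [->|_]; last by rewrite setU0; apply: (min_con mC).
  rewrite setUC; have [u uC zu] := zadj b0; apply: csetU1 uC zu => //.
  exact: (min_con mC).
have Rroot b v : iota v \in R b -> v = inl b.
  by case/RP=> [/(min_dis mC (min_root mC v))|[_ /eqP]] //; rewrite (negPf (zroot v)).
pose rho x := if x \in R false then r false else if x \in R true then r true else x.
have rhoR b x : x \in R b -> rho x = r b.
  rewrite /rho; case: (boolP (x \in R false)) => [xf xb|xf]; first by rewrite (RD b false x).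
  by case: b => // [->|xb]; rewrite ?xb in xf *.
have rhoN x : (forall b, x \notin R b) -> rho x = x by move=> H; rewrite /rho !(negPf (H _)).
have rhoP x : (exists2 b, x \in R b & rho x = r b) \/ (forall b, x \notin R b) /\ rho x = x.
  case: (boolP [exists b, x \in R b]) => [/existsP[b xb]|/existsPn H].
    by left; exists b => //; apply: rhoR.
  by right; split=> //; apply: rhoN.
have rR b : r b \in R b by apply: CR; apply: (min_root mC).
have rr x : rho (rho x) = rho x.
  by case: (rhoP x) => [[b xb ->]|[_ e]]; [rewrite (rhoR b)|rewrite e].
have ri v : rho (iota v) = iota v.
  by case: (rhoP (iota v)) => [[b /Rroot-> ->]|[]].
have fibR b x : rho x = r b -> x \in R b.
  by case: (rhoP x) => [[b' xb ->] /ii[<-]|[H ->] e] //; case/negP: (H b); rewrite e.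
have cf x : cset g [set y | rho y == rho x].
  case: (rhoP x) => [[b xb ->]|[H ->]].
    have -> : [set y | rho y == r b] = R b; last exact: Rc.
    by apply/setP=> y; rewrite inE; apply/eqP/idP => [/fibR|/rhoR].
  have -> : [set y | rho y == x] = [set x]; last exact: cset1.
  apply/setP=> y; rewrite !inE; case: (rhoP y) => [[b yb e]|[_ ->]] //.
  rewrite e; apply/eqP/eqP => [e'|e']; first by case/negP: (H b); rewrite -e'.
  by case/negP: (H b); rewrite -e'.
pose S' (u v : bool + I) := match u, v with
  | inl b, inr i | inr i, inl b => K b i :|: R b | _, _ => set0 end.
have S'P u v x : @hub_rel I false u v -> x \in S' u v ->
    exists b i, [/\ (u = inl b /\ v = inr i) \/ (u = inr i /\ v = inl b) & x \in K b i :|: R b].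
  by case: u v => [b|i] [b'|j] //= _ xS; [exists b, j|exists b', i]; split=> //; [left|right].
have KR b i b' x : x \in K b i -> x \in R b' -> b' = b.
  move=> xK /RP[xC|[-> e]]; first by have [_] := KS b i x xK; rewrite (subsetP (CU b')).
  by case: (eqVneq b0 b) => // /bneq eb; case/negP: (zK i); rewrite -eb -e.
have sS' : scheme (@hub_rel I false) g iota S'.
  split.
  - by move=> [b|i] [b'|j].
  - by move=> [b|i] [b'|j] //= _; rewrite inE ?rR ?cK ?orbT.
  - have H b i : cset g (K b i :|: R b).
      apply: csetU => //; first by apply: cset_cc => //; rewrite inE cU cS.
      by right; have [x [y [xK yC xy]]] := KU b i b; exists x, y; split=> //; apply: CR.
    by move=> [b|i] [b'|j] //= _; apply: H.
  - move=> u v w huv /(S'P _ _ _ huv)[b [i [e]]] H.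
    suff : w = inl b \/ w = inr i by case: e => -[-> ->] [->|->]; auto.
    case/setUP: H => [/KS[wS _]|/Rroot]; last by left.
    exact: (sch_root sS (isT : @hub_rel I true (inl b) (inr i))).
  move=> x u v huv xS; have [[b xR]|H] := classic (exists b, x \in R b).
    exists (inl b) => u' v' huv' /(S'P _ _ _ huv')[b' [i [e]]] H.
    suff -> : b = b' by case: e => -[-> ->]; auto.
    by case/setUP: H => [/KR/(_ xR)//|/(RD _ _ _ xR)].
  have H' b : x \notin R b by apply/negP=> xb; apply: H; exists b.
  have aux u' v' : @hub_rel I false u' v' -> x \in S' u' v' -> x \in S u' v'.
    move=> huv' /(S'P _ _ _ huv')[b' [i [e]]] /setUP[/KS[H1 _]|]; last by rewrite (negPf (H' _)).
    by case: e => -[-> ->] //; rewrite (sch_sym sS).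
  have [w Hw] := sch_lab sS2 huv (aux u v huv xS).
  by exists w => u' v' huv' xS'; apply: Hw (aux _ _ huv' xS').
(* The K_{2,k} case is applied a second time, with the enlarged hub sets contracted to the hubs. The
   new hub branch sets contain the old ones and [z], which makes them adjacent. *)
have [C' mC'] : has_minor (@hub_rel I false) (ctr g rho) iota.
  apply: (good_hub2 (ctr_sym rho sg) ii (S := fun u v => rho @: S' u v)).
  apply: scheme_ctr => // [x u v huv xS|x u v w huv xS e].
    case: (rhoP x) => [[b xb ex]|[H ex]].
      exists (inl b) => u' v' y huv' /(S'P _ _ _ huv')[b' [i [e]]] Hy; rewrite ex => /fibR yb.
      suff -> : b = b' by case: e => -[-> ->]; auto.
      by case/setUP: Hy => [/KR/(_ yb)//|/(RD _ _ _ yb)].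
    have [w Hw] := sch_lab sS' huv xS; exists w => u' v' y huv' yS; rewrite ex => ey.
    apply: Hw => //; case: (rhoP y) => [[b yb ey']|[_ ey']]; last by rewrite -ey ey'.
    by case/negP: (H b); rewrite -ey ey'.
  case: (rhoP x) => [[b xb ex]|[H ex]]; last first.
    by apply: (sch_root sS' huv); rewrite -e ex.
  have -> : w = inl b by apply: ii; rewrite -e.
  case/(S'P _ _ _ huv): xS => b' [i [e' Hx]].
  suff -> : b = b' by case: e' => -[-> ->]; auto.
  by case/setUP: Hx => [/KR/(_ xb)//|/(RD _ _ _ xb)].
have mC2 := minor_ctr sg rr cf ri mC'.
exists (fun v => rho @^-1: C' v); split; [exact: min_root mC2|exact: min_con mC2|exact: (min_dis mC2)|].
have RC b x : x \in R b -> x \in rho @^-1: C' (inl b).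
  by move=> xR; rewrite inE (rhoR b) // (min_root mC').
have t0 : touch g (rho @^-1: C' (inl b0)) (rho @^-1: C' (inl (~~ b0))).
  have [u uC zu] := zadj (~~ b0); exists z, u; split=> //; apply: RC; last exact: CR.
  by apply/RP; right.
move=> [b|i] [b'|j] //= huv; try exact: (min_adj mC2 (u := inl _) (v := inr _)).
- rewrite (bneq huv); case: (eqVneq b b0) => [->//|/bneq e].
  by apply: touch_sym => //; move: t0; rewrite e negbK.
- exact: (min_adj mC2 (u := inr _) (v := inl _)).
Qed.

(** The vertex [y] moves into a hub set that it touches. If it is taken from [C (inr i)], the
    remainder [W] at [c i] touches hub [b] through [y] itself, so only contact with the other hub
    has to be assumed. If [y] lies in no branch set, [i] is an arbitrary index. *)
Lemma hub_improve C b y (W : {set T}) i :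
  is_minor (@hub_rel I false) g iota C -> y \notin C (inl false) -> y \notin C (inl true) ->
  (exists2 u, u \in C (inl b) & g y u) -> (forall j, y \in C (inr j) -> j = i) ->
  (y \in C (inr i) -> [/\ y != c i, W = cc g (C (inr i) :\ y) (c i) & touch g W (C (inl (~~ b)))]) ->
  (y \notin C (inr i) -> W = C (inr i)) ->
  exists2 C' : bool + I -> {set T}, is_minor (@hub_rel I false) g iota C' &
    C (inl false) :|: C (inl true) \proper C' (inl false) :|: C' (inl true).
Proof.
move=> mC yf yt [u uC yu] yj Wy Wn.
have ynb b' : y \notin C (inl b') by case: b'.
have WC : W \subset C (inr i).
  case: (boolP (y \in C (inr i))) => [/Wy[_ -> _]|/Wn->//].
  by apply/subsetP=> x /(subsetP (cc_sub _ _ _)); rewrite inE => /andP[].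
have cW : c i \in W.
  case: (boolP (y \in C (inr i))) => [/Wy[yc -> _]|/Wn->]; last exact: (min_root mC).
  by rewrite mem_cc // !inE eq_sym yc (min_root mC).
have yW : y \notin W.
  case: (boolP (y \in C (inr i))) => [/Wy[_ -> _]|/[dup]/Wn-> //].
  by apply/negP=> /(subsetP (cc_sub _ _ _)); rewrite !inE eqxx.
pose C' (v : bool + I) := match v with
  | inl b' => if b' == b then y |: C (inl b) else C (inl b')
  | inr j => if j == i then W else C (inr j) end.
have C'P v x : x \in C' v -> x \in C v \/ x = y /\ v = inl b.
  case: v => [b'|j] /=; case: eqP => [->|_]; try by left.
    by case/setU1P; [right|left].
  by move/(subsetP WC); left.
have yC' v : y \in C' v -> v = inl b.
  case: v => [b'|j] /=; case: eqP => [->|nj] //; first by rewrite (negPf (ynb b')).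
    by rewrite (negPf yW).
  by move/yj.
have CC' b' : C (inl b') \subset C' (inl b').
  by rewrite /=; case: eqP => [->|//]; apply: subsetUr.
have adj b' j : touch g (C' (inl b')) (C' (inr j)).
  have t0 := touch_sub (CC' b') (subxx _) (min_adj mC (isT : @hub_rel I false (inl b') (inr j))).
  rewrite [C' (inr j)]/=; case: eqP => [ej|//]; subst j.
  case: (boolP (y \in C (inr i))) => [yi|/Wn->//]; have [yc eW tW] := Wy yi.
  apply: touch_sym => //; case: (eqVneq b b') => [<-|/bneq->]; last exact: touch_sub (CC' _) tW.
  have [||||z zW zy] := @cc_touch _ g (C (inr i)) (c i) y sg => //; first exact: (min_con mC).
  - exact: (min_root mC).
  - by rewrite eq_sym.
  by exists z, y; split=> //; [rewrite eW|rewrite /= eqxx setU11].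
exists C'.
  split.
  - case=> [b'|j]; first by apply: (subsetP (CC' b')); apply: (min_root mC).
    by rewrite /=; case: eqP => [->//|_]; apply: (min_root mC).
  - case=> [b'|j] /=; case: eqP => [e|_]; try exact: (min_con mC).
      by apply: csetU1 uC yu => //; apply: (min_con mC).
    case: (boolP (y \in C (inr i))) => [/Wy[yc -> _]|/Wn->]; last exact: (min_con mC).
    by apply: cset_cc => //; rewrite !inE eq_sym yc (min_root mC).
  - move=> u' v x xu xv; case: (eqVneq x y) => [e|xy].
      by rewrite e in xu xv; rewrite (yC' _ xu) (yC' _ xv).
    case: (C'P _ _ xu) => [xu'|[e _]]; last by rewrite e eqxx in xy.
    case: (C'P _ _ xv) => [xv'|[e _]]; last by rewrite e eqxx in xy.
    exact: (min_dis mC xu' xv').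
  move=> [b'|j] [b''|j'] //= _; [exact: (adj b' j')|].
  by apply: touch_sym => //; apply: (adj b'' j).
apply/properP; split; first by rewrite setUSS.
exists y; last by rewrite inE negb_or yf yt.
have : y \in C' (inl b) by rewrite /= eqxx setU11.
by rewrite in_setU; case: (b) => ->; rewrite ?orbT.
Qed.

Lemma hub_adjacent_aux (i0 : I) n C : is_minor (@hub_rel I false) g iota C ->
  #|~: (C (inl false) :|: C (inl true))| < n -> has_minor (@hub_rel I true) g iota.
Proof.
elim: n C => // n IH C mC Cn.
have imp C' : is_minor (@hub_rel I false) g iota C' ->
    C (inl false) :|: C (inl true) \proper C' (inl false) :|: C' (inl true) ->
    has_minor (@hub_rel I true) g iota.
  move=> mC' pC; apply: (IH C') => //; rewrite -ltnS; apply: leq_trans _ Cn.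
  by rewrite ltnS; apply: proper_card; rewrite properC.
have [//|nm] := classic (has_minor (@hub_rel I true) g iota).
have nt : ~ touch g (C (inl false)) (C (inl true)).
  move=> t; apply: nm; exists C; split; [exact: min_root mC|exact: min_con mC|exact: (min_dis mC)|].
  move=> [[]|i] [[]|j] //= _; try exact: (min_adj mC (u := inl _) (v := inr _)).
  - exact: touch_sym.
  - exact: (min_adj mC (u := inr _) (v := inl _)).
  - exact: (min_adj mC (u := inr _) (v := inl _)).
pose adj b y := exists2 u, u \in C (inl b) & g y u.
have N1 y b : y \notin C (inl false) -> y \notin C (inl true) -> adj b y ->
    exists i, y \in C (inr i).
  move=> yf yt yb; have [//|ni] := classic (exists i, y \in C (inr i)).
  have nj j : y \notin C (inr j) by apply/negP=> yj; apply: ni; exists j.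
  have [|||||||C' mC' pC] := @hub_improve C b y (C (inr i0)) i0 => //.
  - by move=> j; rewrite (negPf (nj j)).
  - by rewrite (negPf (nj i0)).
  by case: nm; apply: (imp C').
have N2 i y b : y \in C (inr i) -> y != c i -> adj b y ->
    ~ touch g (cc g (C (inr i) :\ y) (c i)) (C (inl (~~ b))).
  move=> yi yc yb t.
  have yn b' : y \notin C (inl b') by apply/negP=> yb'; have := min_dis mC yi yb'.
  have [|||||||C' mC' pC] := @hub_improve C b y (cc g (C (inr i) :\ y) (c i)) i => //.
  - by move=> j yj; have [] := min_dis mC yi yj.
  - by rewrite yi.
  by case: nm; apply: (imp C').
have N3 i y y' b : y \in C (inr i) -> y' \in C (inr i) -> adj b y -> adj (~~ b) y' -> y = y'.
  move=> yi yi' yb yb'; apply/eqP/negPn/negP=> nyy.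
  have tch (W : {set T}) b1 x : x \in W -> adj b1 x -> touch g W (C (inl b1)).
    by move=> xW [u uC xu]; exists x, u.
  have ci := min_root mC (inr i).
  case: (eqVneq y (c i)) => [ey|yc].
    apply: (N2 i y' (~~ b)) => //; first by rewrite -ey eq_sym.
    by rewrite negbK; apply: (tch _ _ y) => //; rewrite -ey mem_cc // !inE nyy.
  case: (eqVneq y' (c i)) => [ey'|yc'].
    apply: (N2 i y b) => //.
    by apply: (tch _ _ y') => //; rewrite -ey' mem_cc // !inE eq_sym nyy.
  (* [W] is what [c i] reaches without [y] and [y']. It is left through one of them, say [y']; then
     [W] with [y'] survives the removal of [y] and touches the other hub set, against [N2]. *)
  pose W := cc g (C (inr i) :\ y :\ y') (c i).
  have WS x : x \in W -> [/\ x \in C (inr i), x != y & x != y'].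
    by move/(subsetP (cc_sub _ _ _)); rewrite !inE => /and3P[].
  have cW : c i \in W by rewrite mem_cc // !inE ![c i == _]eq_sym yc yc'.
  have yW : y \notin W by apply/negP=> /WS[_]; rewrite eqxx.
  have [x [t [xC xW tC tW xt]]] := cset_cut (min_con mC (inr i)) ci cW yi yW.
  have sub a a' : a \in C (inr i) -> W \subset cc g (C (inr i) :\ a) (c i) ->
      t == a' -> a' != a -> t \in cc g (C (inr i) :\ a) (c i).
    move=> aC sW ta aa; apply: cc_closed xt; first exact: (subsetP sW).
    by rewrite !inE (eqP ta) aa -(eqP ta).
  have Wsub a : a \in [set y; y'] -> W \subset cc g (C (inr i) :\ a) (c i).
    move=> aS; apply/subsetP=> z; rewrite inE => /andP[zS cz]; rewrite inE.
    have s : C (inr i) :\ y :\ y' \subset C (inr i) :\ a.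
      apply/subsetP=> w; rewrite !inE => /and3P[w1 w2 ->]; rewrite andbT.
      by case/set2P: aS => ->.
    by rewrite (subsetP s _ zS) (connect_ind_sub s _ cz).
  case: (boolP ((t == y) || (t == y'))) => [/orP[ty|ty]|]; last first.
  - rewrite negb_or => /andP[ty ty']; case/negP: tW; apply: cc_closed xt => //.
    by rewrite !inE ty ty'.
  - apply: (N2 i y b) => //; apply: (tch _ _ y') => //; rewrite -{1}(eqP ty).
    by apply: (sub y y') => //; [apply: Wsub; rewrite !inE eqxx|rewrite eq_sym].
  apply: (N2 i y' (~~ b)) => //; rewrite negbK; apply: (tch _ _ y) => //.
  rewrite -{1}(eqP ty).
  by apply: (sub y' y) => //; apply: Wsub; rewrite !inE eqxx orbT.
apply: (hub_contact mC nt) => y b u yf yt uC yu.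
have [i yi] : exists i, y \in C (inr i) by apply: (N1 y b) => //; exists u.
have [x [v [xC vC xv]]] := min_adj mC (isT : @hub_rel I false (inr i) (inl (~~ b))).
have -> : y = x by apply: (N3 i y x b) => //; [exists u|exists v].
by exists v.
Qed.

Lemma hub_adjacent : I -> has_minor (@hub_rel I true) g iota.
Proof.
by move=> i0; have [C mC] := good_hub2 sg ii sS2; apply: (hub_adjacent_aux i0 mC (ltnSn _)).
Qed.
End HubsAdjacent.

Lemma good_hub11 (I : finType) : I -> good (@hub_rel I true).
Proof. by move=> i0 T g iota S sg ii sS; apply: (hub_adjacent sg ii sS i0). Qed.

(** * Rooted K4 *)

Definition neq_rel (T : eqType) : rel T := fun x y => x != y.

Section K4.
Local Notation V := (bool * bool)%type.
Variables (T : finType) (g : rel T) (iota : V -> T).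
Hypotheses (sg : symmetric g) (ii : injective iota).

(* A K_{2,3} minor with sides {r, D} and the three roots other than r; the set D
   contains no root. *)
Record is_wheel (r : V) (C : V -> {set T}) (D : {set T}) : Prop := {
  wh_root : forall v, iota v \in C v;
  wh_con : forall v, cset g (C v);
  wh_dis : forall u v x, x \in C u -> x \in C v -> u = v;
  wh_Dcon : cset g D;
  wh_Ddis : forall v x, x \in C v -> x \notin D;
  wh_adj : forall v, v != r -> touch g (C r) (C v);
  wh_Dadj : forall v, v != r -> touch g D (C v) }.

Variable P : bool -> {set T}.
Hypotheses (cP : forall d, cset g (P d)) (dP : forall x, x \in P false -> x \notin P true).

(** [C] is a minor of the 4-cycle whose diagonals are the pairs [(d, false)], [(d, true)].
    [R (d, e)] is the part of the diagonal set [P d] absorbed so far from the end [(d, e)]. *)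
Record linked (C R : V -> {set T}) : Prop := {
  li_root : forall v, iota v \in R v;
  li_sub : forall v, R v \subset C v;
  li_con : forall v, cset g (C v);
  li_Rcon : forall v, cset g (R v);
  li_dis : forall u v x, x \in C u -> x \in C v -> u = v;
  li_adj : forall d e e', touch g (C (d, e)) (C (~~ d, e'));
  li_P : forall d e, R (d, e) \subset P d }.

Arguments li_root [C R] _ v.
Arguments li_sub [C R] _ v.
Arguments li_con [C R] _ v.
Arguments li_Rcon [C R] _ v.

Definition rem (R : V -> {set T}) d := #|P d :\: (R (d, false) :|: R (d, true))|.

Let bneq (b b' : bool) : b != b' -> b' = ~~ b.
Proof. by case: b b' => -[]. Qed.

(** The vertex [p] may be taken away from a branch set of the other diagonal. The part left at that
    root touches [p], hence the enlarged [C (d, e)]; contact with [C (d, ~~ e)] is the last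
    hypothesis. Since the two diagonal sets are disjoint, [p] lies in no [R], so nothing absorbed
    earlier is lost. *)
Lemma linked_grow C R d e p : linked C R -> p \in P d ->
  p \notin R (d, e) -> p \notin C (d, ~~ e) ->
  (exists2 t, t \in R (d, e) & g p t) ->
  (forall e1, p \in C (~~ d, e1) ->
     touch g (cc g (C (~~ d, e1) :\ p) (iota (~~ d, e1))) (C (d, ~~ e))) ->
  exists C' R', linked C' R' /\
    rem R' false + rem R' true < rem R false + rem R true.
Proof.
move=> L pP pR pC [t tR pt] H.
have PP x d1 : x \in P d1 -> x \in P d -> d1 = d.
  by case: (d1) (d) => -[] // x1 x2; [have := dP x2; rewrite x1|have := dP x1; rewrite x2].
have pR' v : p \notin R v.
  apply/negP; case: v => d1 e1 pv; have e_d := PP p d1 (subsetP (li_P L d1 e1) _ pv) pP.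
  subst d1; case: (eqVneq e e1) => [e_e|/bneq e_e]; subst e1; first by rewrite pv in pR.
  by rewrite (subsetP (li_sub L _)) in pC.
pose C' v := if v == (d, e) then p |: C v else
  if p \in C v then cc g (C v :\ p) (iota v) else C v.
pose R' v := if v == (d, e) then p |: R v else R v.
have RC v : v != (d, e) -> R v \subset C' v.
  move=> nv; rewrite /C' (negPf nv); case: ifP => pv; last exact: (li_sub L).
  apply: cc_max; [exact: (li_Rcon L)|exact: (li_root L)|].
  by rewrite subsetD1 (li_sub L) pR'.
have C'C v x : x \in C' v -> x \in C v \/ x = p /\ v = (d, e).
  rewrite /C'; case: eqP => [->|_]; first by case/setU1P; [right|left].
  by case: ifP => _; [move/(subsetP (cc_sub _ _ _)); rewrite inE => /andP[]|]; left.
have pC' v : p \in C' v -> v = (d, e).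
  rewrite /C'; case: eqP => // _; case: ifP => [_|->//].
  by move/(subsetP (cc_sub _ _ _)); rewrite !inE eqxx.
have C'1 : C' (d, e) = p |: C (d, e) by rewrite /C' eqxx.
have C'2 : C' (d, ~~ e) = C (d, ~~ e).
  by rewrite /C' (negPf pC); case: eqP => // -[]; case: (e).
have CC' e1 : C (d, e1) \subset C' (d, e1).
  by case: (eqVneq e e1) => [<-|/bneq->]; rewrite ?C'1 ?C'2 ?subsetUr.
have root v : iota v \in C v by apply: (subsetP (li_sub L v)); apply: (li_root L).
have pi v : iota v != p by apply/eqP=> e_p; have := pR' v; rewrite -e_p (li_root L).
have adj e1 e2 : touch g (C' (d, e1)) (C' (~~ d, e2)).
  have nd : (~~ d, e2) != (d, e) by rewrite xpair_eqE; case: (d).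
  rewrite [C' (~~ d, e2)]/C' (negPf nd).
  case: ifP => pe2; last by apply: touch_sub (CC' e1) (subxx _) (li_adj L d e1 e2).
  case: (eqVneq e e1) => [<-|/bneq->]; last first.
    by rewrite C'2; apply: touch_sym => //; apply: H.
  have [z zW zp] := cc_touch sg (li_con L _) (root (~~ d, e2)) pe2 (pi _).
  by exists p, z; rewrite C'1 setU11 sg.
exists C', R'; split.
  split.
  - by move=> v; rewrite /R'; case: ifP => _; rewrite ?inE (li_root L) ?orbT.
  - move=> v; case: (eqVneq v (d, e)) => [->|nv].
      by rewrite C'1 /R' eqxx setUS // (li_sub L).
    by rewrite /R' (negPf nv) RC.
  - move=> v; rewrite /C'; case: eqP => [->|_].
      by exact: csetU1 sg (li_con L _) (subsetP (li_sub L _) _ tR) pt.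
    case: ifP => pv; last exact: (li_con L).
    by apply: cset_cc => //; rewrite !inE pi root.
  - move=> v; rewrite /R'; case: eqP => [->|_]; last exact: (li_Rcon L).
    by exact: csetU1 sg (li_Rcon L _) tR pt.
  - move=> u v x xu xv; case: (eqVneq x p) => [e_x|xp].
      by rewrite e_x in xu xv; rewrite (pC' _ xu) (pC' _ xv).
    case: (C'C _ _ xu) => [xu'|[e_x _]]; last by rewrite e_x eqxx in xp.
    case: (C'C _ _ xv) => [xv'|[e_x _]]; last by rewrite e_x eqxx in xp.
    exact: (li_dis L xu' xv').
  - move=> d' e1 e2; case: (eqVneq d d') => [<-|/bneq->]; first exact: adj.
    by rewrite negbK; apply: touch_sym => //; apply: adj.
  move=> d1 e1; rewrite /R'; case: eqP => [[-> ->]|_]; last exact: (li_P L).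
  by rewrite subUset sub1set pP (li_P L).
have remle d1 : rem R' d1 <= rem R d1.
  apply: subset_leq_card; apply: setDS; apply: setUSS; rewrite /R'; case: ifP => // _;
  exact: subsetUr.
have remlt : rem R' d < rem R d.
  apply: proper_card; apply/properP; split.
    apply: setDS; apply: setUSS; rewrite /R'; case: ifP => // _; exact: subsetUr.
  exists p; first by rewrite !inE pP !(negPf (pR' _)).
  rewrite !inE pP andbT negbK; apply/orP.
  have pRe : p \in R' (d, e) by rewrite /R' eqxx setU11.
  by case: (e) pRe => ->; [right|left].
have := remle (~~ d); move: remlt; case: (d) => /=; lia.
Qed.

Lemma linked_K4_or_wheel C R : linked C R ->
  has_minor (@neq_rel V) g iota \/ exists r C D, is_wheel r C D.
Proof.
have [n] := ubnP (rem R false + rem R true); elim: n C R => // n IH C R Rn L.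
have [|nw] := classic (has_minor (@neq_rel V) g iota \/ exists r C D, is_wheel r C D) => //.
have grow d e p : p \in P d -> p \notin R (d, e) -> p \notin C (d, ~~ e) ->
  (exists2 t, t \in R (d, e) & g p t) ->
  (forall e1, p \in C (~~ d, e1) ->
     touch g (cc g (C (~~ d, e1) :\ p) (iota (~~ d, e1))) (C (d, ~~ e))) -> False.
  move=> p1 p2 p3 p4 p5; have [C' [R' [L' lt]]] := linked_grow L p1 p2 p3 p4 p5.
  by apply: nw; apply: (IH C' R') => //; apply: leq_trans lt _; rewrite -ltnS.
have root v : iota v \in C v by apply: (subsetP (li_sub L v)); apply: (li_root L).
have RP v : R v \subset P v.1 by case: v => d e; apply: (li_P L).
have RCd u v x : x \in R u -> x \in C v -> u = v.
  by move=> /(subsetP (li_sub L u)) xu xv; apply: (li_dis L xu xv).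
have next d e : exists p, [/\ p \in P d, p \notin R (d, e) & exists2 t, t \in R (d, e) & g p t].
  have nr : iota (d, ~~ e) \notin R (d, e).
    by apply/negP=> x1; have [] := RCd _ _ _ x1 (root _); case: (e).
  have rP v : iota v \in P v.1 by apply: (subsetP (RP v)); apply: (li_root L).
  have [t [p [tP tR pP pR tp]]] := cset_cut (@cP d) (rP (d, e)) (li_root L (d, e)) (rP (d, ~~ e)) nr.
  by exists p; split=> //; exists t; rewrite // sg.
have diag d : touch g (C (d, false)) (C (d, true)).
  have [//|nd] := classic (touch g (C (d, false)) (C (d, true))); exfalso.
  have [p [pP pR [t tR pt]]] := next d false.
  have pC : p \notin C (d, true).
    by apply/negP=> pC; apply: nd; exists t, p; rewrite (subsetP (li_sub L _) _ tR) pC sg.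
  have [//|nb] := classic (forall e1, p \in C (~~ d, e1) ->
     touch g (cc g (C (~~ d, e1) :\ p) (iota (~~ d, e1))) (C (d, true))).
    by apply: (grow d false p) => //; exists t.
  have [e1 [pC1 nt]] : exists e1, p \in C (~~ d, e1) /\
     ~ touch g (cc g (C (~~ d, e1) :\ p) (iota (~~ d, e1))) (C (d, true)).
    by apply: NNPP => H; apply: nb => e1 p1; apply: NNPP => H1; apply: H; exists e1.
  have [q [qP qR [s sR qs]]] := next (~~ d) e1.
  pose v1 := (d, false); pose v2 := (~~ d, e1); pose v3 := (~~ d, ~~ e1); pose v4 := (d, true).
  have cov v : [\/ v = v1, v = v2, v = v3 | v = v4].
    rewrite /v1 /v2 /v3 /v4; case: v => d' e'; case: (eqVneq d d') => [<-|/bneq->].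
      by case: e'; [apply: Or44|apply: Or41].
    by case: (eqVneq e1 e') => [<-|/bneq->]; [apply: Or42|apply: Or43].
  have n12 : v1 != v2 by rewrite xpair_eqE; case: (d).
  have n13 : v1 != v3 by rewrite xpair_eqE; case: (d).
  have n42 : v4 != v2 by rewrite xpair_eqE; case: (d).
  have n43 : v4 != v3 by rewrite xpair_eqE; case: (d).
  have n14 : v1 != v4 by rewrite xpair_eqE andbF.
  have n23 : v2 != v3 by rewrite xpair_eqE eqxx; case: (e1).
  have a12 : touch g (C v1) (C v2) := li_adj L d false e1.
  have a13 : touch g (C v1) (C v3) := li_adj L d false (~~ e1).
  have a42 : touch g (C v4) (C v2) := li_adj L d true e1.
  have a43 : touch g (C v4) (C v3) := li_adj L d true (~~ e1).
  have PP x : x \in P d -> x \in P (~~ d) -> False.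
    by case: (d) => x1 x2; [have := dP x2; rewrite x1|have := dP x1; rewrite x2].
  rewrite -/v1 -/v2 -/v3 -/v4 in pR pC pC1 nt tR qR sR.
  have pRn v : v.1 = ~~ d -> p \notin R v.
    by move=> ev; apply/negP=> /(subsetP (RP v)); rewrite ev => /(PP p pP).
  have qRn v : v.1 = d -> q \notin R v.
    by move=> ev; apply/negP=> /(subsetP (RP v)); rewrite ev => /PP/(_ qP).
  have pne v : v.1 = ~~ d -> iota v != p.
    by move=> ev; apply: contraNneq (pRn v ev) => <-; apply: (li_root L).
  have qne v : v.1 = d -> iota v != q.
    by move=> ev; apply: contraNneq (qRn v ev) => <-; apply: (li_root L).
  (* Taking [p] away from [C v2] would leave [W2], which does not touch [C v4]. So the contact with
     [v4] is in the rest [b]; this is connected, contains [p], and touches the sets of [v1], [v2]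
     and [v4]. *)
  pose W2 := cc g (C v2 :\ p) (iota v2); pose b := C v2 :\: W2.
  have W2C : W2 \subset C v2.
    by apply/subsetP=> x /(subsetP (cc_sub _ _ _)); rewrite inE => /andP[].
  have rW2 : iota v2 \in W2 by rewrite mem_cc // !inE pne // root.
  have cW2 : cset g W2 by apply: cset_cc => //; rewrite !inE pne // root.
  have cb : cset g b by apply: cset_rest => //; [exact: (li_con L)|exact: pne].
  have pb : p \in b by rewrite inE pC1 andbT; apply/negP=> /(subsetP (cc_sub _ _ _)); rewrite !inE eqxx.
  have bC x : x \in b -> x \in C v2 /\ x \notin W2 by rewrite inE => /andP[].
  have tbW2 : touch g b W2.
    have [z zW zp] := cc_touch sg (li_con L v2) (root v2) pC1 (pne v2 erefl).
    by exists p, z; rewrite sg.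
  have R2W : R v2 \subset W2.
    by apply: cc_max; [exact: (li_Rcon L v2)|exact: (li_root L v2)|rewrite subsetD1 (li_sub L v2) pRn].
  have tb4 : touch g b (C v4).
    have [x [y [xC yC xy]]] := a42; exists y, x; split; rewrite 1?sg //.
    by rewrite inE yC andbT; apply/negP=> yW; apply: nt; exists y, x; rewrite sg.
  have tC1 : t \in C v1 by apply: (subsetP (li_sub L v1)).
  have sW2 : s \in W2 by apply: (subsetP R2W).
  have WC4 u x : x \in C u -> x \in b -> u = v2 by move=> xu /bC[xb _]; apply: (li_dis L xu xb).
  (* If [q] lies in [C v3], that set still touches [W2] through [q] and [s], and [C v3] and [b] are
     the two sides of a wheel. *)
  case: (boolP (q \in C v3)) => qC3.
    apply: nw; right; exists v3, (fun v => if v == v2 then W2 else C v), b; split.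
    - by move=> v; case: eqP => [->//|_]; apply: root.
    - by move=> v; case: eqP => // _; apply: (li_con L).
    - move=> u v x xu xv; apply: (@li_dis _ _ L _ _ x).
        by move: xu; case: eqP => [->|//]; apply: (subsetP W2C).
      by move: xv; case: eqP => [->|//]; apply: (subsetP W2C).
    - exact: cb.
    - move=> v x; case: eqP => [_ xW|/eqP nv xv]; first by apply/negP=> /bC[_]; rewrite xW.
      by apply/negP=> /(WC4 v x xv)/eqP; rewrite (negPf nv).
    - move=> v nv; rewrite [v3 == _]eq_sym (negPf n23).
      case: (cov v) nv => -> nv.
      + by rewrite (negPf n12); apply: touch_sym.
      + by rewrite eqxx; exists q, s.
      + by rewrite eqxx in nv.
      + by rewrite (negPf n42); apply: touch_sym.
    move=> v nv; case: (cov v) nv => -> nv.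
    + by rewrite (negPf n12); exists p, t.
    + by rewrite eqxx.
    + by rewrite eqxx in nv.
    + by rewrite (negPf n42).
  have [nb2|nb2] := classic (forall e2, q \in C (d, e2) ->
     touch g (cc g (C (d, e2) :\ q) (iota (d, e2))) (C v3)).
    by apply: (grow (~~ d) e1 q) => //; [exists s|rewrite negbK].
  have [e2 [qC nt2]] : exists e2, q \in C (d, e2) /\
     ~ touch g (cc g (C (d, e2) :\ q) (iota (d, e2))) (C v3).
    by apply: NNPP => H; apply: nb2 => e2 q1; apply: NNPP => H1; apply: H; exists e2.
  (* [q] is not in [C v4], because it is adjacent to [s] in [W2]. So it lies in [C v1], which is now
     cut just as [C v2] was. *)
  case: e2 qC nt2 => qC nt2; first by apply: nt; exists s, q; rewrite sg.
  rewrite -/v1 in qC nt2.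
  pose W1 := cc g (C v1 :\ q) (iota v1); pose D := C v1 :\: W1.
  have W1C : W1 \subset C v1.
    by apply/subsetP=> x /(subsetP (cc_sub _ _ _)); rewrite inE => /andP[].
  have rW1 : iota v1 \in W1 by rewrite mem_cc // !inE qne // root.
  have cW1 : cset g W1 by apply: cset_cc => //; rewrite !inE qne // root.
  have cD : cset g D by apply: cset_rest => //; [exact: (li_con L)|exact: qne].
  have qD : q \in D by rewrite inE qC andbT; apply/negP=> /(subsetP (cc_sub _ _ _)); rewrite !inE eqxx.
  have DC x : x \in D -> x \in C v1 /\ x \notin W1 by rewrite inE => /andP[].
  have tDW1 : touch g D W1.
    have [z zW zq] := cc_touch sg (li_con L v1) (root v1) qC (qne v1 erefl).
    by exists q, z; rewrite sg.
  have R1W : R v1 \subset W1.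
    by apply: cc_max; [exact: (li_Rcon L v1)|exact: (li_root L v1)|rewrite subsetD1 (li_sub L v1) qRn].
  have tW1 : t \in W1 by apply: (subsetP R1W).
  have tD3 : touch g D (C v3).
    have [x [y [xC yC xy]]] := a13; exists x, y; split=> //.
    by rewrite inE xC andbT; apply/negP=> xW; apply: nt2; exists x, y.
  (* Here [b] is added to [C v4], which becomes one side of the wheel; the part [D] cut off from
     [C v1] is the other. *)
  pose C' v := if v == v1 then W1 else if v == v2 then W2 else if v == v4 then C v4 :|: b else C v.
  have e_1 : C' v1 = W1 by rewrite /C' eqxx.
  have e_2 : C' v2 = W2 by rewrite /C' eq_sym (negPf n12) eqxx.
  have e_3 : C' v3 = C v3 by rewrite /C' ![v3 == _]eq_sym (negPf n13) (negPf n23) (negPf n43).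
  have e_4 : C' v4 = C v4 :|: b by rewrite /C' eq_sym (negPf n14) (negPf n42) eqxx.
  have C'C v x : x \in C' v -> [\/ x \in C v /\ x \notin b | v = v4 /\ x \in b] /\ x \notin D.
    have Db y : y \in b -> y \notin D.
      by move=> /bC[y2 _]; apply/negP=> /DC[y1 _]; move: n12; rewrite (li_dis L y1 y2) eqxx.
    have nD u y : y \in C u -> u != v1 -> y \notin D.
      by move=> yu; apply: contraNN => /DC[y1 _]; rewrite (li_dis L yu y1).
    have nb' u y : y \in C u -> u != v2 -> y \notin b.
      by move=> yu; apply: contraNN => /(WC4 u y yu)->.
    case: (cov v) => ->; rewrite ?e_1 ?e_2 ?e_3 ?e_4.
    - move=> xW; have xC := subsetP W1C _ xW; split; first by left; rewrite xC (nb' v1).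
      by apply/negP=> /DC[_]; rewrite xW.
    - move=> xW; have xC := subsetP W2C _ xW; split; last by apply: (nD v2); rewrite // eq_sym.
      by left; split=> //; apply/negP=> /bC[_]; rewrite xW.
    - move=> xC; split; last by apply: (nD v3); rewrite // eq_sym.
      by left; rewrite xC (nb' v3) // eq_sym.
    - case/setUP=> [xC|xb]; last by split; [right|apply: Db].
      by split; [left; rewrite xC (nb' v4)|apply: (nD v4); rewrite // eq_sym].
  apply: nw; right; exists v4, C', D; split.
  - by move=> v; case: (cov v) => ->; rewrite ?e_1 ?e_2 ?e_3 ?e_4 ?in_setU ?root.
  - move=> v; case: (cov v) => ->; rewrite ?e_1 ?e_2 ?e_3 ?e_4 //; try exact: (li_con L).
    by apply: csetU => //; [exact: (li_con L)|right; apply: touch_sym].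
  - move=> u v x /C'C[[[xu nb1]|[-> xb]] _] /C'C[[[xv nb1']|[-> xb']] _] //.
    + exact: (li_dis L xu xv).
    + by rewrite xb' in nb1.
    + by rewrite xb in nb1'.
  - exact: cD.
  - by move=> v x /C'C[].
  - move=> v nv; rewrite e_4; case: (cov v) nv => -> nv; rewrite ?e_1 ?e_2 ?e_3.
    + by exists p, t; rewrite inE pb orbT.
    + by apply: touch_sub tbW2; rewrite ?subsetUr.
    + by apply: touch_sub a43; rewrite ?subsetUl.
    + by rewrite eqxx in nv.
  move=> v nv; case: (cov v) nv => -> nv; rewrite ?e_1 ?e_2 ?e_3 //.
  - by exists q, s.
  - by rewrite eqxx in nv.
left; exists C; split=> //.
- exact: (li_con L).
- exact: (li_dis L).
move=> [d e] [d' e']; rewrite /neq_rel xpair_eqE negb_and => nn.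
case: (eqVneq d d') nn => [<- /= nn|/bneq-> _]; last exact: (li_adj L).
rewrite (bneq nn); case: (e); last exact: diag.
by apply: touch_sym => //; apply: diag.
Qed.
End K4.

Arguments wh_root [T g iota r C D] _ v.
Arguments wh_con [T g iota r C D] _ v.

Local Notation V := (bool * bool)%type.

Lemma cover4 (a b c d v : V) : uniq [:: a; b; c; d] -> v \in [:: a; b; c; d].
Proof.
move=> u; have sub : {subset [:: a; b; c; d] <= enum {: V}} by move=> x _; rewrite mem_enum.
have sz : size (enum {: V}) <= size [:: a; b; c; d] by rewrite -cardE card_prod card_bool.
by have [_ ->] := uniq_min_size u sub sz; rewrite mem_enum.
Qed.

Lemma others4 (a : V) : exists b c d : V, uniq [:: a; b; c; d].
Proof.
case: a => -[] [];
by [exists (true, false), (false, true), (false, false)|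
    exists (true, true), (false, true), (false, false)|
    exists (true, true), (true, false), (false, false)|
    exists (true, true), (true, false), (false, true)].
Qed.

Lemma disjoint_setU (T : finType) (A B C : {set T}) :
  [disjoint A & C] -> [disjoint B & C] -> [disjoint A :|: B & C].
Proof. by rewrite -!setI_eq0 setIUl => /eqP-> /eqP->; rewrite setU0. Qed.

Lemma disjoint_of (T : finType) (A B : {set T}) :
  (forall s, s \in A -> s \notin B) -> [disjoint A & B].
Proof.
by move=> H; rewrite -setI_eq0; apply/eqP/setP=> s; rewrite !inE; apply/negP=> /andP[/H/negPf->].
Qed.

(** * Separations of three roots by two vertices *)

Section Separation.
Variables (T : finType).
Implicit Types (g : rel T) (S : {set T}).

Definition sep3 g S x y z : Prop := [/\ ~~ connect (ind g S) x y,
  ~~ connect (ind g S) x z & ~~ connect (ind g S) y z].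

Lemma sep3_pair (V : eqType) (f : V -> T) g S i j k u v : symmetric g ->
  sep3 g S (f i) (f j) (f k) -> u \in [:: i; j; k] -> v \in [:: i; j; k] -> u != v ->
  ~~ connect (ind g S) (f u) (f v).
Proof.
have cs sg := sym_connect_sym (@ind_sym _ g S sg).
move=> /cs{}cs [s1 s2 s3]; rewrite !inE => /or3P[]/eqP-> /or3P[]/eqP->; rewrite ?eqxx // => _;
by rewrite // cs.
Qed.

Lemma cset_connect g A S x y : cset g A -> A \subset S -> x \in A -> y \in A ->
  connect (ind g S) x y.
Proof. by move=> cA sA xA yA; apply: connect_ind_sub (cA x y xA yA). Qed.

Lemma connect_ctr g rho S S' x y : (forall s, s \in S -> rho s \in S') ->
  connect (ind g S) x y -> connect (ind (ctr g rho) S') (rho x) (rho y).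
Proof.
move=> sS xy; apply: (@connect_inv _ _ [pred z | connect (ind (ctr g rho) S') (rho x) (rho z)]
  _ x y xy) => [u v /= xu|]; last exact: connect0.
case/and3P=> uS vS uv; apply: connect_trans xu _.
case: (eqVneq (rho u) (rho v)) => [->|nuv]; first exact: connect0.
by apply: connect1; apply/and3P; split; rewrite ?sS //; apply/ctrP; split=> //; exists u, v.
Qed.

Lemma connect_step g S x y : connect (ind g S) x y -> x != y ->
  exists t, [/\ t \in S, t != x, g x t & connect (ind g S) t y].
Proof.
case/connectP=> p0 pp ->; case: (shortenP pp) => -[|t p] /=; first by rewrite eqxx.
case/andP=> /and3P[_ tS xt] tp /andP[xp _] _ _; exists t; split=> //.
  by apply: contraNneq xp => ->; rewrite inE eqxx.
by apply/connectP; exists p.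
Qed.
End Separation.

Section Wheel.
Variables (T : finType) (iota : V -> T).
Hypothesis (ii : injective iota).

(** The case [u = v] is included, so separations by a single vertex are excluded too. *)
Definition unsplit (g : rel T) : Prop := forall u v (i j k : V),
  uniq [:: i; j; k] -> {in [:: i; j; k], forall w, iota w != u /\ iota w != v} ->
  ~ sep3 g (~: [set u; v]) (iota i) (iota j) (iota k).

(** A separating pair of the quotient that avoids the merged vertex separates already in [g]; one
    that contains it lifts to [x], [y] and the other vertex of the pair. *)
Lemma unsplit_ctr (g : rel T) x y : symmetric g -> unsplit g -> (forall v, iota v != y) ->
  (forall v (i j k : V), uniq [:: i; j; k] ->
    {in [:: i; j; k], forall w, [/\ iota w != x, iota w != y & iota w != v]} ->
    ~ sep3 g (~: [set x; y; v]) (iota i) (iota j) (iota k)) ->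
  unsplit (ctr g (erho x y)).
Proof.
move=> sg ug iy H u v i j k uq nr [s1 s2 s3].
have ri w : erho x y (iota w) = iota w by rewrite erho_n.
have key (S : {set T}) : (forall s, s \in S -> erho x y s \in ~: [set u; v]) ->
    sep3 g S (iota i) (iota j) (iota k).
  move=> sS; split; [apply: contra s1|apply: contra s2|apply: contra s3] => c;
  by have := connect_ctr sS c; rewrite !ri.
have xuv : (x == u) || (x == v) -> exists v', [/\ v' = u \/ v' = v,
    forall s, s \in ~: [set x; y; v'] -> erho x y s \in ~: [set u; v] & x = u \/ x = v].
  case/orP=> /eqP e; [exists v|exists u]; (split; [by auto| |by auto]) => s;
  rewrite !inE e !negb_or => /andP[/andP[s4 s5] s6]; rewrite erho_n //;
  by rewrite ?s4 ?s6.
case: (boolP ((x == u) || (x == v))) => [/xuv[v' [ev sv ex]]|].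
  apply: (H v' i j k uq _ (key _ sv)) => w /nr[w1 w2]; split=> //.
    by case: ex => ->.
  by case: ev => ->.
rewrite negb_or => /andP[xu xv]; apply: (ug u v i j k uq nr); apply: key => s.
rewrite !inE !negb_or /erho; case: (eqVneq s y) => [_ _|//]; by rewrite xu xv.
Qed.

Lemma K4_of_sets (g : rel T) (a b c d : V) (A B C D : {set T}) :
  symmetric g -> uniq [:: a; b; c; d] ->
  iota a \in A -> iota b \in B -> iota c \in C -> iota d \in D ->
  cset g A -> cset g B -> cset g C -> cset g D ->
  [disjoint A & B] -> [disjoint A & C] -> [disjoint A & D] ->
  [disjoint B & C] -> [disjoint B & D] -> [disjoint C & D] ->
  touch g A B -> touch g A C -> touch g A D -> touch g B C -> touch g B D -> touch g C D ->
  has_minor (@neq_rel V) g iota.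
Proof.
move=> sg uq rA rB rC rD cA cB cC cD AB AC AD BC BD CD tAB tAC tAD tBC tBD tCD.
have cov v := cover4 v uq.
move: uq; rewrite /= !inE !negb_or => /and4P[/and3P[ab ac ad] /andP[bc bd] cd _].
pose E v := if v == a then A else if v == b then B else if v == c then C else D.
have Ea : E a = A by rewrite /E eqxx.
have Eb : E b = B by rewrite /E eq_sym (negPf ab) eqxx.
have Ec : E c = C by rewrite /E ![c == _]eq_sym (negPf ac) (negPf bc) eqxx.
have Ed : E d = D by rewrite /E ![d == _]eq_sym (negPf ad) (negPf bd) (negPf cd).
have covP v : [\/ v = a, v = b, v = c | v = d].
  by have := cov v; rewrite !inE => /or4P[] /eqP->; [apply: Or41|apply: Or42|apply: Or43|apply: Or44].
have dj (X Y : {set T}) x : [disjoint X & Y] -> x \in X -> x \in Y -> False.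
  by move=> d_ xX; rewrite (disjointFr d_ xX).
have tch X Y := @touch_sym T g X Y sg.
exists E; split.
- by move=> v; case: (covP v) => ->; rewrite ?Ea ?Eb ?Ec ?Ed.
- by move=> v; case: (covP v) => ->; rewrite ?Ea ?Eb ?Ec ?Ed.
- move=> u v x; case: (covP u) => ->; case: (covP v) => ->; rewrite ?Ea ?Eb ?Ec ?Ed // => x1 x2;
  exfalso; first [exact: (dj _ _ _ AB x1 x2)|exact: (dj _ _ _ AB x2 x1)
  |exact: (dj _ _ _ AC x1 x2)|exact: (dj _ _ _ AC x2 x1)|exact: (dj _ _ _ AD x1 x2)
  |exact: (dj _ _ _ AD x2 x1)|exact: (dj _ _ _ BC x1 x2)|exact: (dj _ _ _ BC x2 x1)
  |exact: (dj _ _ _ BD x1 x2)|exact: (dj _ _ _ BD x2 x1)|exact: (dj _ _ _ CD x1 x2)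
  |exact: (dj _ _ _ CD x2 x1)].
by move=> u v; rewrite /neq_rel; case: (covP u) => ->; case: (covP v) => ->;
  rewrite ?eqxx ?Ea ?Eb ?Ec ?Ed // => _; apply: tch.
Qed.

Lemma fourth (a b c : V) : uniq [:: a; b; c] -> exists d, uniq [:: a; b; c; d].
Proof.
by move: a b c => [[] []] [[] []] [[] []] //= _;
  first [by exists (true, true)|by exists (true, false)|by exists (false, true)|by exists (false, false)].
Qed.

Lemma erho_disj (x y : T) (A B : {set T}) s : (forall s, s \in A -> s \in B -> False) ->
  (x \in A) = (y \in A) -> (x \in B) = (y \in B) ->
  s \in erho x y @: A -> s \in erho x y @: B -> False.
Proof.
move=> AB xA xB /imsetP[s1 s1A ->] /imsetP[s2 s2B].
rewrite /erho; case: (eqVneq s1 y) s1A => [-> yA|_ s1A];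
  case: (eqVneq s2 y) s2B => [-> yB|_ s2B] e.
- exact: (AB y).
- by apply: (AB x); [rewrite xA|rewrite e].
- by apply: (AB x); [rewrite -e|rewrite xB].
- by apply: (AB s1) => //; rewrite e.
Qed.

Lemma wheel_ctr (g : rel T) r C D x y : is_wheel g iota r C D -> (forall v, iota v != y) ->
  (forall v, (x \in C v) = (y \in C v)) -> (x \in D) = (y \in D) ->
  is_wheel (ctr g (erho x y)) iota r (fun v => erho x y @: C v) (erho x y @: D).
Proof.
move=> w iy sC sD.
have dj u v s : u != v -> s \in C u -> s \in C v -> False.
  by move=> uv s1 s2; move: uv; rewrite (wh_dis w s1 s2) eqxx.
have tch (A B : {set T}) : (forall s, s \in A -> s \in B -> False) -> (x \in A) = (y \in A) ->
    (x \in B) = (y \in B) -> touch g A B -> touch (ctr g (erho x y)) (erho x y @: A) (erho x y @: B).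
  move=> AB xA xB [a [b [aA bB ab]]]; exists (erho x y a), (erho x y b).
  rewrite !imset_f //; split=> //; apply/ctrP; split; last by exists a, b.
  apply/eqP=> e; apply: (@erho_disj x y A B (erho x y a)) => //; first exact: imset_f.
  by rewrite e imset_f.
have Dd v s : s \in C v -> s \in D -> False by move=> sv; apply/negP/(wh_Ddis w sv).
split.
- by move=> v; rewrite -{1}(erho_n x (iy v)) imset_f // (wh_root w).
- by move=> v; apply: cset_image; apply: (wh_con w).
- move=> u v s s1 s2; apply/eqP/negPn/negP=> uv.
  by apply: (@erho_disj x y (C u) (C v) s) => // s'; apply: dj.
- by apply: cset_image; apply: (wh_Dcon w).
- move=> v s s1; apply/negP=> s2; apply: (@erho_disj x y (C v) D s) => // s'; exact: Dd.
- move=> v vr; apply: tch => //; last exact: (wh_adj w).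
  by move=> s; apply: dj; rewrite eq_sym.
move=> v vr; apply: tch => //; last exact: (wh_Dadj w).
by move=> s s1 s2; apply: (Dd v s).
Qed.

(** * A minimal wheel without K4 *)

Section WheelStep.
Variables (g : rel T) (r : V).
Hypotheses (sg : symmetric g) (ug : unsplit g) (nm : ~ has_minor (@neq_rel V) g iota)
  (IH : forall g', nz g' < nz g -> symmetric g' -> unsplit g' ->
     (exists C D, is_wheel g' iota r C D) -> has_minor (@neq_rel V) g' iota).

(** An edge that does not cross the boundary of a set of the wheel can be contracted without
    destroying the wheel. By minimality the contraction must therefore destroy [unsplit]. *)
Lemma wheel_split C D x y : is_wheel g iota r C D -> (forall v, (x \in C v) = (y \in C v)) ->
  (x \in D) = (y \in D) -> g x y -> x != y -> (forall v, iota v != y) ->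
  exists v i j k, [/\ uniq [:: i; j; k],
    {in [:: i; j; k], forall w, [/\ iota w != x, iota w != y & iota w != v]} &
    sep3 g (~: [set x; y; v]) (iota i) (iota j) (iota k)].
Proof.
move=> w sC sD gxy nxy iy; apply: NNPP => H.
have [||||C' mC'] := @IH (ctr g (erho x y)).
- exact: nz_erho.
- exact: ctr_sym.
- apply: unsplit_ctr => // v i j k uq nr s; apply: H.
  by exists v, i, j, k.
- by exists (fun v => erho x y @: C v), (erho x y @: D); apply: wheel_ctr.
apply: nm; exists (fun v => erho x y @^-1: C' v); apply: (minor_ctr sg) mC'.
- exact: erho_idem.
- exact: erho_fib.
by move=> v; rewrite erho_n.
Qed.

(** A neighbour in another set [C j] yields K4 at once, with [C k :|: D] as the third set. Otherwise
    [t] can be put into [C i], and [wheel_split] provides a [v] that, together with the two ends,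
    separates the other three roots. But the rest of the wheel still joins two of these after the
    removal of any one vertex. *)
Lemma wheel_nbr C D i t : is_wheel g iota r C D -> i != r -> g (iota i) t -> t != iota i ->
  t \in C r :|: D.
Proof.
move=> w ir it ti; apply/negPn/negP; rewrite in_setU negb_or => /andP[tr tD].
have dj u v s : u != v -> s \in C u -> s \in C v -> False.
  by move=> uv s1 s2; move: uv; rewrite (wh_dis w s1 s2) eqxx.
have dC u v : u != v -> [disjoint C u & C v].
  by move=> uv; rewrite -setI_eq0; apply/eqP/setP=> s; rewrite !inE; apply/negP=> /andP[]; apply: dj.
have dD u : [disjoint C u & D].
  rewrite -setI_eq0; apply/eqP/setP=> s; rewrite !inE; apply/negP=> /andP[s1].
  by apply/negP/(wh_Ddis w s1).
have tch X Y := @touch_sym T g X Y sg.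
case: (pickP (fun j => (j != i) && (t \in C j))) => [j /andP[ji tj]|nj].
  have jr : j != r by apply: contraTneq tj => ->.
  have u3 : uniq [:: r; i; j].
    by rewrite /= !inE negb_or ![r == _]eq_sym ir jr eq_sym ji.
  have [k uk] := fourth u3; have := uk.
  rewrite /= !inE !negb_or !andbT => /and3P[/and3P[_ _ rk] /andP[_ ik] jk].
  have kr : k != r by rewrite eq_sym.
  have uq : uniq [:: i; j; k; r].
    by rewrite /= !inE !negb_or [i == j]eq_sym ji ik ir jk jr kr.
  apply: nm; apply: (@K4_of_sets g i j k r (C i) (C j) (C k :|: D) (C r)) => //;
    try exact: (wh_root w); try exact: (wh_con w); try by apply: dC; rewrite // eq_sym.
  - by rewrite inE (wh_root w).
  - apply: csetU => //; [exact: (wh_con w)|exact: (wh_Dcon w)|right].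
    by apply: tch; apply: (wh_Dadj w).
  - by rewrite disjoint_sym; apply: disjoint_setU; rewrite disjoint_sym; [apply: dC|apply: dD].
  - by rewrite disjoint_sym; apply: disjoint_setU; rewrite disjoint_sym; [apply: dC|apply: dD].
  - by apply: disjoint_setU; [apply: dC|rewrite disjoint_sym; apply: dD].
  - by exists (iota i), t; rewrite (wh_root w).
  - by apply: tch; apply: touch_sub (wh_Dadj w ir); rewrite ?subsetUr.
  - by apply: tch; apply: (wh_adj w).
  - by apply: tch; apply: touch_sub (wh_Dadj w jr); rewrite ?subsetUr.
  - by apply: tch; apply: (wh_adj w).
  - by apply: tch; apply: touch_sub (wh_adj w kr); rewrite ?subsetUl.
have tn v : iota v != t.
  apply/eqP=> e; case: (eqVneq v i) => [ev|vi]; first by rewrite -e ev eqxx in ti.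
  by have := nj v; rewrite vi -e (wh_root w).
have nti : iota i != t by rewrite eq_sym.
have nCt v : v != i -> t \notin C v by move=> vi; have := nj v; rewrite vi => /negbT.
pose C' v := if v == i then t |: C i else C v.
have C'i : C' i = t |: C i by rewrite /C' eqxx.
have C'n v : v != i -> C' v = C v by rewrite /C' => /negPf->.
have CC' v : C v \subset C' v.
  by rewrite /C'; case: eqP => [->|_]; rewrite ?subsetUr.
have w' : is_wheel g iota r C' D.
  split.
  - by move=> v; apply: (subsetP (CC' v)); apply: (wh_root w).
  - move=> v; rewrite /C'; case: eqP => [_|_]; last exact: (wh_con w).
    by apply: csetU1 sg (wh_con w i) (wh_root w i) _; rewrite sg.
  - move=> u v s; case: (eqVneq u i) => [->|ui]; case: (eqVneq v i) => [->|vi] //;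
    rewrite ?C'i ?(C'n u ui) ?(C'n v vi).
    + by case/setU1P=> [->|s1 s2]; [rewrite (negPf (nCt v vi))|apply: (wh_dis w s1 s2)].
    + by move=> s2 /setU1P[e|s1]; [move: s2; rewrite e (negPf (nCt u ui))|apply: (wh_dis w s2 s1)].
    + exact: (wh_dis w).
  - exact: (wh_Dcon w).
  - move=> v s; rewrite /C'; case: eqP => [_ /setU1P[->//|]|_]; exact: (wh_Ddis w).
  - move=> v vr; apply: touch_sub (CC' _) (CC' _) (wh_adj w vr).
  move=> v vr; apply: touch_sub (subxx _) (CC' _) (wh_Dadj w vr).
have iD : iota i \notin D by apply: (wh_Ddis w (wh_root w i)).
have sC v : (iota i \in C' v) = (t \in C' v).
  case: (eqVneq v i) => [->|vi]; first by rewrite C'i !inE eqxx (wh_root w) orbT.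
  rewrite C'n // (negPf (nCt v vi)); apply/negP=> iv.
  by move: vi; rewrite (wh_dis w iv (wh_root w i)) eqxx.
have sD : (iota i \in D) = (t \in D) by rewrite (negPf tD) (negPf iD).
have [v [j [k [l [uq nr [s1 s2 s3]]]]]] := wheel_split w' sC sD it nti tn.
have uq4 : uniq [:: i; j; k; l].
  rewrite cons_uniq uq andbT; apply/negP=> /nr[]; by rewrite eqxx.
have nv u : u \in [:: j; k; l] -> u != i by move=> /nr[e _ _]; apply: contraNneq e => ->.
have Cv u : u != i -> v \notin C u -> C u \subset ~: [set iota i; t; v].
  move=> ui vu; apply/subsetP=> s su; rewrite !inE !negb_or; apply/andP; split.
    apply/andP; split; last by apply: contraNneq (nCt u ui) => <-.
    by apply: contraNneq ui => e; apply/eqP; apply: (wh_dis w su); rewrite e (wh_root w).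
  by apply: contraNneq vu => <-.
have conn A a b : a \in [:: j; k; l] -> b \in [:: j; k; l] -> a != b -> cset g A ->
    A \subset ~: [set iota i; t; v] -> iota a \in A -> iota b \in A -> False.
  move=> aJ bJ ab cA sA aA bA; have c1 := cset_connect cA sA aA bA.
  have c2 := cset_connect cA sA bA aA.
  by move: aJ bJ ab c1 c2 s1 s2 s3; rewrite !inE => /or3P[]/eqP-> /or3P[]/eqP->;
    rewrite ?eqxx // => _ c1 c2 z1 z2 z3; first [by rewrite c1 in z1|by rewrite c1 in z2|by rewrite c1 in z3
     |by rewrite c2 in z1|by rewrite c2 in z2|by rewrite c2 in z3].
have rJ : r \in [:: j; k; l].
  by have := cover4 r uq4; rewrite inE eq_sym (negPf ir).
have [a [b [aJ bJ ab ar br]]] : exists a b, [/\ a \in [:: j; k; l], b \in [:: j; k; l],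
    a != b, a != r & b != r].
  move: uq; rewrite /= !inE negb_or andbT => /andP[/andP[jk jl] kl].
  move: rJ; rewrite !inE => /or3P[]/eqP->.
  - by exists k, l; rewrite !inE !eqxx ?orbT kl ![_ == j]eq_sym.
  - by exists j, l; rewrite !inE !eqxx ?orbT jl [l == k]eq_sym.
  - by exists j, k; rewrite !inE !eqxx ?orbT.
have [ai bi ri] : [/\ a != i, b != i & r != i] by split; apply: nv.
have UU (A B : {set T}) : touch g A B -> cset g A -> cset g B -> cset g (A :|: B).
  by move=> tAB cA cB; apply: csetU => //; right.
(* If [v] is in [C r], then [D] joins the roots [a] and [b]. If not, [C r] joins [r] to [a] or to
   [b], since [v] cannot lie in both [C a] and [C b]. *)
case: (boolP (v \in C r)) => [vr|vr].
  apply: (conn (D :|: C a :|: C b) a b) => //.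
  - apply: (UU); [|apply: (UU)|]; try exact: (wh_con w); try exact: (wh_Dcon w).
      by apply: touch_sub (wh_Dadj w br); rewrite ?subsetUl.
    exact: (wh_Dadj w).
  - rewrite !subUset !Cv ?andbT //.
    + apply/subsetP=> s sDD; rewrite !inE !negb_or; apply/andP; split; last first.
        by apply: contraTneq sDD => ->; apply: (wh_Ddis w vr).
      by apply/andP; split; apply: contraTneq sDD => ->.
    + by apply/negP=> vb; move: br; rewrite (wh_dis w vb vr) eqxx.
    + by apply/negP=> va; move: ar; rewrite (wh_dis w va vr) eqxx.
  - by rewrite !in_setU (wh_root w a) orbT.
  - by rewrite !in_setU (wh_root w b) orbT.
have main c : c \in [:: j; k; l] -> c != r -> c != i -> v \in C c.
  move=> cJ cr ci; apply/negPn/negP=> vc; apply: (conn (C r :|: C c) r c) => //.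
  - by rewrite eq_sym.
  - by apply: (UU); [apply: (wh_adj w)|apply: (wh_con w)|apply: (wh_con w)].
  - by rewrite subUset !Cv.
  - by rewrite in_setU (wh_root w).
  - by rewrite in_setU (wh_root w) orbT.
by move: ab; rewrite (wh_dis w (main a aJ ar ai) (main b bJ br bi)) eqxx.
Qed.

Lemma wheel_single C D i : is_wheel g iota r C D -> i != r -> C i = [set iota i].
Proof.
move=> w ir; apply/eqP; rewrite eqEsubset sub1set (wh_root w) andbT.
apply/subsetP=> x xC; apply/negPn/negP=> xi.
have [s [t [_ /set1P-> tC ti it]]] := cset_cut (wh_con w i) (wh_root w i) (set11 _) xC xi.
rewrite inE in ti; have := wheel_nbr w ir it ti; rewrite in_setU => /orP[tr|tD].
  by move: ir; rewrite (wh_dis w tC tr) eqxx.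
by move: tD; apply/negP; apply: (wh_Ddis w tC).
Qed.

(** The components of the three roots outside [R0] and [D0] form another wheel, with sides [R0] and
    [D0]. Applied to it, [wheel_single] and [wheel_nbr] shrink the components to single vertices and
    confine their neighbours. *)
Lemma wheel_comp C D (R0 D0 : {set T}) y : is_wheel g iota r C D ->
  cset g R0 -> cset g D0 -> iota r \in R0 -> y \in D0 -> R0 \subset C r -> D0 \subset D ->
  (forall u v, u != r -> v != r -> u != v ->
     ~~ connect (ind g (~: (R0 :|: D0))) (iota u) (iota v)) ->
  forall v, v != r -> [/\ forall t, g (iota v) t -> t != iota v -> t \in R0 :|: D0,
    exists2 t, t \in R0 & g (iota v) t & exists2 t, t \in D0 & g (iota v) t].
Proof.
move=> w0 cR cD rR yD /subsetP sR /subsetP sD sep.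
have RD x : x \in R0 -> x \notin D0.
  by move=> /sR xR; apply/negP=> /sD; apply/negP/(wh_Ddis w0 xR).
have iR v : v != r -> iota v \notin R0.
  by move=> vr; apply: contra vr => /sR/(wh_dis w0 (wh_root w0 v))->.
have iD v : iota v \notin D0.
  by apply/negP=> /sD; apply/negP/(wh_Ddis w0 (wh_root w0 v)).
have iRD v : v != r -> iota v \notin R0 :|: D0 by move=> vr; rewrite in_setU negb_or iR ?iD.
have un v (A : {set T}) : v != r -> cset g A -> touch g A (C v) -> cset g (A :|: [set iota v]).
  move=> vr cA tA; rewrite -(wheel_single w0 vr).
  by apply: csetU => //; [exact: (wh_con w0)|right].
have HA v : v != r -> exists A : {set T}, [/\ cset g A, iota v \in A, [disjoint A & D0] &
    exists2 x, x \in A & x \in R0].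
  move=> vr; exists (C r :|: [set iota v]); split.
  - by apply: un => //; [exact: (wh_con w0)|exact: (wh_adj w0)].
  - by rewrite !inE eqxx orbT.
  - apply: disjoint_of => s /setUP[sr|/set1P->//].
    by apply/negP=> /sD; apply/negP/(wh_Ddis w0 sr).
  - by exists (iota r); rewrite // inE (wh_root w0).
have HB v : v != r -> exists A : {set T}, [/\ cset g A, iota v \in A, [disjoint A & R0] &
    exists2 x, x \in A & x \in D0].
  move=> vr; exists (D :|: [set iota v]); split.
  - by apply: un => //; [exact: (wh_Dcon w0)|exact: (wh_Dadj w0)].
  - by rewrite !inE eqxx orbT.
  - apply: disjoint_of => s /setUP[sD'|/set1P->]; last exact: iR.
    by apply: contraTN sD' => /sR/(wh_Ddis w0).
  - by exists y; rewrite // inE sD.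
pose N := ~: (R0 :|: D0).
have rN v : v != r -> iota v \in N by move=> vr; rewrite inE iRD.
pose K v := if v == r then R0 else cc g N (iota v).
have Kr : K r = R0 by rewrite /K eqxx.
have Kn v : v != r -> K v = cc g N (iota v) by rewrite /K => /negPf->.
have KN v x : v != r -> x \in K v -> x \notin R0 /\ x \notin D0.
  move=> vr; rewrite Kn // => /(subsetP (cc_sub _ _ _)); rewrite !inE negb_or => /andP[] //.
have out v (A B E : {set T}) : v != r -> R0 :|: D0 = B :|: E -> cset g A -> iota v \in A ->
    [disjoint A & E] -> (exists2 x, x \in A & x \in B) -> touch g (K v) B.
  move=> vr e cA vA dA [x xA xB]; have vK : iota v \in K v by rewrite Kn ?mem_cc ?rN.
  have xK : x \notin K v.
    apply/negP=> /(KN v x vr)[xR xD]; have : x \in R0 :|: D0 by rewrite e inE xB.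
    by rewrite in_setU (negPf xR) (negPf xD).
  have [s [t [sA sK tA tK st]]] := cset_cut cA vA vK xA xK.
  exists s, t; split=> //; apply: contraNT tK => tB; rewrite Kn // in sK *.
  by apply: cc_closed sK _ st; rewrite inE e inE negb_or tB (disjointFr dA tA).
have w : is_wheel g iota r K D0.
  split=> //.
  - by move=> v; case: (eqVneq v r) => [->|vr]; rewrite ?Kr // Kn // mem_cc // rN.
  - by move=> v; case: (eqVneq v r) => [->|vr]; rewrite ?Kr // Kn //; apply: cset_cc; rewrite ?rN.
  - move=> u v x; case: (eqVneq u r) => [->|ur]; case: (eqVneq v r) => [->|vr] //.
    + by rewrite Kr => xR /(KN v x vr)[]; rewrite xR.
    + by rewrite Kr => /(KN u x ur)[/negPf->].
    rewrite !Kn // !inE => /andP[_ c1] /andP[_ c2]; apply/eqP/negPn/negP=> uv.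
    case/negP: (sep u v ur vr uv); apply: connect_trans c1 _.
    by rewrite (sym_connect_sym (ind_sym _ sg)).
  - by move=> v x; case: (eqVneq v r) => [->|vr]; [rewrite Kr; apply: RD|case/(KN v x vr)].
  - move=> v vr; rewrite Kr; have [A [cA vA dA xA]] := HA v vr.
    by apply: touch_sym => //; apply: (out v A R0 D0).
  move=> v vr; have [A [cA vA dA xA]] := HB v vr.
  by apply: touch_sym => //; apply: (out v A D0 R0); rewrite // setUC.
move=> v vr; have Kv := wheel_single w vr; split.
- by move=> t vt tv; have := wheel_nbr w vr vt tv; rewrite Kr.
- have [s [t [sK tK st]]] := wh_adj w vr; rewrite Kr in sK.
  by rewrite Kv in tK; exists s; rewrite // sg -(set1P tK).
- have [s [t [sK tK st]]] := wh_Dadj w vr.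
  by rewrite Kv in tK; exists s; rewrite // sg -(set1P tK).
Qed.

(** Otherwise the pair [u], [v] would separate the three roots other than [r]: once it is removed,
    [t] is their only possible neighbour, and a path between two of them needs both to be adjacent
    to [t]. *)
Lemma two_nbrs (t u v : T) : (forall w, w != r -> iota w != u /\ iota w != v) ->
  (forall w s, w != r -> g (iota w) s -> s != iota w -> s \in [:: t; u; v]) ->
  exists a b, [/\ a != r, b != r, a != b, g (iota a) t & g (iota b) t].
Proof.
move=> nuv nb; have [i [j [k]]] := others4 r.
rewrite cons_uniq !inE !negb_or => /andP[/and3P[ri rj rk] uq].
have [ir jr kr] : [/\ i != r, j != r & k != r] by rewrite ![_ == r]eq_sym.
apply: NNPP => H; apply: (ug (u := u) (v := v) uq).
  by move=> w; rewrite !inE => /or3P[]/eqP->; apply: nuv.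
move: uq; rewrite /= !inE negb_or andbT => /andP[/andP[ij ik] jk].
have gt a b : a != r -> a != b -> connect (ind g (~: [set u; v])) (iota a) (iota b) -> g (iota a) t.
  move=> ar ab /connect_step[|s [sN sa as_ _]]; first by apply: contra ab => /eqP/ii->.
  have := nb a s ar as_ sa; move: sN; rewrite !inE negb_or => /andP[/negPf-> /negPf->].
  by rewrite !orbF => /eqP<-.
have key a b : a != r -> b != r -> a != b -> ~~ connect (ind g (~: [set u; v])) (iota a) (iota b).
  move=> ar br ab; apply/negP=> c; apply: H; exists a, b; split=> //; first exact: (gt a b).
  apply: (gt b a) => //; first by rewrite eq_sym.
  by rewrite (sym_connect_sym (ind_sym _ sg)).
by split; apply: key.
Qed.

(** Two sets of at least two elements covering the three roots other than [r] have a common element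
    [c], and the two remaining roots can be divided between them. *)
Lemma two_by_two (p q : pred V) : (forall w, w != r -> p w || q w) ->
  (exists a b, [/\ a != r, b != r, a != b, p a & p b]) ->
  (exists a b, [/\ a != r, b != r, a != b, q a & q b]) ->
  exists a b c, [/\ uniq [:: a; b; c; r], p a, p c, q b & q c].
Proof.
move=> pq [a [b [ar br ab pa pb]]] Q.
have u3 : uniq [:: r; a; b] by rewrite /= !inE negb_or ![r == _]eq_sym ar br ab.
have [c u4] := fourth u3; have cov v := cover4 v u4.
move: u4; rewrite /= !inE !negb_or !andbT => /and3P[/and3P[_ _ rc] /andP[_ ac] bc].
have cr : c != r by rewrite eq_sym.
have fin (x y z : V) : x != y -> x != z -> y != z -> x != r -> y != r -> z != r ->
    uniq [:: x; y; z; r].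
  by move=> h1 h2 h3 h4 h5 h6; rewrite /= !inE !negb_or h1 h2 h3 h4 h5 h6.
have covP v : v != r -> [\/ v = a, v = b | v = c].
  by move=> vr; have := cov v; rewrite !inE (negPf vr) /= => /or3P[]/eqP->; [apply: Or31|apply: Or32|apply: Or33].
case: (boolP (q c)) => qc.
  case: (boolP (q a)) => qa.
    by exists b, c, a; split=> //; apply: fin; rewrite // eq_sym.
  case: (boolP (q b)) => qb.
    by exists a, c, b; split=> //; apply: fin; rewrite // eq_sym.
  case: Q => x [y [xr yr xy qx qy]]; exfalso.
  by move: xy qx qy; case: (covP x xr) => ->; case: (covP y yr) => ->;
    rewrite ?eqxx ?(negPf qa) ?(negPf qb).
have pc : p c by have := pq c cr; rewrite (negPf qc) orbF.
have [qa qb] : q a /\ q b.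
  case: Q => x [y [xr yr xy qx qy]]; move: xy qx qy.
  by case: (covP x xr) => ->; case: (covP y yr) => ->; rewrite ?eqxx ?(negPf qc) // => _ h1 h2.
by exists c, a, b; split=> //; apply: fin; rewrite // eq_sym.
Qed.

(* The four branch sets are {p, u}, {q, t}, {s} and {r}. *)
Lemma wheel_K4_small p q s u t : uniq [:: p; q; s; r] -> u != t ->
  (forall v, iota v != u) -> (forall v, iota v != t) ->
  g (iota p) u -> g (iota s) u -> g (iota q) t -> g (iota s) t -> g (iota p) (iota r) ->
  g (iota s) (iota r) -> touch g [set iota p; u] [set iota q; t] ->
  touch g [set iota q; t] [set iota r] -> False.
Proof.
move=> uq ut nu nt pu su qt st pr sr tpq tqr; apply: nm.
have := uq; rewrite /= !inE !negb_or => /and4P[/and3P[pq ps pr'] /andP[qs qr'] sr' _].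
have ne a b : a != b -> iota a != iota b by apply: contra => /eqP/ii->.
have [nu' nt'] : (forall v, u != iota v) /\ (forall v, t != iota v) by split=> v; rewrite eq_sym.
apply: (@K4_of_sets g p q s r [set iota p; u] [set iota q; t] [set iota s] [set iota r]) => //;
  rewrite ?set21 ?set11 //; try exact: cset1; try (by apply: cset2).
- by apply: disjoint_of => x /set2P[]->; rewrite !inE negb_or ?ne ?nt ?nu' ?ut.
- by apply: disjoint_of => x /set2P[]->; rewrite !inE ?ne.
- by apply: disjoint_of => x /set2P[]->; rewrite !inE ?ne.
- by apply: disjoint_of => x /set2P[]->; rewrite !inE ?ne.
- by apply: disjoint_of => x /set2P[]->; rewrite !inE ?ne.
- by apply: disjoint_of => x /set1P->; rewrite !inE ?ne.
- by exists u, (iota s); rewrite set22 set11 sg.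
- by exists (iota p), (iota r); rewrite set21 set11.
- by exists t, (iota s); rewrite set22 set11 sg.
- by exists (iota s), (iota r); rewrite !set11.
Qed.

Lemma wheel_false C D : is_wheel g iota r C D -> False.
Proof.
move=> w; have sing v (vr : v != r) := wheel_single w vr.
have ne u v : u != v -> iota u != iota v by apply: contra => /eqP/ii->.
have [i [j [k]]] := others4 r.
rewrite cons_uniq !inE !negb_or => /andP[/and3P[ri rj rk] uijk].
have [ir jr] : i != r /\ j != r by rewrite ![_ == r]eq_sym.
have inD x : x \in D -> forall v, iota v != x.
  by move=> xD v; apply: contraTneq xD => <-; apply: (wh_Ddis w (wh_root w v)).
have inabc a b c : uniq [:: a; b; c] -> r \notin [:: a; b; c] ->
    forall v : V, v != r -> v \in [:: a; b; c].
  move=> uq rn v vr; have uq4 : uniq [:: r; a; b; c] by rewrite cons_uniq uq rn.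
  by have := cover4 v uq4; rewrite inE (negPf vr).
have rest (p q s : V) : uniq [:: p; q; s; r] -> [/\ p != r, q != r & s != r].
  by rewrite /= !inE !negb_or => /and4P[/and3P[_ _ ->] /andP[_ ->] ->].
case: (boolP [exists x in C r, x != iota r]) => [/exists_inP[x0 x0C x0r]|none].
  have [r' [x [_ /set1P-> xC xr rx]]] := cset_cut (wh_con w r) (wh_root w r) (set11 _) x0C
    (ltac:(by rewrite inE)).
  rewrite inE in xr.
  have nx v : iota v != x.
    case: (eqVneq v r) => [->|]; first by rewrite eq_sym.
    by apply: contraNneq => e; apply/eqP; apply: (wh_dis w _ xC); rewrite -e (wh_root w).
  have sC v : (iota r \in C v) = (x \in C v).
    by apply/idP/idP => h; [rewrite (wh_dis w h (wh_root w r))|rewrite (wh_dis w h xC) (wh_root w)].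
  have sD : (iota r \in D) = (x \in D).
    by rewrite (negPf (wh_Ddis w xC)) (negPf (wh_Ddis w (wh_root w r))).
  have [|y [a [b [c [uq nr sp]]]]] := wheel_split w sC sD rx _ nx; first by rewrite eq_sym.
  have rabc : r \notin [:: a; b; c] by apply/negP=> /nr[]; rewrite eqxx.
  have abc := inabc _ _ _ uq rabc.
  have spr u v : u != r -> v != r -> u != v ->
      ~~ connect (ind g (~: ([set iota r; x] :|: [set y]))) (iota u) (iota v).
    by move=> ur vr uv; apply: (sep3_pair sg sp); rewrite ?abc.
  have yr v : v != r -> iota v != y by move=> /abc/nr[].
  (* Otherwise [D] still joins the roots [i] and [j] when [iota r], [x] and [y] are removed. *)
  have yD : y \in D.
    apply/negPn/negP=> yD.
    have ij : i != j by move: uijk; rewrite /= !inE negb_or => /andP[/andP[]].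
    have := spr i j ir jr ij; apply/negP/negPn.
    have cij : cset g (D :|: C i :|: C j).
      apply: csetU; [done| |exact: (wh_con w)|right].
        by apply: csetU; [|exact: (wh_Dcon w)|exact: (wh_con w)|right; apply: (wh_Dadj w)].
      by apply: touch_sub (wh_Dadj w jr); rewrite ?subsetUl.
    apply: (cset_connect cij); try by rewrite !in_setU !(wh_root w) ?orbT.
    rewrite !sing //; apply/subsetP=> s; rewrite !inE !negb_or => /orP[/orP[sD'|/eqP->]|/eqP->];
      rewrite ?ne ?nx ?yr // [s == _]eq_sym inD // (contraTneq _ sD') => [|->]; last exact: (wh_Ddis w xC).
    by apply: contraNneq yD => <-.
  have H := wheel_comp w (cset2 sg rx) (@cset1 _ g y) (set21 _ _) (set11 y)
    (ltac:(by rewrite subUset !sub1set xC (wh_root w))) (ltac:(by rewrite sub1set)) spr.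
  have gy v : v != r -> g (iota v) y by move=> vr; have [_ _ [t /set1P->]] := H v vr.
  have grx v : v != r -> g (iota v) (iota r) || g (iota v) x.
    by move=> vr; have [_ [t /set2P[]-> ->] _] := H v vr; rewrite ?orbT.
  have nb v s : v != r -> g (iota v) s -> s != iota v -> [|| s == iota r, s == x | s == y].
    by move=> vr vs sv; have [/(_ s vs sv) h _ _] := H v vr; move: h; rewrite !inE orbA.
  have T1 : exists a b, [/\ a != r, b != r, a != b, g (iota a) (iota r) & g (iota b) (iota r)].
    apply: (@two_nbrs (iota r) x y) => [v vr|v s vr vs sv]; first by rewrite nx yr.
    by rewrite !inE; apply: (nb v).
  have T2 : exists a b, [/\ a != r, b != r, a != b, g (iota a) x & g (iota b) x].
    apply: (@two_nbrs x (iota r) y) => [v vr|v s vr vs sv]; first by rewrite ne ?yr.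
    by rewrite !inE orbCA; apply: (nb v).
  have [p [q [s [uq4 pr sr qx sx]]]] := two_by_two grx T1 T2; have [np nq ns] := rest p q s uq4.
  apply: (wheel_K4_small uq4 (u := y) (t := x)) => //; try exact: gy.
  - by apply: contraNneq (wh_Ddis w xC) => <-.
  - exact: inD.
  - by exists y, (iota q); rewrite set22 set21 sg gy.
  - by exists x, (iota r); rewrite set22 set11 sg.
have Cr : C r = [set iota r].
  apply/eqP; rewrite eqEsubset sub1set (wh_root w) andbT; apply/subsetP=> x xC.
  by rewrite inE; apply: contraNT none => xr; apply/exists_inP; exists x.
have gr v : v != r -> g (iota v) (iota r).
  by move=> vr; have [s [t [sr tv st]]] := wh_adj w vr; move: sr tv st;
    rewrite Cr (sing v vr) => /set1P-> /set1P->; rewrite sg.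
have [y [_ [yD _ _]]] := wh_Dadj w ir.
(* If [D] is a single vertex like [C r], these two vertices separate the other roots, against
   [unsplit]. So [D] contains an edge. *)
case: (boolP [exists d in D, d != y]) => [/exists_inP[d0 d0D d0y]|noneD]; last first.
  have DyE : D = [set y].
    apply/eqP; rewrite eqEsubset sub1set yD andbT; apply/subsetP=> x xD.
    by rewrite inE; apply: contraNT noneD => xr; apply/exists_inP; exists x.
  apply: (ug (u := iota r) (v := y) uijk).
    move=> v; rewrite !inE => vv; rewrite (inD y yD); split=> //; apply: ne.
    by case/or3P: vv => /eqP->; rewrite eq_sym.
  have key a b : a != r -> a != b -> ~~ connect (ind g (~: [set iota r; y])) (iota a) (iota b).
    move=> ar ab; apply/negP=> /connect_step[|s [sN sa as_ _]]; first exact: ne.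
    by move: sN; rewrite inE; apply/negP/negPn; have := wheel_nbr w ar as_ sa; rewrite Cr DyE.
  move: uijk; rewrite /= !inE negb_or andbT => /andP[/andP[ij ik] jk].
  by split; apply: key.
have [y' [d [_ /set1P-> dD dy yd]]] := cset_cut (wh_Dcon w) yD (set11 _) d0D (ltac:(by rewrite inE)).
rewrite inE in dy.
have yn := inD y yD; have dn := inD d dD.
have sC v : (y \in C v) = (d \in C v).
  by apply/idP/idP => h; [have := wh_Ddis w h; rewrite yD|have := wh_Ddis w h; rewrite dD].
have sD : (y \in D) = (d \in D) by rewrite yD dD.
have [|z [a [b [c [uq nr sp]]]]] := wheel_split w sC sD yd _ dn; first by rewrite eq_sym.
(* At least two of the separated roots differ from [r]. Both are adjacent to [iota r], so [iota r]
   must be among the removed vertices. *)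
have ez : z = iota r.
  apply/eqP/negPn/negP=> zr.
  have [u [v [uJ vJ uv ur vr]]] : exists u v, [/\ u \in [:: a; b; c], v \in [:: a; b; c],
      u != v, u != r & v != r].
    move: uq; rewrite /= !inE negb_or andbT => /andP[/andP[ab ac] bc].
    case: (eqVneq a r) => [ar|ar].
      by exists b, c; rewrite !inE !eqxx ?orbT bc -ar ![_ == a]eq_sym.
    case: (eqVneq b r) => [br|br]; last by exists a, b; rewrite !inE !eqxx ?orbT.
    by exists a, c; rewrite !inE !eqxx ?orbT ac -br [c == b]eq_sym.
  have := sep3_pair sg sp uJ vJ uv; apply/negP/negPn.
  have [u1 u2 u3] := nr u uJ; have [v1 v2 v3] := nr v vJ.
  apply: (@cset_connect _ g (iota u |: [set iota v; iota r])).
  - apply: (csetU1 sg (y := iota r)); [exact: cset2 sg (gr v vr)|exact: set22|exact: gr].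
  - apply/subsetP=> s; rewrite !inE !negb_or => /or3P[]/eqP->; rewrite ?u1 ?u2 ?u3 ?v1 ?v2 ?v3 //.
    by rewrite yn dn eq_sym zr.
  - by rewrite !inE eqxx.
  - by rewrite !inE eqxx orbT.
have rabc : r \notin [:: a; b; c] by apply/negP=> /nr[]; rewrite ez eqxx.
have abc := inabc _ _ _ uq rabc.
have spr u v : u != r -> v != r -> u != v ->
    ~~ connect (ind g (~: ([set iota r] :|: [set y; d]))) (iota u) (iota v).
  by move=> ur vr uv; rewrite setUC -ez; apply: (sep3_pair sg sp); rewrite ?abc.
have H := wheel_comp w (@cset1 _ g (iota r)) (cset2 sg yd) (set11 _) (set21 y d)
  (ltac:(by rewrite sub1set (wh_root w))) (ltac:(by rewrite subUset !sub1set yD dD)) spr.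
have gyd v : v != r -> g (iota v) y || g (iota v) d.
  by move=> vr; have [_ _ [t /set2P[]-> ->]] := H v vr; rewrite ?orbT.
have nb v s : v != r -> g (iota v) s -> s != iota v -> [|| s == iota r, s == y | s == d].
  by move=> vr vs sv; have [/(_ s vs sv) h _ _] := H v vr; move: h; rewrite !inE.
have T1 : exists a b, [/\ a != r, b != r, a != b, g (iota a) y & g (iota b) y].
  apply: (@two_nbrs y (iota r) d) => [v vr|v s vr vs sv]; first by rewrite ne.
  by rewrite !inE orbCA; apply: (nb v).
have T2 : exists a b, [/\ a != r, b != r, a != b, g (iota a) d & g (iota b) d].
  apply: (@two_nbrs d (iota r) y) => [v vr|v s vr vs sv]; first by rewrite ne.
  by rewrite !inE orbC -orbA; apply: (nb v).
have [p [q [s [uq4 py sy qd sd]]]] := two_by_two gyd T1 T2; have [np nq ns] := rest p q s uq4.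
apply: (wheel_K4_small uq4 (u := y) (t := d)) => //; try exact: gr.
- by rewrite eq_sym.
- by exists y, d; rewrite !set22.
- by exists (iota q), (iota r); rewrite set21 set11 gr.
Qed.
End WheelStep.

Lemma wheel_K4 (g : rel T) r C D : symmetric g -> unsplit g -> is_wheel g iota r C D ->
  has_minor (@neq_rel V) g iota.
Proof.
have [n] := ubnP (nz g); elim: n g C D => // n IH g C D gn sg ug w.
apply: NNPP => nm; apply: (wheel_false sg ug nm _ w) => g' lg sg' ug' [C' [D' w']].
by apply: (IH g' C' D') => //; apply: leq_trans lg _; rewrite -ltnS.
Qed.
End Wheel.

Section CsetMinusComponent.
Variables (T : finType) (g : rel T).

(** A walk in [S] can return from [Z] only at [v], and its first entry into [Z] is also from [v], so
    the detour can be cut out. *)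
Lemma cset_cutoff (S Z : {set T}) v r : symmetric g -> cset g S -> r \in S -> r \notin Z ->
  v \notin Z -> (forall x y, x \in S -> y \in S -> x \in Z -> y \notin Z -> g x y -> y = v) ->
  cset g (S :\: Z).
Proof.
move=> sg cS rS rZ vZ att; apply: (@csetP _ _ _ r) => //; first by rewrite inE rZ.
move=> W rW cl.
have sub : S \subset (W :\: Z) :|: (if v \in W then Z else set0).
  apply: (cset_sub cS rS); first by rewrite !inE rZ rW.
  move=> x y; case: (boolP (x \in Z)) => xZ.
    rewrite !inE xZ /=; case: ifP => [vW _|_]; last by rewrite inE.
    move=> xS yS xy; case: (boolP (y \in Z)) => // yZ /=.
    by rewrite orbF (att x y).
  rewrite !inE xZ /= => xW xS yS xy.
  have xW' : x \in W by move: xW; case: ifP; rewrite ?inE ?(negPf xZ) orbF.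
  case: (boolP (y \in Z)) => yZ /=; last by rewrite (cl x y) // inE ?xZ ?yZ.
  by rewrite -(att y x) ?xW' // sg.
apply/subsetP=> x; rewrite inE => /andP[xZ /(subsetP sub)].
by rewrite !inE xZ /=; case: ifP; rewrite ?inE ?(negPf xZ) orbF.
Qed.
End CsetMinusComponent.

(** * Two-vertex separations in minimal K4 schemes *)

Section K4Scheme.
Variables (T : finType) (g : rel T) (iota : V -> T) (S : V -> V -> {set T}).
Let h : rel V := @neq_rel V.
Hypotheses (sg : symmetric g) (ii : injective iota) (sS : scheme h g iota S)
  (ok : step_ok h g) (nm : ~ has_minor h g iota).

(** The three edges of a triangle have no common end, so a vertex in all three sets would have no
    label. *)
Lemma triangle_label (i j k : V) t : uniq [:: i; j; k] -> t \in S i j -> t \in S i k ->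
  t \in S j k -> False.
Proof.
rewrite /= !inE negb_or andbT => /andP[/andP[ij ik] jk] t1 t2 t3.
have [w Hw] := sch_lab sS (ij : h i j) t1.
case: (Hw i j ij t1) => e; subst w.
  by case: (Hw j k jk t3) => e; move: ij ik; rewrite e eqxx.
by case: (Hw i k ik t2) => e; move: ij jk; rewrite e eqxx.
Qed.

(** Were three roots separated by [u] and [v], each path between two of them would pass through [u]
    or [v], and by [triangle_label] neither vertex serves all three. So both carry labels. The
    component of the root that labels [u] contains no other root and can be cleared of the paths not
    ending there; then an edge at this root is contractible. *)
Lemma minimal_unsplit : unsplit iota g.
Proof.
move=> u v i j k uijk nr [s1 s2 s3].
pose N := ~: [set u; v]; pose con a b := connect (ind g N) (iota a) (iota b).
have csym a b : con a b = con b a by rewrite /con (sym_connect_sym (ind_sym N sg)).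
have ctr' a b c : con a b -> con b c -> con a c by apply: connect_trans.
have [ij ik jk] : [/\ i != j, i != k & j != k].
  by move: uijk; rewrite /= !inE negb_or andbT => /andP[/andP[-> ->] ->].
have hit a b : a != b -> ~~ con a b -> u \in S a b \/ v \in S a b.
  move=> ab nc; case: (boolP (u \in S a b)) => uS; first by left.
  right; apply: contraNT nc => vS.
  apply: cset_connect (sch_con sS (ab : h a b)) _ (sch_end sS (ab : h a b)) _.
    apply/subsetP=> x xS; rewrite !inE negb_or; apply/andP.
    by split; [apply: contraNneq uS => <-|apply: contraNneq vS => <-].
  by rewrite (sch_sym sS); apply: (sch_end sS); rewrite /h /neq_rel eq_sym.
have [h1 h2 h3] := And3 (hit i j ij s1) (hit i k ik s2) (hit j k jk s3).
have nothru t : (forall a b, a != b -> ~~ con a b -> t \in S a b) -> False.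
  by move=> H; apply: (triangle_label uijk (H i j ij s1) (H i k ik s2) (H j k jk s3)).
have [l u4] := fourth uijk; have cov w := cover4 w u4.
have notl (t : T) a b : iota l = t -> a \in [:: i; j; k] -> b \in [:: i; j; k] -> a != b ->
    t \notin S a b.
  move=> <- aJ bJ ab; apply/negP=> /(sch_root sS (ab : h a b)).
  move: u4; rewrite /= !inE !negb_or !andbT => /and3P[/and3P[_ _ il] /andP[_ jl] kl].
  by case=> e; move: aJ bJ; rewrite -?e !inE ![l == _]eq_sym ?(negPf il) ?(negPf jl) ?(negPf kl).
have inJ : [/\ i \in [:: i; j; k], j \in [:: i; j; k] & k \in [:: i; j; k]].
  by rewrite !inE !eqxx !orbT.
have [iJ jJ kJ] := inJ.
have lu : iota l != u.
  apply/eqP=> e; apply: (triangle_label (t := v) uijk).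
  - by case: h1 => //; rewrite (negPf (notl u i j e iJ jJ ij)).
  - by case: h2 => //; rewrite (negPf (notl u i k e iJ kJ ik)).
  - by case: h3 => //; rewrite (negPf (notl u j k e jJ kJ jk)).
have lv : iota l != v.
  apply/eqP=> e; apply: (triangle_label (t := u) uijk).
  - by case: h1 => //; rewrite (negPf (notl v i j e iJ jJ ij)).
  - by case: h2 => //; rewrite (negPf (notl v i k e iJ kJ ik)).
  - by case: h3 => //; rewrite (negPf (notl v j k e jJ kJ jk)).
have ru w : iota w != u /\ iota w != v.
  have := cov w; rewrite (mem_cat w [:: i; j; k] [:: l]) => /orP[/nr //|].
  by rewrite inE => /eqP->.
have label (t s : T) : (forall a b, a != b -> ~~ con a b -> t \in S a b \/ s \in S a b) ->
    exists w, forall a b, a != b -> t \in S a b -> w = a \/ w = b.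
  move=> H; have [[a [b [ab tS]]]|no] := classic (exists a b, a != b /\ t \in S a b).
    by have [w Hw] := sch_lab sS (ab : h a b) tS; exists w => a' b'; apply: Hw.
  by exfalso; apply: (nothru s) => a b ab nc; case: (H a b ab nc) => // tS; case: no; exists a, b.
have [wu Hu] := label u v hit.
have hit' a b : a != b -> ~~ con a b -> v \in S a b \/ u \in S a b.
  by move=> ab nc; case: (hit a b ab nc); [right|left].
have [wv Hv] := label v u hit'.
have far a b : a != b -> wu != a -> wu != b -> wv != a -> wv != b -> con a b.
  move=> ab ua ub va vb; apply/negPn/negP=> nc; case: (hit a b ab nc) => tS.
    by case: (Hu a b ab tS) => e; [move: ua|move: ub]; rewrite e eqxx.
  by case: (Hv a b ab tS) => e; [move: va|move: vb]; rewrite e eqxx.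
(* The roots lie in at least three components, so two components cannot account for all of them. *)
have pig p z : ~ (forall w, con w p \/ con w z).
  move=> H; have J a b c : con a c -> con b c -> con a b.
    by move=> ac bc; apply: (ctr' a c b ac); rewrite csym.
  by case: (H i) => hi; case: (H j) => hj; case: (H k) => hk;
    first [by case/negP: s1; apply: (J _ _ _ hi hj)|by case/negP: s2; apply: (J _ _ _ hi hk)
          |by case/negP: s3; apply: (J _ _ _ hj hk)].
have con0 a : con a a by apply: connect0.
have wuv : wu != wv.
  apply/eqP=> e; rewrite -e in Hv far.
  have far2 a b : a != b -> wu != a -> wu != b -> con a b by move=> *; apply: far.
  case: (eqVneq wu i) => [ei|ui].
    by case/negP: s3; apply: far2; rewrite // ei.
  case: (eqVneq wu j) => [ej|uj].
    by case/negP: s2; apply: far2; rewrite // ej // eq_sym.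
  by case/negP: s1; apply: far2.
have [p [q u4']] : exists p q, uniq [:: wu; wv; p; q].
  have [p [q [r0 u4']]] := others4 wu; have := cover4 wv u4'.
  rewrite inE eq_sym (negPf wuv) /=; move: u4'; rewrite /= !inE !negb_or !andbT.
  case/and3P=> /and3P[up uq ur] /andP[pq pr] qr /or3P[] /eqP->.
  - by exists q, r0; rewrite !inE !negb_or up uq ur pq pr qr.
  - by exists p, r0; rewrite !inE !negb_or up uq ur [q == p]eq_sym pq pr qr.
  - by exists p, q; rewrite !inE !negb_or up uq ur ![r0 == _]eq_sym pq pr qr.
have cov' w : [\/ w = wu, w = wv, w = p | w = q].
  by have := cover4 w u4'; rewrite !inE => /or4P[]/eqP->;
    [apply: Or41|apply: Or42|apply: Or43|apply: Or44].
have pqc : con q p.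
  move: u4'; rewrite /= !inE !negb_or !andbT => /and3P[/and3P[_ up uq] /andP[vp vq] pq].
  by apply: far; rewrite // eq_sym.
have alone b : b != wu -> ~~ con wu b.
  move=> bu; apply/negP=> c; apply: (pig p wv) => w.
  case: (cov' w) => ->; [|by right|by left|by left].
  case: (cov' b) c bu => -> c; rewrite ?eqxx // => _; [by right|by left|left].
  exact: ctr' c pqc.
pose Z := cc g N (iota wu).
have wuN : iota wu \in N by have [r1 r2] := ru wu; rewrite !inE negb_or r1.
have wuZ : iota wu \in Z by rewrite mem_cc.
have ZN x : x \in Z -> x \in N by move/(subsetP (cc_sub _ _ _)).
have rootZ b : iota b \in Z -> b = wu.
  by rewrite inE => /andP[_ c]; apply/eqP/negPn/negP=> /alone/negP; apply.
have uZ : u \notin Z by apply/negP=> /ZN; rewrite !inE eqxx.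
have vZ : v \notin Z by apply/negP=> /ZN; rewrite !inE eqxx orbT.
have outZ x y : x \in Z -> y \notin Z -> g x y -> y = u \/ y = v.
  move=> xZ yZ xy; case: (boolP (y \in N)) => [yN|].
    by case/negP: yZ; apply: cc_closed xZ yN xy.
  by rewrite !inE negbK => /orP[]/eqP->; auto.
(* A set for an edge not at [wu] avoids [u] because of its label, so it enters [Z] only through [v];
   by [cset_cutoff] it stays connected without [Z]. *)
pose S' a b := if (wu == a) || (wu == b) then S a b else S a b :\: Z.
have sS' : scheme h g iota S'.
  apply: (scheme_sub sS).
  - by move=> a b; rewrite /S' orbC (sch_sym sS).
  - by move=> a b hab; rewrite /S'; case: ifP => // _; apply: subsetDl.
  - move=> a b hab; rewrite /S'; case: ifP => [_|]; first exact: (sch_end sS).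
    move=> /negbT; rewrite negb_or => /andP[ua _]; rewrite inE (sch_end sS) // andbT.
    by apply: contra ua => /rootZ->.
  move=> a b hab; rewrite /S'; case: ifP => [_|]; first exact: (sch_con sS).
  move=> /negbT; rewrite negb_or => /andP[ua ub].
  apply: (@cset_cutoff _ g _ _ v (iota a)) => //; first exact: (sch_con sS).
  - exact: (sch_end sS).
  - by apply: contra ua => /rootZ->.
  move=> x y _ yS xZ yZ xy; case: (outZ x y xZ yZ xy) => // e; subst y.
  by case: (Hu a b hab yS) => e; [move: ua|move: ub]; rewrite e eqxx.
(* Otherwise all paths from [wu] leave [Z] through [v]. Those to [p] and to [q] would force the
   label of [v] to be [wu] as well. *)
have tZ : touch g [set u] Z.
  apply: NNPP => nt; apply/negP: wuv; apply/negPn/eqP.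
  have vS b : b != wu -> v \in S wu b.
    move=> bu; have ub : wu != b by rewrite eq_sym.
    have bZ : iota b \notin Z by apply: contra bu => /rootZ->.
    have bS : iota b \in S wu b by rewrite (sch_sym sS); apply: (sch_end sS).
    have [x [y [xS xZ yS yZ xy]]] := cset_cut (sch_con sS (ub : h wu b))
      (sch_end sS (ub : h wu b)) wuZ bS bZ.
    case: (outZ x y xZ yZ xy) => e; subst y => //.
    by case: nt; exists u, x; rewrite set11 sg.
  move: u4'; rewrite /= !inE !negb_or !andbT => /and3P[/and3P[_ up uq] _ pq].
  have pS : v \in S wu p by apply: vS; rewrite eq_sym.
  have qS : v \in S wu q by apply: vS; rewrite eq_sym.
  case: (Hv wu p up pS) => // e1; case: (Hv wu q uq qS) => // e2.
  by move: pq; rewrite -e1 e2 eqxx.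
have cZu : cset g (u |: Z).
  have [x [t [/set1P-> tZ' ut]]] := tZ.
  by apply: csetU1 sg _ tZ' ut; apply: cset_cc.
have wuU : iota wu \in u |: Z by rewrite in_setU wuZ orbT.
have uU : u \in u |: Z by rewrite setU11.
have unw : u \notin [set iota wu] by rewrite inE eq_sym; case: (ru wu).
have [x [t [_ /set1P-> tU tw wt]]] := cset_cut cZu wuU (set11 _) uU unw.
rewrite inE in tw.
apply: nm; apply: (@edge_contract _ h _ g iota S' (iota wu) t wu) => //.
- by rewrite eq_sym.
- move=> b; apply/eqP=> e; case/setU1P: tU => [tu|tZ'].
    by have [] := ru b; rewrite e tu eqxx.
  by move: tw; rewrite -e (rootZ b) ?e // eqxx.
- by move=> b /ii.
move=> a b hab; case: (boolP ((wu == a) || (wu == b))) => [/orP[]/eqP->|nw]; auto.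
rewrite /S' (negPf nw) !in_setD wuZ /=; case/setU1P: tU => [-> /andP[_ uS]|tZ']; first exact: (Hu a b hab uS).
by rewrite tZ'.
Qed.
End K4Scheme.

Lemma good_K4 : good (@neq_rel V).
Proof.
apply: good_ind => T g iota S sg ii sS ok.
have [//|nm] := classic (has_minor (@neq_rel V) g iota).
have ug := minimal_unsplit sg ii sS ok nm.
(* The 4-cycle is obtained as K_{2,2}; its hubs are the roots [(false, b)], so that opposite roots
   agree in the first coordinate. *)
pose e (x : bool + bool) : V := match x with inl b => (false, b) | inr b => (true, b) end.
have ie : injective e by move=> [b|b] [b'|b'] // [->].
have he x y : @hub_rel bool false x y -> @neq_rel V (e x) (e y).
  by case: x y => [b|b] [b'|b'] //= _; rewrite /neq_rel xpair_eqE.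
have [|C0 mC0] := good_hub2 sg _ (scheme_pull ie he sS); first exact: inj_comp.
pose f (v : V) : bool + bool := let: (d, b) := v in if d then inr b else inl b.
have fe v : e (f v) = v by case: v => -[].
pose C v := C0 (f v); pose R v := [set iota v].
pose P d := S (d, false) (d, true).
have hP d : @neq_rel V (d, false) (d, true) by rewrite /neq_rel xpair_eqE eqxx.
have cP d : cset g (P d) := sch_con sS (hP d).
have rootP d e1 : iota (d, e1) \in P d.
  case: e1; last exact: (sch_end sS (hP d)).
  by rewrite /P (sch_sym sS); apply: (sch_end sS); rewrite /neq_rel xpair_eqE eqxx.
have dP x : x \in P false -> x \notin P true.
  move=> x1; apply/negP=> x2; have [w Hw] := sch_lab sS (hP false) x1.
  by case: (Hw _ _ (hP false) x1) => e1; case: (Hw _ _ (hP true) x2) => e2; rewrite e1 in e2.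
have L : linked g iota P C R.
  split.
  - by move=> v; rewrite set11.
  - by move=> v; rewrite sub1set -{1}(fe v); apply: (min_root mC0).
  - by move=> v; apply: (min_con mC0).
  - by move=> v; apply: cset1.
  - by move=> u v x xu xv; rewrite -(fe u) -(fe v) (min_dis mC0 xu xv).
  - by move=> d e1 e2; apply: (min_adj mC0); case: d.
  by move=> d e1; rewrite sub1set rootP.
have [//|[r [C' [D w]]]] := linked_K4_or_wheel sg cP dP L.
exact: (wheel_K4 ii sg ug w).
Qed.

(** * Cycles *)

Section CycleFacts.
Variable n : nat.
Hypothesis n3 : 2 < n.
Local Notation f := (@ordS n).

Lemma val_ordS_iter k (i : 'I_n) : val (iter k f i) = (i + k) %% n.
Proof.
elim: k => [|k IH]; first by rewrite addn0 modn_small.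
by rewrite iterS /= [nat_of_ord _]IH -addn1 modnDml addn1 addnS.
Qed.

Lemma ordS_reach (i j : 'I_n) : exists k, j = iter k f i.
Proof.
exists (n - i + j); apply: val_inj; rewrite val_ordS_iter addnA subnKC ?(ltnW (ltn_ord i)) //.
by rewrite modnDl modn_small.
Qed.

Lemma ordS_neq (i : 'I_n) : f i != i.
Proof.
apply/eqP=> /(congr1 val) /=; have := ltn_ord i => lt.
have [h|h] := ltnP i.+1 n; first by rewrite modn_small //; lia.
have e : i.+1 = n by lia.
by rewrite e modnn; lia.
Qed.

Lemma ordS2_neq (i : 'I_n) : f (f i) != i.
Proof.
apply/eqP=> /(congr1 val); rewrite -[f (f i)]/(iter 2 f i) val_ordS_iter; have := ltn_ord i => lt.
case: (ltnP (i + 2) n) => h; first by rewrite modn_small //=; lia.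
by rewrite -(subnK h) modnDr modn_small /=; lia.
Qed.

Lemma cycle_adjP (u v : 'I_n) : reflect (v = f u \/ u = f v) (cycle_adj u v).
Proof.
rewrite /cycle_adj /=; apply: (iffP andP) => [[_ /orP[]/eqP<-]|]; auto.
by case=> ->; rewrite eqxx ?orbT; split=> //; [rewrite eq_sym|]; apply: ordS_neq.
Qed.
End CycleFacts.

Lemma good_cycle n : 2 < n -> good (@cycle_adj n).
Proof.
move=> n3; apply: good_ind => T g iota S sg ii sS ok.
have [//|nm] := classic (has_minor (@cycle_adj n) g iota).
pose f := @ordS n.
have adjf i : cycle_adj i (f i) by apply/cycle_adjP => //; left.
have finj : injective f := @ordS_inj n.
have fn i : f i != i := ordS_neq n3 i.
have ffn i : f (f i) != i := ordS2_neq n3 i.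
have iff' i : iota i != iota (f i) by apply/eqP=> /ii e; have := fn i; rewrite -e eqxx.
have /fin_all_exists[q Hq] : forall i, exists q : seq T,
    [/\ path g (iota i) (rcons q (iota (f i))), uniq (iota i :: rcons q (iota (f i))),
        {subset iota i :: rcons q (iota (f i)) <= S i (f i)} &
        q != [::] -> ~~ g (iota i) (iota (f i))].
  move=> i; have r1 := sch_end sS (adjf i).
  have r2 : iota (f i) \in S i (f i).
    by rewrite (sch_sym sS); apply: (sch_end sS); rewrite cycle_adj_sym.
  case: (boolP (g (iota i) (iota (f i)))) => gi.
    exists [::]; split=> //=; rewrite ?gi ?inE ?iff' //.
    by move=> z; rewrite !inE => /orP[]/eqP->.
  have [p [pp lp up sp]] := cset_path (sch_con sS (adjf i)) r1 r2.
  case/lastP: p pp lp up sp => [|q z]; first by move=> _ /= e; have := iff' i; rewrite e eqxx.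
  by rewrite last_rcons => pp ez up sp; subst z; exists q.
pose L i := [set z in iota i :: rcons (q i) (iota (f i))].
have LS i : L i \subset S i (f i) by apply/subsetP=> z; rewrite inE; case: (Hq i) => _ _ s _; apply: s.
pose S' u v := if v == f u then L u else if u == f v then L v else set0.
have S'f i : S' i (f i) = L i by rewrite /S' eqxx.
have S'sym u v : S' u v = S' v u.
  rewrite /S'; case: eqP => [->|_]; case: eqP => // e.
  by have := ffn u; rewrite -e eqxx.
have S'b i : S' (f i) i = L i by rewrite S'sym S'f.
have Lr i : iota i \in L i by rewrite !inE eqxx.
have Lr' i : iota (f i) \in L i by rewrite !inE mem_rcons inE eqxx orbT.
have sS' : scheme (@cycle_adj n) g iota S'.
  apply: (scheme_sub sS) => // u v /(cycle_adjP n3)[]->.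
  - by rewrite S'f.
  - by rewrite S'b (sch_sym sS).
  - by rewrite S'f.
  - by rewrite S'b.
  - by rewrite S'f; apply: cset_seq; case: (Hq u).
  - by rewrite S'b; apply: cset_seq; case: (Hq v).
have lab i j t w : t \in L i -> t \in L j -> (forall u v, cycle_adj u v -> t \in S' u v -> w = u \/ w = v) ->
    (w = i \/ w = f i) /\ (w = j \/ w = f j).
  by move=> ti tj H; split; apply: H; rewrite ?S'f.
have labx i t : t \in L i -> exists w, forall u v, cycle_adj u v -> t \in S' u v -> w = u \/ w = v.
  by move=> ti; apply: (sch_lab sS' (adjf i)); rewrite S'f.
have nonroot i z : z \in q i -> forall v, iota v != z.
  move=> zq v; apply/eqP=> e; have [_ u _ _] := Hq i.
  have : iota v \in S' i (f i) by rewrite S'f !inE mem_rcons inE e zq !orbT.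
  move/(sch_root sS' (adjf i)) => ev; move: u; rewrite /= rcons_uniq mem_rcons inE negb_or.
  case: ev => ev; rewrite ev in e; rewrite e zq ?andbF //.
have qL i z : z \in q i -> z \in L i by move=> zq; rewrite !inE mem_rcons inE zq !orbT.
have Lq i z : z \in L i -> (forall v, iota v != z) -> z \in q i.
  by move=> zL nz; move: zL; rewrite !inE mem_rcons inE ![z == _]eq_sym !(negPf (nz _)).
pose a i := head (iota i) (q i).
have aq i : q i != [::] -> a i \in q i by rewrite /a; case: (q i) => //= x s _; rewrite inE eqxx.
have ga i : q i != [::] -> g (iota i) (a i).
  by rewrite /a; case: (Hq i) => + _ _ _; case: (q i) => //= x s /andP[].
have aL i : q i != [::] -> a i \in L (f i).
  move=> qi; apply/negPn/negP=> aL; apply: nm.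
  apply: (@edge_contract _ _ _ g iota S' (iota i) (a i) i) => //.
  - exact: ga.
  - exact: nonroot (aq i qi) i.
  - exact: nonroot (aq i qi).
  - by move=> r /ii.
  move=> u v huv /orP[|aS]; first exact: (sch_root sS' huv).
  have aLi := qL i _ (aq i qi); have [w Hw] := labx i _ aLi.
  have [|ew|ew] := Hw i (f i) (adjf i); first by rewrite S'f.
    by rewrite -ew; apply: Hw.
  rewrite -ew in aL; move/(cycle_adjP n3): (huv) => [] ev; subst v || subst u.
    case: (Hw u (f u) huv aS) => e; last by move: e; rewrite ew => /finj; auto.
    by move: aS; rewrite S'f -e (negPf aL).
  case: (Hw (f v) v huv aS) => e; first by move: e; rewrite ew => /finj; auto.
  by move: aS; rewrite S'b -e (negPf aL).
have lab2 i t : t \in L i -> t \in L (f i) -> forall w,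
    (forall u v, cycle_adj u v -> t \in S' u v -> w = u \/ w = v) -> w = f i.
  move=> t1 t2 w Hw; have [[->|//] [e|e]] := lab i (f i) t w t1 t2 Hw => //.
  by have := ffn i; rewrite -e eqxx.
case: (pickP (fun i => q i != [::])) => [i0 qi0|none]; last first.
  exists (fun v => [set iota v]); split.
  - by move=> v; apply: set11.
  - by move=> v; apply: cset1.
  - by move=> u v x /set1P-> /set1P/ii.
  have gf i : g (iota i) (iota (f i)).
    by have [+ _ _ _] := Hq i; have /negbFE/eqP-> := none i; rewrite /= andbT.
  move=> u v /(cycle_adjP n3)[]->.
    by exists (iota u), (iota (f u)); rewrite !set11.
  by exists (iota (f v)), (iota v); rewrite !set11 sg.
(* By [aL] the first inner vertex of one path is an inner vertex of the next, so nonempty interiors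
   propagate round the cycle. *)
have qn i : q i != [::].
  have step j : q j != [::] -> q (f j) != [::].
    move=> qj; have := Lq (f j) (a j) (aL j qj) (nonroot _ _ (aq j qj)).
    by case: (q (f j)).
  have [k ->] := ordS_reach i0 i.
  by elim: k => [|k IH]; rewrite ?iterS //; apply: step.
have {}aq i := aq i (qn i); have {}aL i := aL i (qn i); have {}ga i := ga i (qn i).
have anr i : forall v, iota v != a i := nonroot i _ (aq i).
pose p := @ord_pred n.
have fp i : f (p i) = i := ord_predK i.
have pf i : p (f i) = i := ordSK i.
(* The new root of [i] lies on the old paths before and after [i] and has label [i]. With this shift
   the interior of [L i] joins the new roots of [i] and [f i]. *)
pose iota' i := a (p i).
have alab i : forall w, (forall u v, cycle_adj u v -> a i \in S' u v -> w = u \/ w = v) -> w = f i.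
  by apply: lab2; [apply: qL; apply: aq|apply: aL].
have ii' : injective iota'.
  move=> i j e; rewrite -(fp i) -(fp j); have [w Hw] := labx _ _ (aL (p i)).
  by rewrite -(alab (p i) w Hw); apply: (alab (p j)); rewrite -/(iota' j) -e.
pose root x := [exists v, iota v == x].
pose g' : rel T := fun x y => [&& g x y, ~~ root x & ~~ root y].
have sg' : symmetric g' by move=> x y; rewrite /g' sg [~~ root x && _]andbC.
pose Q i := [set z in q i].
have QL i : Q i \subset L i by apply/subsetP=> z; rewrite inE; apply: qL.
have a1 i : iota' i \in Q i.
  by rewrite inE; apply: Lq; [rewrite -{2}(fp i); apply: aL|apply: anr].
have a2 i : iota' (f i) \in Q i by rewrite inE /iota' pf.
have gQ i : cset g (Q i).
  have [+ _ _ _] := Hq i; rewrite /Q; case: (q i) (qn i) => //= x s _ /andP[_].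
  by rewrite rcons_path => /andP[ps _]; apply: cset_seq.
pose S2 u v := if v == f u then Q u else if u == f v then Q v else set0.
have S2f i : S2 i (f i) = Q i by rewrite /S2 eqxx.
have S2sym u v : S2 u v = S2 v u.
  rewrite /S2; case: eqP => [->|_]; case: eqP => // e.
  by have := ffn u; rewrite -e eqxx.
have S2S u v : S2 u v \subset S' u v.
  by rewrite /S2 /S'; case: ifP => // _; case: ifP.
have sS2 : scheme (@cycle_adj n) g' iota' S2.
  split=> //.
  - move=> u v /(cycle_adjP n3)[]->; first by rewrite S2f.
    by rewrite S2sym S2f.
  - have cQ i : cset g' (Q i).
      apply: cset_mono (gQ i) => x y; rewrite !inE => xq yq xy; rewrite /g' xy /=.
      by apply/andP; split; rewrite /root; apply/existsPn=> v; apply: nonroot; eassumption.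
    move=> u v /(cycle_adjP n3)[]->; first by rewrite S2f.
    by rewrite S2sym S2f.
  - move=> u v w huv /(subsetP (S2S u v)) wS.
    have [z Hz] := labx _ _ (aL (p w)); rewrite -(fp w) -(alab (p w) z Hz).
    exact: Hz huv wS.
  move=> t u v huv /(subsetP (S2S u v)) tS; have [w Hw] := sch_lab sS' huv tS.
  by exists w => u' v' huv' /(subsetP (S2S u' v')); apply: Hw.
have lg : nz g' < nz g.
  apply: proper_card; apply/properP; split.
    by apply/subsetP=> x /existsP[y /and3P[xy _ _]]; apply/existsP; exists y.
  exists (iota i0); first by apply/existsP; exists (a i0).
  apply/negP=> /existsP[y /and3P[_ /negP r _]]; apply: r.
  by apply/existsP; exists i0.
have [C mC] := ok g' iota' S2 lg sg' ii' sS2.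
have noroot v w : iota w \notin C v.
  apply/negP=> wC; have e : iota w = iota' v.
    apply: (minor_isolated mC) wC => y; apply/negP=> /and3P[_ _ /negP r]; apply: r.
    by apply/existsP; exists w.
  by have := anr (p v) w; rewrite e eqxx.
have sub : subrel g' g by move=> x y /and3P[].
(* The old root of [v] is adjacent to [a v], the new root of [f v], hence the rotation by one. *)
exists (fun v => iota v |: C (f v)); split.
- by move=> v; apply: setU11.
- move=> v; apply: (csetU1 sg (y := iota' (f v))).
  + by apply: cset_mono (min_con mC (f v)) => x y _ _; apply: sub.
  + exact: (min_root mC).
  + by rewrite /iota' pf.
- move=> u v x /setU1P[->|xu] /setU1P[|xv].
  + by move/ii.
  + by rewrite (negPf (noroot _ _)) in xv.
  + by move=> e; rewrite e (negPf (noroot _ _)) in xu.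
  + by apply: finj; apply: (min_dis mC xu xv).
move=> u v huv; have hf : cycle_adj (f u) (f v).
  by apply/cycle_adjP => //; case/(cycle_adjP n3): huv => ->; auto.
have [x [y [xC yC xy]]] := min_adj mC hf.
by exists x, y; rewrite !inE xC yC !orbT; split=> //; apply: sub.
Qed.

(** * Pruning and disjoint unions *)

Section SetRho.
Variables (T : finType) (g : rel T) (B : {set T}) (i : T).
Hypotheses (iB : i \in B) (cB : cset g B).

Definition srho x := if x \in B then i else x.

Lemma srho_idem x : srho (srho x) = srho x.
Proof. by rewrite /srho; case: (boolP (x \in B)) => [_|/negPf->]; rewrite ?iB. Qed.

Lemma srho_eq x y : srho x = srho y -> x = y \/ x \in B /\ y \in B.
Proof.
rewrite /srho; case: (boolP (x \in B)) => xB; case: (boolP (y \in B)) => yB e; auto.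
- by case/negP: yB; rewrite -e.
- by case/negP: xB; rewrite e.
Qed.

Lemma srho_fib x : cset g [set y | srho y == srho x].
Proof.
case: (boolP (x \in B)) => xB.
  have -> : [set y | srho y == srho x] = B; last exact: cB.
  apply/setP=> y; rewrite inE; apply/eqP/idP => [/srho_eq[->//|[]//]|yB].
  by rewrite /srho xB yB.
have -> : [set y | srho y == srho x] = [set x]; last exact: cset1.
apply/setP=> y; rewrite !inE; apply/eqP/eqP => [/srho_eq[//|[_]]|->//].
by rewrite (negPf xB).
Qed.
End SetRho.

Section Prune.
Variables (TH : finType) (h : rel TH) (u : TH) (D : {set TH}).
Definition prune : rel TH := fun x y => [&& h x y, x \notin D & y \notin D].
Hypotheses (sh : symmetric h) (uD : u \notin D) (Du : forall d x, d \in D -> h d x -> x = u \/ x \in D).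

(** [L] is deleted and supplies the branch sets of [D], while [B] is contracted into the root of
    [u]. The conditions on [prune] ensure that what is left is a scheme for the remaining edges. *)
Record pruning (T : finType) (g : rel T) (iota : TH -> T) (S : TH -> TH -> {set T})
    (L B : {set T}) (C : TH -> {set T}) : Prop := {
  pr_B : cset g B;
  pr_u : iota u \in B;
  pr_root : forall x, iota x \in B -> x = u;
  pr_BL : forall t, t \in B -> t \notin L;
  pr_SL : forall a b t, prune a b -> t \in S a b -> t \notin L;
  pr_SB : forall a b t, prune a b -> t \in S a b -> t \in B -> u = a \/ u = b;
  pr_L : forall x, x \notin D -> iota x \notin L;
  pr_C : forall d, d \in D -> [/\ iota d \in C d, C d \subset L & cset g (C d)];
  pr_dis : forall d d' t, d \in D -> d' \in D -> t \in C d -> t \in C d' -> d = d';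
  pr_adj : forall d x, d \in D -> h d x -> touch g (C d) (if x == u then B else C x) }.

Lemma good_prune : good prune ->
  (forall (T : finType) (g : rel T) iota S, symmetric g -> injective iota -> scheme h g iota S ->
     exists L B C, pruning g iota S L B C) -> good h.
Proof.
move=> gp H T g iota S sg ii sS; have [L [B [Cd pr]]] := H T g iota S sg ii sS.
pose g1 : rel T := fun x y => [&& g x y, x \notin L & y \notin L].
have sg1 : symmetric g1 by move=> x y; rewrite /g1 sg [(x \notin L) && _]andbC.
have sub1 : subrel g1 g by move=> x y /and3P[].
have cB1 : cset g1 B.
  by apply: cset_mono (pr_B pr) => x y xB yB xy; rewrite /g1 xy !(pr_BL pr).
have uB := pr_u pr.
pose rho := srho B (iota u).
have ri v : rho (iota v) = iota v.
  by rewrite /rho /srho; case: ifP => // /(pr_root pr)->.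
have sub : subrel prune h by move=> x y /and3P[].
have sS1 : scheme prune g1 iota S.
  split; first exact: (sch_sym sS).
  - by move=> a b /sub; apply: (sch_end sS).
  - move=> a b hab; apply: cset_mono (sch_con sS (sub _ _ hab)) => x y xS yS xy.
    by rewrite /g1 xy !(pr_SL pr hab).
  - by move=> a b w /sub; apply: (sch_root sS).
  move=> t a b /sub hab tS; have [w Hw] := sch_lab sS hab tS.
  by exists w => a' b' /sub; apply: Hw.
have [|C' mC'] := gp T (ctr g1 rho) iota (fun a b => rho @: S a b) (ctr_sym rho sg1) ii.
  apply: scheme_ctr => // [x a b hab xS|x a b w hab xS].
    case: (boolP (x \in B)) => xB.
      exists u => a' b' y hab' yS /(srho_eq uB)[e|[yB _]]; last exact: (pr_SB pr hab' yS).
      by rewrite e in yS; apply: (pr_SB pr hab' yS).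
    have [w Hw] := sch_lab sS1 hab xS; exists w => a' b' y hab' yS /(srho_eq uB)[e|[_]].
      by apply: Hw; rewrite // -e.
    by rewrite (negPf xB).
  rewrite -ri => /(srho_eq uB)[e|[xB /(pr_root pr)->]]; last exact: (pr_SB pr hab xS).
  by apply: (sch_root sS1 hab); rewrite -e.
have mC : is_minor prune g1 iota (fun v => rho @^-1: C' v).
  by apply: (minor_ctr sg1) mC' => //; [exact: srho_idem|exact: srho_fib].
pose C v := rho @^-1: C' v; rewrite -/C in mC.
have BC t : t \in B -> t \in C u.
  by move=> tB; rewrite inE /rho /srho tB (min_root mC').
have CL v t : v \notin D -> t \in C v -> t \notin L.
  move=> vD tC; apply/negP=> tL; have e : t = iota v.
    by apply: (minor_isolated mC) tC => y; rewrite /g1 tL andbF andbF.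
  by move: tL; rewrite e (negPf (pr_L pr vD)).
pose E v := if v \in D then Cd v else C v.
have En v : v \notin D -> E v = C v by rewrite /E => /negPf->.
have Ed v : v \in D -> E v = Cd v by rewrite /E => ->.
have CdL d t : d \in D -> t \in Cd d -> t \in L.
  by move=> dD; have [_ /subsetP s _] := pr_C pr dD; apply: s.
exists E; split.
- move=> v; case: (boolP (v \in D)) => vD; last by rewrite En // (min_root mC).
  by rewrite Ed //; have [] := pr_C pr vD.
- move=> v; case: (boolP (v \in D)) => vD; first by rewrite Ed //; have [] := pr_C pr vD.
  by rewrite En //; apply: cset_mono (min_con mC v) => x y _ _; apply: sub1.
- move=> a b t; case: (boolP (a \in D)) => aD; case: (boolP (b \in D)) => bD;
    rewrite ?(Ed _ aD) ?(Ed _ bD) ?(En _ aD) ?(En _ bD).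
  + exact: (pr_dis pr).
  + by move=> /(CdL a t aD) tL /(CL b t bD); rewrite tL.
  + by move=> /(CL a t aD)/negPf tL /(CdL b t bD); rewrite tL.
  + exact: (min_dis mC).
have adjD d x : d \in D -> h d x -> touch g (E d) (E x).
  move=> dD dx; have := pr_adj pr dD dx; rewrite Ed //.
  case: eqP => [->|/eqP xu]; last by case: (Du dD dx) => [e|xD]; [rewrite e eqxx in xu|rewrite Ed].
  by apply: touch_sub; rewrite // En //; apply/subsetP=> t; apply: BC.
move=> a b hab; case: (boolP (a \in D)) => aD; first exact: adjD.
case: (boolP (b \in D)) => bD; first by apply: touch_sym => //; apply: adjD; rewrite // sh.
have hp : prune a b by rewrite /prune hab aD bD.
by have [x [y [xC yC xy]]] := min_adj mC hp; exists x, y; rewrite !En //; split=> //; apply: sub1.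
Qed.
End Prune.

Lemma good_leaf (TH : finType) (h : rel TH) u v : symmetric h -> u != v -> h u v ->
  (forall x, h v x -> x = u) -> good (prune h [set v]) -> good h.
Proof.
move=> sh uv huv vu gp; apply: (good_prune (u := u) (D := [set v])) => //.
- by rewrite inE.
- by move=> d x /set1P-> /vu; left.
move=> T g iota S sg ii sS.
have iuv : iota u != iota v by apply: contra uv => /eqP/ii->.
have uS := sch_end sS huv.
have vS : iota v \in S u v by rewrite (sch_sym sS); apply: (sch_end sS); rewrite sh.
have [z zB zv] := cc_touch sg (sch_con sS huv) uS vS iuv.
set B := cc g (S u v :\ iota v) (iota u) in zB.
have BS t : t \in B -> t != iota v /\ t \in S u v.
  by move/(subsetP (cc_sub _ _ _)); rewrite !inE => /andP[].
exists [set iota v], B, (fun=> [set iota v]); split.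
- by apply: cset_cc => //; rewrite !inE iuv.
- by rewrite mem_cc // !inE iuv.
- by move=> x /BS[xv /(sch_root sS huv)[//|e]]; rewrite e eqxx in xv.
- by move=> t /BS[]; rewrite inE.
- move=> a b t /and3P[hab aD bD] tS; rewrite inE; apply/eqP=> e; rewrite e in tS.
  by case: (sch_root sS hab tS) => e'; [move: aD|move: bD]; rewrite e' set11.
- move=> a b t /and3P[hab aD bD] tS /BS[_ tS']; have [w Hw] := sch_lab sS hab tS.
  case: (Hw u v huv tS') => e; subst w; first exact: Hw.
  by case: (Hw a b hab tS) => e; [move: aD|move: bD]; rewrite e set11.
- by move=> x; rewrite !inE; apply: contra => /eqP/ii->.
- by move=> d /set1P->; split; [exact: set11|exact: subxx|exact: cset1].
- by move=> d d' t /set1P-> /set1P->.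
move=> d x /set1P-> /vu->; rewrite eqxx; apply: touch_sym => //.
by exists z, (iota v); rewrite set11.
Qed.

(** Cuts a path between two marked vertices, whichever comes first; it divides the path opposite to
    [u] in a pendant triangle. *)
Lemma path_separate (T : eqType) (x : T) (p : seq T) a b : a \in x :: p -> b \in x :: p -> a != b ->
  exists p1 y p2, p = p1 ++ y :: p2 /\
    ((a \in x :: p1 /\ b \in y :: p2) \/ (b \in x :: p1 /\ a \in y :: p2)).
Proof.
rewrite !inE => ap bp ab; case: (boolP (b \in p)) bp => [bq _|bp].
  move: ap; case/splitPr: bq => p1 p2 ap.
  case: (boolP (a \in x :: p1)) => a1.
    by exists p1, b, p2; split=> //; left; rewrite a1 mem_head.
  have : a \in p2.
    by move: ap a1; rewrite mem_cat !inE (negPf ab) /=; case: (a == x); case: (a \in p1).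
  case/splitPr=> r1 r2; exists (p1 ++ b :: r1), a, r2; rewrite -catA; split=> //; right.
  by rewrite mem_head inE mem_cat mem_head !orbT.
rewrite orbF => /eqP bx; subst b; move: ap; rewrite (negPf ab) /=.
case/splitPr=> p1 p2; exists p1, a, p2; split=> //; right.
by rewrite !mem_head.
Qed.

(** [L] is the path for [v w], and [B] consists of the parts around [iota u] of the other two sets
    outside [L]. These reach [L] at different vertices, because the three edges have no common
    label. Cutting [L] between the two contacts gives sets for [v] and [w]; since both touch [B],
    the order of the contacts does not matter. *)
Lemma good_triangle_leaf (TH : finType) (h : rel TH) u v w : symmetric h ->
  u != v -> u != w -> v != w -> h u v -> h u w -> h v w ->
  (forall x, h v x -> x = u \/ x = w) -> (forall x, h w x -> x = u \/ x = v) ->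
  good (prune h [set v; w]) -> good h.
Proof.
move=> sh uv uw vw huv huw hvw Nv Nw gp; apply: (good_prune (u := u) (D := [set v; w])) => //.
- by rewrite !inE negb_or uv.
- by move=> d x /set2P[]-> => [/Nv|/Nw][]->; auto; right; rewrite !inE eqxx ?orbT.
move=> T g iota S sg ii sS.
have ne a b : a != b -> iota a != iota b by apply: contra => /eqP/ii->.
have end2 a b : h a b -> iota b \in S a b.
  by move=> hab; rewrite (sch_sym sS); apply: (sch_end sS); rewrite sh.
have [p [pp lp up sp]] := cset_path (sch_con sS hvw) (sch_end sS hvw) (end2 _ _ hvw).
pose L := [set z in iota v :: p].
have LS z : z \in L -> z \in S v w by rewrite inE => /sp.
have vL : iota v \in L by rewrite !inE eqxx.
have wL : iota w \in L by rewrite inE -lp mem_last.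
have tri t : t \in S u v -> t \in S u w -> t \in S v w -> False.
  move=> t1 t2 t3; have [r Hr] := sch_lab sS huv t1.
  case: (Hr u v huv t1) => e1; case: (Hr u w huw t2) => e2; case: (Hr v w hvw t3) => e3;
  by move: uv uw vw; rewrite -?e1 -?e2 -?e3 ?eqxx.
have uL : iota u \notin L.
  by apply/negP=> /LS/(sch_root sS hvw)[] e; [move: uv|move: uw]; rewrite e eqxx.
have reach a : h u a -> iota a \in L -> exists s t, [/\ s \in cc g (S u a :\: L) (iota u),
    t \in L, t \in S u a & g s t].
  move=> hua aL; have uC : iota u \in cc g (S u a :\: L) (iota u).
    by rewrite mem_cc // inE uL (sch_end sS).
  have aC : iota a \notin cc g (S u a :\: L) (iota u).
    by apply/negP=> /(subsetP (cc_sub _ _ _)); rewrite inE aL.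
  have [s [t [sS' sC tS tC st]]] := cset_cut (sch_con sS hua) (sch_end sS hua) uC (end2 _ _ hua) aC.
  exists s, t; split=> //; apply: contraNT tC => tL.
  by apply: cc_closed sC _ st; rewrite inE tL.
have [s1 [t1 [s1C t1L t1S st1]]] := reach v huv vL.
have [s2 [t2 [s2C t2L t2S st2]]] := reach w huw wL.
have t12 : t1 != t2.
  by apply/eqP=> e; rewrite -e in t2S; apply: (tri t1) => //; apply: LS.
have t1p : t1 \in iota v :: p by rewrite inE in t1L.
have t2p : t2 \in iota v :: p by rewrite inE in t2L.
have [p1 [y [p2 [ep sep]]]] := path_separate t1p t2p t12.
pose X a := cc g (S u a :\: L) (iota u).
pose B := X v :|: X w.
have XS a t : t \in X a -> t \notin L /\ t \in S u a.
  by move/(subsetP (cc_sub _ _ _)); rewrite inE => /andP[].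
have uX a : h u a -> iota u \in X a by move=> hua; rewrite mem_cc // inE uL (sch_end sS).
have cX a : h u a -> cset g (X a).
  by move=> hua; apply: cset_cc => //; rewrite inE uL (sch_end sS).
pose Cv := [set z in iota v :: p1]; pose Cw := [set z in y :: p2].
have eL : iota v :: p = (iota v :: p1) ++ (y :: p2) by rewrite ep.
have CL : Cv \subset L /\ Cw \subset L.
  by split; apply/subsetP=> z; rewrite !in_set eL mem_cat => ->; rewrite ?orbT.
have [CvL CwL] := CL.
have CC z : z \in Cv -> z \in Cw -> False.
  move: up; rewrite eL cat_uniq => /and3P[_ /hasPn H _]; rewrite !in_set => z1 z2.
  by have := H z z2; rewrite /= z1.
have pth := pp; rewrite ep cat_path /= in pth; have /and3P[pp1 ly pp2] := pth.
have tCvw : touch g Cv Cw.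
  by exists (last (iota v) p1), y; rewrite !in_set mem_last mem_head.
have lw : iota w \in Cw by rewrite in_set -lp ep last_cat /= mem_last.
have tB : touch g B Cv /\ touch g B Cw.
  have h1 (A : {set T}) : t1 \in A -> touch g B A.
    by move=> tA; exists s1, t1; rewrite in_setU s1C.
  have h2 (A : {set T}) : t2 \in A -> touch g B A.
    by move=> tA; exists s2, t2; rewrite in_setU s2C orbT.
  case: sep => -[a1 a2]; [split; [apply: h1|apply: h2]|split; [apply: h2|apply: h1]];
  by rewrite in_set.
have [tBv tBw] := tB.
have nD a : a \notin [set v; w] -> a != v /\ a != w by rewrite !inE negb_or => /andP[].
exists L, B, (fun d => if d == v then Cv else Cw); split.
- by apply: csetU; [|exact: cX|exact: cX|left; exists (iota u); rewrite uX].
- by rewrite in_setU uX.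
- move=> x /setUP[]/XS[xL].
    by case/(sch_root sS huv) => // e; rewrite e vL in xL.
  by case/(sch_root sS huw) => // e; rewrite e wL in xL.
- by move=> t /setUP[]/XS[].
- move=> a b t /and3P[hab /nD[av aw] /nD[bv bw]] tS; apply/negP=> /LS tvw.
  have [r Hr] := sch_lab sS hab tS.
  by case: (Hr a b hab tS) => e1; case: (Hr v w hvw tvw) => e2;
    move: av aw bv bw; rewrite -?e1 -?e2 ?eqxx.
- move=> a b t /and3P[hab /nD[av aw] /nD[bv bw]] tS; have [r Hr] := sch_lab sS hab tS.
  case/setUP=> /XS[_ t'].
    case: (Hr u v huv t') => e; subst r; first exact: Hr.
    by case: (Hr a b hab tS) => e; [move: av|move: bv]; rewrite e eqxx.
  case: (Hr u w huw t') => e; subst r; first exact: Hr.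
  by case: (Hr a b hab tS) => e; [move: aw|move: bw]; rewrite e eqxx.
- move=> x /nD[xv xw]; apply/negP=> /LS/(sch_root sS hvw)[] e; first by rewrite e eqxx in xv.
  by rewrite e eqxx in xw.
- move=> d /set2P[]->; rewrite ?eqxx; first by split=> //; [rewrite in_set mem_head|exact: cset_seq].
  by rewrite eq_sym (negPf vw); split=> //; exact: cset_seq.
- move=> d d' t /set2P[]-> /set2P[]->; rewrite ?eqxx ?[w == v]eq_sym ?(negPf vw) // => z1 z2;
  by case: (CC t).
move=> d x /set2P[]-> => [/Nv|/Nw][]->; rewrite ?eqxx ?[w == u]eq_sym ?[v == u]eq_sym
  ?[w == v]eq_sym ?(negPf uw) ?(negPf uv) ?(negPf vw); by [|apply: touch_sym].
Qed.

Lemma good_union (TH : finType) (h1 h2 : rel TH) : symmetric h1 -> symmetric h2 ->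
  (forall x y z, h1 x y -> h2 x z -> False) -> good h1 -> good h2 ->
  good (fun x y => h1 x y || h2 x y).
Proof.
move=> sh1 sh2 dis gd1 gd2 T g iota S sg ii sS; set h := (fun x y => _) in sS *.
(* Each relation is solved inside the vertices of its own sets; the branch sets stay there, apart
   from roots that are incident with none of its edges. *)
have key (k : rel TH) : (forall x y, k x y -> h x y) -> good k -> exists C (U : {set T}),
    [/\ is_minor k g iota C, forall t, t \in U <-> (exists x y, k x y /\ t \in S x y) &
     forall v t, t \in C v -> t \in U \/ t = iota v].
  move=> sub gk; pose U := [set t | [exists x, [exists y, k x y && (t \in S x y)]]].
  have UP t : t \in U <-> (exists x y, k x y /\ t \in S x y).
    rewrite inE; split=> [/existsP[x /existsP[y /andP[? ?]]]|[x [y [? ?]]]]; first by exists x, y.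
    by apply/existsP; exists x; apply/existsP; exists y; apply/andP.
  pose g' : rel T := fun x y => [&& g x y, x \in U & y \in U].
  have sg' : symmetric g' by move=> x y; rewrite /g' sg [(x \in U) && _]andbC.
  have [|C mC] := gk T g' iota S sg' ii.
    split; first exact: (sch_sym sS).
    - by move=> a b /sub; apply: (sch_end sS).
    - move=> a b kab; apply: cset_mono (sch_con sS (sub _ _ kab)) => x y xS yS xy.
      by rewrite /g' xy /=; apply/andP; split; apply/UP; exists a, b.
    - by move=> a b w /sub; apply: (sch_root sS).
    move=> t a b /sub hab tS; have [w Hw] := sch_lab sS hab tS.
    by exists w => a' b' /sub; apply: Hw.
  exists C, U; split=> //; first by apply: minor_edges mC => x y /and3P[].
  move=> v t tC; case: (boolP (t \in U)) => tU; [by left|right].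
  by apply: (minor_isolated mC) tC => y; rewrite /g' (negPf tU) !andbF.
have [C1 [U1 [m1 U1P CU1]]] := key h1 (fun x y k => introT orP (or_introl k)) gd1.
have [C2 [U2 [m2 U2P CU2]]] := key h2 (fun x y k => introT orP (or_intror k)) gd2.
(* A label of a common vertex would be incident with an edge of [h1] and an edge of [h2]. *)
have dU t : t \in U1 -> t \in U2 -> False.
  move=> /U1P[a [b [k1 t1]]] /U2P[c [d [k2 t2]]].
  have k1' : h a b by rewrite /h k1.
  have k2' : h c d by rewrite /h k2 orbT.
  have [w Hw] := sch_lab sS k1' t1.
  have e1 : exists z, h1 w z.
    by case: (Hw a b k1' t1) => ->; [exists b|exists a; rewrite sh1].
  have e2 : exists z, h2 w z.
    by case: (Hw c d k2' t2) => ->; [exists d|exists c; rewrite sh2].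
  by case: e1 e2 => z1 z1' [z2 z2']; apply: (dis w z1 z2).
pose s1 v := [exists y, h1 v y].
have s1P v : s1 v -> iota v \in U1.
  move=> /existsP[y hy]; apply/U1P; exists v, y; split=> //.
  by apply: (sch_end sS); rewrite /h hy.
have ns1 v : ~~ s1 v -> iota v \notin U1.
  move=> /existsPn nv; apply/negP=> /U1P[x [y [k1 vS]]].
  have k1' : h x y by rewrite /h k1.
  case: (sch_root sS k1' vS) => e; subst v; first by have := nv y; rewrite k1.
  by have := nv x; rewrite sh1 k1.
have C1U v t : s1 v -> t \in C1 v -> t \in U1.
  by move=> sv /CU1[//|->]; apply: s1P.
have C2U v t : ~~ s1 v -> t \in C2 v -> t \notin U1.
  by move=> sv /CU2[tU|->]; [apply/negP=> t1; apply: (dU t)|apply: ns1].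
exists (fun v => if s1 v then C1 v else C2 v); split.
- by move=> v; case: ifP => _; [exact: (min_root m1)|exact: (min_root m2)].
- by move=> v; case: ifP => _; [exact: (min_con m1)|exact: (min_con m2)].
- move=> u v t; case: ifP => su; case: ifP => sv.
  + exact: (min_dis m1).
  + by move=> /(C1U u t su) tU /(C2U v t (negbT sv)); rewrite tU.
  + by move=> /(C2U u t (negbT su))/negPf tU /(C1U v t sv); rewrite tU.
  + exact: (min_dis m2).
move=> u v /orP[huv|huv].
  have -> : s1 u by apply/existsP; exists v.
  have -> : s1 v by apply/existsP; exists u; rewrite sh1.
  exact: (min_adj m1).
case: ifP => [/existsP[y hy]|_]; first by case: (dis u y v).
case: ifP => [/existsP[y hy]|_]; first by case: (dis v y u); rewrite // sh2.
exact: (min_adj m2).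
Qed.

(** * Graphs built from cores *)

Section Cacti.
Variables (TH : finType) (adj : rel TH).
Hypotheses (sa : symmetric adj) (ia : irreflexive adj).

(** The vertex sets of nonseparable induced subgraphs, and also the empty set; single vertices and
    pairs of adjacent vertices are included. *)
Definition two_conn (X : {set TH}) : Prop := cset adj X /\ forall v, v \in X -> cset adj (X :\ v).

Lemma two_conn_edge a b : adj a b -> two_conn [set a; b].
Proof.
move=> ab; split; first exact: cset2.
move=> v _; have s1 c d : cset adj ([set c] :\ d).
  by move=> x y; rewrite !inE => /andP[_ /eqP->] /andP[_ /eqP->]; apply: connect0.
case: (eqVneq v a) => [->|va].
  have -> : [set a; b] :\ a = [set b] :\ a.
    by apply/setP=> x; rewrite !inE; case: (x == a).
  exact: s1.
case: (eqVneq v b) => [->|vb].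
  have -> : [set a; b] :\ b = [set a] :\ b.
    by apply/setP=> x; rewrite !inE; case: (x == b); rewrite ?orbF.
  exact: s1.
have -> : [set a; b] :\ v = [set a; b].
  apply/setP=> x; rewrite !inE; case: eqP => // ->.
  by rewrite (negPf va) (negPf vb).
exact: cset2.
Qed.

Lemma cset_tail x (p : seq TH) : path adj x p -> cset adj [set z in p].
Proof.
case: p => [|y p] /=; first by move=> _ u v; rewrite inE.
by case/andP=> _; apply: cset_seq.
Qed.

(** If the removed vertex is on the ear, the two pieces of the ear hang on [a] and on [b]; if it is
    in [X], the ear hangs on an end that is still there. *)
Lemma two_conn_ear (X : {set TH}) a b (p : seq TH) : two_conn X -> a \in X -> b \in X -> a != b ->
  path adj a (rcons p b) -> uniq p -> {in p, forall z, z \notin X} ->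
  two_conn (X :|: [set z in p]).
Proof.
move=> [cX cXv] aX bX ab pth up pX; set Y := X :|: _.
have join (A B : {set TH}) z : cset adj A -> cset adj B -> z \in A -> z \in B -> cset adj (A :|: B).
  by move=> cA cB zA zB; apply: csetU => //; left; exists z.
have pa : path adj a p by move: pth; rewrite rcons_path => /andP[].
have cap := cset_seq sa pa; have cpb := cset_tail pth.
have bE : b \in [set z in rcons p b] by rewrite inE mem_rcons mem_head.
have aE : a \in [set z in a :: p] by rewrite inE mem_head.
split.
  have -> : Y = X :|: [set z in a :: p].
    by apply/setP=> z; rewrite !inE; case: eqP => [->|]; rewrite ?aX.
  exact: join aX aE.
move=> v vY; case: (boolP (v \in X)) => vX.
  have vp : v \notin p by apply: contraTN vX => /pX.
  have vpz z : z \in p -> z != v by apply: contraTneq => ->.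
  case: (eqVneq v a) => [va|va].
    have -> : Y :\ v = (X :\ v) :|: [set z in rcons p b].
      apply/setP=> z; rewrite !inE mem_rcons inE; case: (eqVneq z b) => [->|_] /=.
        by rewrite bX va eq_sym ab.
      by case: (boolP (z \in p)) => [/vpz->|_]; rewrite ?orbT // !orbF.
    by apply: join bE; [apply: cXv|exact: cpb|rewrite !inE bX va eq_sym ab].
  have -> : Y :\ v = (X :\ v) :|: [set z in a :: p].
    apply/setP=> z; rewrite !inE; case: (eqVneq z a) => [->|_] /=.
      by rewrite aX eq_sym va.
    by case: (boolP (z \in p)) => [/vpz->|_]; rewrite ?orbT // !orbF.
  by apply: join aE; [apply: cXv|exact: cap|rewrite !inE aX eq_sym va].
have vp : v \in p by move: vY; rewrite !inE (negPf vX).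
case/splitPr: vp up pth pX @Y vY pa cap cpb bE aE => p1 p2 up pth pX Y vY _ _ _ _ _.
move: pth; rewrite rcons_cat cat_path /= => /and3P[pp1 _ pp2].
have c1 := cset_seq sa pp1; have c2 := cset_tail pp2.
move: up; rewrite cat_uniq /= negb_or => /and4P[_ /andP[v1 _] v2 _].
have -> : Y :\ v = X :|: [set z in a :: p1] :|: [set z in rcons p2 b].
  apply/setP=> z; rewrite !inE mem_rcons mem_cat !inE.
  case: (eqVneq z v) => [->|_] /=.
    rewrite (negPf vX) (negPf v1) (negPf v2) /= !orbF; apply/esym/negP => /orP[]/eqP e.
      by move: vX; rewrite e aX.
    by move: vX; rewrite e bX.
  case: (eqVneq z a) => [->|_]; first by rewrite aX.
  case: (eqVneq z b) => [->|_]; first by rewrite bX.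
  by rewrite /= orbA.
apply: (join _ _ b); [|exact: c2|by rewrite in_setU bX|by rewrite inE mem_rcons mem_head].
by apply: (join _ _ a) => //; rewrite inE mem_head.
Qed.

(** Cores stand for the vertex sets of the blocks that are not ordinary: they are maximal
    two-connected sets, there is at most one in each component, and they cover all two-connected
    sets with more than three vertices. *)
Variable Core : {set TH} -> Prop.
Hypotheses (C1 : forall X, Core X -> good (ind adj X))
  (C2 : forall X, Core X -> two_conn X /\ forall Y, two_conn Y -> X \subset Y -> Y = X)
  (C3 : forall X Y x y, Core X -> Core Y -> x \in X -> y \in Y -> connect adj x y -> X = Y)
  (C4 : forall X, two_conn X -> 3 < #|X| -> exists2 Y, Core Y & X \subset Y).

(** * The far end of a longest path *)

Section LongestPath.
(** [R] is where the paths start: a core, or a single vertex if no core is in reach. [R1] excludes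
    ears on [R], and [R2] excludes core vertices outside [R] in its component. *)
Variables (h : rel TH) (R : {set TH}).
Hypotheses (sh : symmetric h) (ha : subrel h adj)
  (R1 : forall a b p, a \in R -> b \in R -> a != b -> p <> [::] -> path adj a (rcons p b) ->
     uniq p -> {in p, forall z, z \notin R} -> False)
  (R2 : forall Y y x, Core Y -> y \in Y -> y \notin R -> x \in R -> connect h x y -> False).

Definition out_path x p : Prop :=
  [/\ x \in R, path h x p, uniq (x :: p) & {in p, forall z, z \notin R}].

Lemma out_path_max x p : out_path x p -> exists x' p', [/\ out_path x' p', size p <= size p' &
  forall y q, out_path y q -> size q <= size p'].
Proof.
have [n] := ubnP (#|TH| - size p); elim: n x p => // n IH x p np op.
have [[y [q [oq lt]]]|no] := classic (exists y q, out_path y q /\ size p < size q); last first.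
  exists x, p; split=> // y q oq; rewrite leqNgt; apply/negP=> lt; apply: no; by exists y, q.
have lq : size q < #|TH| by case: oq => _ _ /card_uniqP /= <- _; apply: max_card.
have [|x' [p' [op' l m]]] := IH y q _ oq; first by lia.
by exists x', p'; split=> //; apply: leq_trans (ltnW lt) l.
Qed.

(** A neighbour off the path would extend it or, if it is in [R], complete an ear on [R]. One
    further back would close a cycle with at least four vertices, contained in a core through [z],
    which [R2] forbids. *)
Lemma last_nbr x p z w : out_path x (rcons p z) ->
  (forall y q, out_path y q -> size q <= size (rcons p z)) -> h z w ->
  exists s1 s2, x :: p = s1 ++ w :: s2 /\ size s2 <= 1.
Proof.
move=> [xR pth u nR] mx zw.
have wz : w != z by apply: contraTneq zw => ->; apply/negP=> /ha; rewrite ia.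
have zR : z \notin R by apply: nR; rewrite mem_rcons mem_head.
have zp : z \notin x :: p by move: u; rewrite -rcons_cons rcons_uniq => /andP[].
have xz : connect h x z by apply/connectP; exists (rcons p z); rewrite ?last_rcons.
have pw : path h x (rcons (rcons p z) w) by rewrite rcons_path pth last_rcons.
have up : uniq (rcons p z) by move: u => /andP[].
case: (boolP (w \in x :: p)) => [wp|wp]; last first.
  exfalso; move: (wp); rewrite inE negb_or => /andP[wx wp'].
  have wn : w \notin x :: rcons p z by rewrite inE mem_rcons inE !negb_or wx wz.
  case: (boolP (w \in R)) => wR.
    apply: (R1 (a := x) (b := w) (p := rcons p z)) => //; first by rewrite eq_sym.
      by case: (p).
    exact: sub_path pw.
  have : out_path x (rcons (rcons p z) w).
    split=> //; first by rewrite -rcons_cons rcons_uniq wn u.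
    by move=> t; rewrite mem_rcons inE => /predU1P[->|/nR].
  by move/mx; rewrite !size_rcons ltnn.
have [s1 [s2 e]] : exists s1 s2, x :: p = s1 ++ w :: s2.
  by case/splitPr: wp => s1 s2; exists s1, s2.
exists s1, s2; split=> //; rewrite leqNgt; apply/negP=> s2n.
have pws : path h w (rcons s2 z).
  case: s1 e => [[<- <-] //|y s1 [_ ep]]; move: pth.
  by rewrite ep rcons_cat cat_path /= => /and3P[].
have uws : uniq (w :: rcons s2 z).
  move: u; rewrite -rcons_cons e rcons_cat cat_uniq => /and3P[_ _].
  by rewrite -rcons_cons.
case: s2 s2n e pws uws => [|c s3] //= s3n e /andP[wc pc] /and3P[].
rewrite inE negb_or => /andP[nwc wn] cn us.
have awc := ha wc.
have ts : two_conn ([set w; c] :|: [set t in rcons s3 z]).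
  apply: (two_conn_ear (a := c) (b := w)) => //.
  - exact: two_conn_edge.
  - exact: set22.
  - exact: set21.
  - by rewrite eq_sym.
  - by rewrite rcons_path last_rcons (ha zw) andbT; apply: sub_path pc.
  - move=> t tn; rewrite !inE negb_or; apply/andP; split; first by apply: contraNneq wn => <-.
    by apply: contraNneq cn => <-.
have /C4[//|Y cY sY] := ts.
  have u4 : uniq [:: w, c & rcons s3 z] by rewrite /= inE negb_or nwc wn cn us.
  apply: leq_trans (_ : size [:: w, c & rcons s3 z] <= _).
    by rewrite /= size_rcons.
  rewrite -(card_uniqP u4); apply: subset_leq_card; apply/subsetP=> t.
  by rewrite !inE orbA.
apply: (R2 (Y := Y) (y := z) (x := x)) => //.
by apply: (subsetP sY); rewrite in_setU !inE mem_rcons mem_head orbT.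
Qed.

Lemma last_two (x : TH) q y t s1 s2 : x :: rcons q y = s1 ++ t :: s2 -> size s2 <= 1 ->
  t = y \/ t = last x q.
Proof.
rewrite -rcons_cons lastI; case: s2 => [|c [|//]] e _.
  by left; move: e; rewrite cats1 => /rcons_inj[_ ->].
by right; move: e; rewrite -cat_rcons cats1 => /rcons_inj[/rcons_inj[_ ->]].
Qed.

(* The end of a longest path leaving R is a leaf or lies in a pendant triangle. *)
Lemma prune_end x p : out_path x p -> p <> [::] -> exists x' (D : {set TH}), [/\ x' \in R,
    forall d, d \in D -> d \notin R /\ connect h x' d,
    #|[set e : TH * TH | prune h D e.1 e.2]| < #|[set e : TH * TH | h e.1 e.2]| & good (prune h D) -> good h].
Proof.
move=> op0 pn; have [x1 [p1 [op le mx]]] := out_path_max op0.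
have {le pn p op0 x} p1n : p1 <> [::] by move=> e; apply: pn; apply: size0nil; move: le; rewrite e leqn0 => /eqP.
case/lastP: p1 => [//|q0 z] in op mx p1n *.
have [xR pth u nR] := op.
have con t : t \in rcons q0 z -> connect h x1 t.
  move=> tp; apply/connectP; have [p1' [p2 e]] : exists a b, rcons q0 z = rcons a t ++ b.
    by case/splitPr: tp => a b; exists a, b; rewrite cat_rcons.
  by exists (rcons p1' t); rewrite ?last_rcons //; move: pth; rewrite e cat_path => /andP[].
have up : uniq (rcons q0 z) by move: u => /andP[].
have nz_prune (D : {set TH}) a b : h a b -> a \in D -> #|[set e : TH * TH | prune h D e.1 e.2]| < #|[set e : TH * TH | h e.1 e.2]|.
  move=> ab aD; apply: proper_card; apply/properP; split.
    by apply/subsetP=> e; rewrite !inE => /and3P[].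
  by exists (a, b); rewrite !inE //= /prune aD andbF.
have disR (D : {set TH}) : D \subset [set t in rcons q0 z] ->
    forall d, d \in D -> d \notin R /\ connect h x1 d.
  by move=> /subsetP sD d /sD; rewrite inE => dp; split; [apply: nR|apply: con].
have [y ey] : exists y, y = last x1 q0 by exists (last x1 q0).
have hyz : h y z by move: pth; rewrite ey rcons_path => /andP[].
have zD : z \in rcons q0 z by rewrite mem_rcons mem_head.
have ne_h a b : h a b -> a != b by apply: contraTneq => ->; apply/negP=> /ha; rewrite ia.
have [leaf|nl] := classic (forall w, h z w -> w = y).
  exists x1, [set z]; split=> //.
  - by apply: disR; rewrite sub1set inE.
  - by apply: (nz_prune _ z y); rewrite ?set11 // sh.
  by apply: good_leaf leaf => //; apply: ne_h.
have [w [zw wy]] : exists w, h z w /\ w <> y.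
  by apply: NNPP => H; apply: nl => w zw; apply: NNPP => wy; apply: H; exists w.
have nbrz t : h z t -> exists s1 s2, x1 :: q0 = s1 ++ t :: s2 /\ size s2 <= 1 := last_nbr op mx.
have [q eq] : exists q, q0 = rcons q y.
  move: ey nbrz; case/lastP: (q0) => [/= ey|q y' ->] nbrz; last by exists q; rewrite last_rcons.
  have [[|c s1] [s2 [[e1 e2] _]]] := nbrz w zw; first by case: wy; rewrite ey -e1.
  by case: s1 e2.
have nbz t : h z t -> t = y \/ t = last x1 q.
  by move/nbrz; rewrite eq => -[s1 [s2 [e s2n]]]; apply: last_two e s2n.
subst q0.
have ew : last x1 q = w by case: (nbz w zw).
(* As [z] is adjacent to [w], exchanging the last two vertices [y] and [z] gives another longest
   path. So [last_nbr] also restricts the neighbours of [y]. *)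
have u2 : uniq (x1 :: rcons (rcons q z) y).
  rewrite (perm_uniq (s2 := x1 :: rcons (rcons q y) z)) //.
  by rewrite perm_cons -!cats1 -!catA perm_cat2l /= (perm_catC [:: z] [:: y]).
have op2 : out_path x1 (rcons (rcons q z) y).
  split=> //.
    move: pth; rewrite !rcons_path !last_rcons => /andP[/andP[-> _] _].
    by rewrite ew (sh w z) zw (sh z y) hyz.
  by move=> t; rewrite !(mem_rcons, inE) => tp; apply: nR; rewrite !(mem_rcons, inE) orbCA.
have mx2 y0 q1 : out_path y0 q1 -> size q1 <= size (rcons (rcons q z) y).
  by move/mx; rewrite !size_rcons.
have nby t : h y t -> t = z \/ t = w.
  by move/(last_nbr op2 mx2) => [s1 [s2 [e s2n]]]; rewrite -ew; apply: last_two e s2n.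
have hwy : h w y.
  by move: pth; rewrite rcons_path => /andP[]; rewrite rcons_path ew => /andP[].
exists x1, [set y; z]; split=> //.
- apply: disR; rewrite subUset !sub1set !(mem_rcons, inE) !eqxx.
  by rewrite orbT.
- by apply: (nz_prune _ y z); rewrite ?set21.
have hwz : h w z by rewrite sh.
apply: (@good_triangle_leaf _ h w y z) => //; try exact: ne_h.
  by move=> t /nby[]; auto.
by move=> t /nbz[]; rewrite ?ew; auto.
Qed.
End LongestPath.

(** Induction on the number of edges of [h]. The invariant says that [h] contains all edges of a
    core or none. Pruning keeps it, because by [R2] no deleted vertex lies in a core that still has
    edges, and it allows [C1] to be used for a whole core. *)
Lemma good_cactus h : symmetric h -> subrel h adj ->
  (forall X x y, Core X -> ind adj X x y -> h x y -> subrel (ind adj X) h) -> good h.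
Proof.
have [n] := ubnP #|[set e : TH * TH | h e.1 e.2]|; elim: n h => // n IH h hn sh ha inv.
have hconn x y : connect h x y -> connect adj x y.
  by apply: connect_sub => a b /ha; apply: connect1.
have finish (R : {set TH}) x p : 
  (forall a b p, a \in R -> b \in R -> a != b -> p <> [::] -> path adj a (rcons p b) ->
     uniq p -> {in p, forall z, z \notin R} -> False) ->
  (forall Y y x, Core Y -> y \in Y -> y \notin R -> x \in R -> connect h x y -> False) ->
  out_path h R x p -> p <> [::] -> good h.
  move=> R1 R2 op pn; have [x' [D [xR DR lt gd]]] := prune_end sh ha R1 R2 op pn.
  apply: gd; apply: IH => //.
  - by apply: leq_trans lt _; rewrite -ltnS.
  - by move=> a b; rewrite /prune sh [(a \notin D) && _]andbC.
  - by move=> a b /and3P[/ha].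
  move=> X a b cX ab /and3P[hab _ _] c d cd; rewrite /prune (inv X a b cX ab hab) //=.
  have nD t : t \in X -> t \notin D.
    move=> tX; apply/negP=> /DR[tR ct]; exact: (R2 X t x').
  by case/and3P: cd => cX' dX' _; rewrite !nD.
(* Cores that meet are equal by [C3], so if every edge lies in a core, the edges of one core are
   vertex-disjoint from the others and can be split off. *)
have [allcore|] := classic (forall x y, h x y -> exists2 X, Core X & ind adj X x y).
  case: (pickP [pred e : TH * TH | h e.1 e.2]) => [[a b] /= hab|none]; last first.
    move=> T g iota S sg ii sS; exists (fun v => [set iota v]); split.
    - by move=> v; apply: set11.
    - by move=> v; apply: cset1.
    - by move=> u v x /set1P-> /set1P/ii.
    by move=> u v huv; have := none (u, v); rewrite /= huv.
  have [X cX abX] := allcore a b hab.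
  have Xh : subrel (ind adj X) h := inv X a b cX abX hab.
  pose h2 : rel TH := fun x y => h x y && ~~ ind adj X x y.
  have si := ind_sym X sa.
  have other x y : h2 x y -> exists Y, [/\ Core Y, ind adj Y x y & forall t, t \in Y -> t \notin X].
    move=> /andP[hxy nX]; have [Y cY xyY] := allcore x y hxy; exists Y; split=> // t tY.
    apply/negP=> tX; move: nX; rewrite (C3 cX cY tX tY (connect0 _ _)) xyY //.
  have g2 : good h2.
    apply: IH.
    - apply: leq_trans (_ : #|[set e : TH * TH | h2 e.1 e.2]| < #|[set e : TH * TH | h e.1 e.2]|) _ => //.
      apply: proper_card; apply/properP; split.
        by apply/subsetP=> e; rewrite !inE => /andP[].
      by exists (a, b); rewrite !inE //= /h2 abX andbF.
    - by move=> x y; rewrite /h2 sh si.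
    - by move=> x y /andP[/ha].
    move=> Y x y cY xyY h2xy c d cd; have [Y' [cY' xyY' dY']] := other x y h2xy.
    have [xY _ _] := and3P xyY; have [xY' _ _] := and3P xyY'.
    have eY : Y = Y' := C3 cY cY' xY xY' (connect0 _ _).
    have hxy : h x y by case/andP: h2xy.
    rewrite /h2 (inv Y x y cY xyY hxy c d cd) /=; apply/negP=> /and3P[cX1 _ _].
    by case/and3P: cd; rewrite eY => /dY'; rewrite cX1.
  have gu : good (fun x y => ind adj X x y || h2 x y).
    apply: good_union => //.
    - by move=> x y; rewrite /h2 sh si.
    - move=> x y z /and3P[xX _ _] /other[Y [_ /and3P[xY _ _] d]].
      by have := d x xY; rewrite xX.
    exact: C1.
  apply: good_mono gu => //.
  - by move=> x y; rewrite /h2 si sh.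
  - by move=> x /=; apply/negP=> /orP[/and3P[_ _]|/andP[/ha]]; rewrite ia.
  by move=> x y hxy; rewrite /h2 hxy; case: (ind adj X x y).
move=> nall.
have [x [y [hxy nXY]]] : exists x y, h x y /\ forall X, Core X -> ~~ ind adj X x y.
  apply: NNPP => H; apply: nall => x y hxy; apply: NNPP => H2; apply: H; exists x, y; split=> // X cX.
  by apply/negP=> xyX; apply: H2; exists X.
have nexy : x != y by apply: contraTneq hxy => ->; apply/negP=> /ha; rewrite ia.
(* There is an edge outside all cores. The longest path starts at the core connected to [x] if there
   is one, and otherwise at [x] itself. *)
have [[X [t [cX tX tx]]]|nocore] := classic (exists X t, [/\ Core X, t \in X & connect h t x]).
  have [a [b [aX bX hab]]] : exists a b, [/\ a \in X, b \notin X & h a b].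
    case: (boolP (x \in X)) => xX.
      exists x, y; split=> //; apply: contra (nXY X cX) => yX.
      by apply/and3P; split=> //; apply: ha.
    apply: NNPP => H; case/negP: xX; apply: (connect_inv (W := [in X]) _ tx) => // u v uX uv.
    by apply: contraT => vX; case: H; exists u, v.
  apply: (finish X a [:: b]) => //.
  - move=> a' b' p a'X b'X nab pn pth up pX; have [tX2 mX] := C2 cX.
    have /mX := two_conn_ear tX2 a'X b'X nab pth up pX; rewrite subsetUl => /(_ isT) e.
    case: p pn pX e {pth up} => // z p _ pX e; have := pX z (mem_head _ _).
    by rewrite -e in_setU inE mem_head orbT.
  - move=> Y y' x' cY y'Y y'X x'X c; case/negP: y'X.
    by rewrite (C3 cX cY x'X y'Y (hconn _ _ c)).
  split=> //=; rewrite ?hab ?inE //.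
    by rewrite andbT; apply: contraNneq bX => <-.
  by move=> z; rewrite inE => /eqP->.
apply: (finish [set x] x [:: y]) => //.
- by move=> a b p /set1P-> /set1P->; rewrite eqxx.
- move=> Y y' x' cY y'Y _ /set1P-> c; apply: nocore; exists Y, y'; split=> //.
  by rewrite (sym_connect_sym sh).
split=> //=; rewrite ?hxy ?set11 ?inE ?nexy //.
by move=> z; rewrite !inE => /eqP->; rewrite eq_sym.
Qed.
End Cacti.

(** * Blocks *)

Lemma good_via (TH0 TH : finType) (h0 : rel TH0) (h : rel TH) (e : TH0 -> TH) :
  injective e -> symmetric h0 -> irreflexive h0 -> symmetric h -> good h0 ->
  (forall u v, h u v -> exists x y, [/\ h0 x y, e x = u & e y = v]) -> good h.
Proof.
move=> ie sh0 ih0 sh g0 sub; apply: good_mono (good_embed ie g0) => //.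
- by move=> u v; apply/push_relP/push_relP => -[x [y [? ? ?]]]; exists y, x; rewrite sh0.
- by move=> u; case: push_relP => // -[x [y [xy <- /ie e_]]]; move: xy; rewrite e_ ih0.
by move=> u v /sub uv; apply/push_relP.
Qed.

Lemma good_complete4 (F : finType) (k : rel F) : symmetric k -> irreflexive k -> #|F| = 4 -> good k.
Proof.
move=> sk ik cF; have c4 : #|{: bool * bool}| = #|F| by rewrite cF card_prod card_bool.
pose e (x : bool * bool) : F := enum_val (cast_ord c4 (enum_rank x)).
have ie : injective e by move=> x y /enum_val_inj /cast_ord_inj /enum_rank_inj.
have surj v : exists x, e x = v.
  by exists (enum_val (cast_ord (esym c4) (enum_rank v))); rewrite /e enum_valK cast_ordKV enum_rankK.
apply: (good_via ie _ _ sk good_K4).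
- by move=> x y; rewrite /neq_rel eq_sym.
- by move=> x; rewrite /neq_rel eqxx.
move=> u v uv; have [x ex] := surj u; have [y ey] := surj v; exists x, y; split=> //.
by apply: contraTneq uv => exy; rewrite -ex -ey exy ik.
Qed.

Lemma good_via_inv (TH0 TH : finType) (h0 : rel TH0) (h : rel TH) (phi : TH -> TH0) :
  injective phi -> #|TH0| = #|TH| -> symmetric h0 -> irreflexive h0 -> symmetric h -> good h0 ->
  (forall u v, h u v -> h0 (phi u) (phi v)) -> good h.
Proof.
move=> ip c sh0 ih0 sh g0 sub.
have [e pe ep] := inj_card_bij ip (eq_leq c).
apply: (good_via (can_inj ep) sh0 ih0 sh g0) => u v /sub uv.
by exists (phi u), (phi v); rewrite !pe.
Qed.

Lemma hub_rel_sym (I : finType) b : symmetric (@hub_rel I b).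
Proof. by move=> [x|i] [y|j] //=; rewrite eq_sym. Qed.

Lemma hub_rel_irrefl (I : finType) b : irreflexive (@hub_rel I b).
Proof. by move=> [x|i] //=; rewrite eqxx andbF. Qed.

Section Multipartite.
Variable s : seq nat.

Lemma multipartite_eq (v w : multipartite_vert s) :
  tag v = tag w -> val (tagged v) = val (tagged w) -> v = w.
Proof. by case: v w => [i j] [i' j'] /= e; subst i' => /val_inj->. Qed.

Lemma card_multipartite : #|multipartite_vert s| = \sum_(i < size s) nth 0 s i.
Proof.
rewrite card_tagged sumnE big_map big_enum /=.
by apply: eq_bigr => i _; rewrite card_ord.
Qed.
End Multipartite.

Lemma good_K112 : good (@multipartite_adj [:: 1; 1; 2]).
Proof.
apply: good_complete4; [exact: multipartite_sym|exact: multipartite_irrefl|].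
by rewrite card_multipartite !big_ord_recr big_ord0.
Qed.

Lemma good_K113 : good (@multipartite_adj [:: 1; 1; 3]).
Proof.
pose phi (v : multipartite_vert [:: 1; 1; 3]) : bool + 'I_3 :=
  if val (tag v) == 0 then inl false else if val (tag v) == 1 then inl true
  else inr (inord (val (tagged v))).
apply: (good_via_inv (phi := phi) _ _ (@hub_rel_sym _ true) (@hub_rel_irrefl _ true)
  (@multipartite_sym _) (@good_hub11 'I_3 ord0)).
- move=> v w e; suff [e1 e2] : val (tag v) = val (tag w) /\ val (tagged v) = val (tagged w).
    by apply: multipartite_eq => //; apply: val_inj.
  move: v w e => [[[|[|[|i]]] Hi] j] [[[|[|[|i']]] Hi'] j'] //; rewrite /phi /= => e; split=> //.
  + by case: j {e} => [[|j] //= _]; case: j' => [[|j'] //= _].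
  + by case: j {e} => [[|j] //= _]; case: j' => [[|j'] //= _].
  + by case: e => /(congr1 val); rewrite /= !inordK.
- by rewrite card_multipartite !big_ord_recr big_ord0 /= card_sum card_bool card_ord.
move=> [[[|[|[|i]]] Hi] j] [[[|[|[|i']]] Hi'] j'] //.
Qed.

Lemma good_K23 : good (@multipartite_adj [:: 2; 3]).
Proof.
pose phi (v : multipartite_vert [:: 2; 3]) : bool + 'I_3 :=
  if val (tag v) == 0 then inl (val (tagged v) == 1) else inr (inord (val (tagged v))).
apply: (good_via_inv (phi := phi) _ _ (@hub_rel_sym _ false) (@hub_rel_irrefl _ false)
  (@multipartite_sym _) (@good_hub2 'I_3)).
- move=> v w e; suff [e1 e2] : val (tag v) = val (tag w) /\ val (tagged v) = val (tagged w).
    by apply: multipartite_eq => //; apply: val_inj.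
  move: v w e => [[[|[|i]] Hi] j] [[[|[|i']] Hi'] j'] //; rewrite /phi /= => e; split=> //.
  + by case: j e => [[|[|j]] //= _]; case: j' => [[|[|j']] //= _].
  + by case: e => /(congr1 val); rewrite /= !inordK.
- by rewrite card_multipartite !big_ord_recr big_ord0 /= card_sum card_bool card_ord.
move=> [[[|[|i]] Hi] j] [[[|[|i']] Hi'] j'] //.
Qed.

Section Blocks.
Variable H : sgraph.
Implicit Types (B : subgraph H) (X Y : {set H}).
Local Notation adjH := (@adj H).

Definition induced X : subgraph H.
Proof.
exists X (ind adjH X); first by apply: ind_sym; apply: adj_sym.
by move=> x y /and3P[].
Defined.

Lemma nonseparable_two_conn B : nonseparable B -> two_conn adjH (sverts B).
Proof.
move=> [[_ cB] nc]; split.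
  move=> x y xB yB; apply: connect_sub (cB x y xB yB) => u v uv.
  by apply: connect1; have [uB vB auv] := sadj_sub uv; apply/and3P.
move=> v vB x y; rewrite !inE => /andP[xv xB] /andP[yv yB].
have : connect [rel a b | [&& sadj B a b, a != v & b != v]] x y.
  apply: contraT => nxy; case: (nc v); split=> //; exists x, y.
  by rewrite !inE xv yv; split=> //; apply: cB.
apply: connect_sub => a b /and3P[/sadj_sub[aB bB ab] av bv].
by apply: connect1; apply/and3P; rewrite !inE av bv.
Qed.

Lemma two_conn_nonseparable X : X != set0 -> two_conn adjH X -> nonseparable (induced X).
Proof.
move=> X0 [cX cXv]; split; first by split.
move=> v [vX [x [y [xX yX _ /negP]]]]; apply.
apply: connect_sub (cXv v vX x y xX yX) => a b /and3P[].
rewrite !inE => /andP[av aX] /andP[bv bX] ab; apply: connect1.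
by rewrite /= av bv; apply/and3P; split=> //; apply/and3P.
Qed.

(** Adding the missing edges of [H] between the vertices of a block keeps it nonseparable, so by
    maximality there are none. *)
Lemma block_adj B : block B -> sadj B =2 ind adjH (sverts B).
Proof.
move=> [nB mB]; have B0 : sverts B != set0 by case: nB => -[].
have sub : subrel (sadj B) (ind adjH (sverts B)) by move=> x y /sadj_sub[? ? ?]; apply/and3P.
have le : subgraph_le B (induced (sverts B)) by split.
have [_ sub'] := mB _ (two_conn_nonseparable B0 (nonseparable_two_conn nB)) le.
by move=> x y; apply/idP/idP => [/sub|/sub'].
Qed.

Lemma block_max B Y : block B -> two_conn adjH Y -> sverts B \subset Y -> Y = sverts B.
Proof.
move=> bB tY sY; have [nB mB] := bB; have B0 : sverts B != set0 by case: nB => -[].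
have Y0 : Y != set0 by apply: contraNneq B0 => e; rewrite -subset0 -e.
have le : subgraph_le B (induced Y).
  split=> // x y; rewrite (block_adj bB) => /and3P[xB yB xy].
  by apply/and3P; rewrite !(subsetP sY).
have [sYB _] := mB _ (two_conn_nonseparable Y0 tY) le.
by apply/eqP; rewrite eqEsubset sYB.
Qed.

Lemma two_conn_block X : X != set0 -> two_conn adjH X -> exists2 B, block B & X \subset sverts B.
Proof.
have [n] := ubnP #|~: X|; elim: n X => // n IH X Xn X0 tX.
have [[Y [tY pY]]|no] := classic (exists Y, two_conn adjH Y /\ X \proper Y).
  have Y0 : Y != set0.
    by apply: contraTneq pY => ->; rewrite properE subset0 (negPf X0).
  have Yn : #|~: Y| < n.
    by apply: leq_trans (_ : #|~: Y| < #|~: X|) _ => //; apply: proper_card; rewrite properC.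
  by have [B bB sB] := IH Y Yn Y0 tY; exists B => //; apply: subset_trans sB; apply: proper_sub.
exists (induced X) => //; split; first exact: two_conn_nonseparable.
move=> B' nB' [sX _]; have tB := nonseparable_two_conn nB'.
have eX : sverts B' = X.
  apply/eqP; rewrite eqEsubset [X \subset _]sX andbT; apply/negPn/negP=> nsub.
  by apply: no; exists (sverts B'); split=> //; rewrite properE sX.
split; first by rewrite eX.
by move=> x y /sadj_sub[xB yB xy]; apply/and3P; rewrite -eX.
Qed.

Lemma isomorphic_card B (F : sgraph) : isomorphic_to B F -> #|sverts B| = #|F|.
Proof. by case=> f [fi <- _]; rewrite card_imset // cardsT. Qed.

Lemma isomorphic_good B (F : sgraph) : block B -> isomorphic_to B F -> good (@adj F) ->
  good (ind adjH (sverts B)).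
Proof.
move=> bB [f [fi fB fadj]] gF.
apply: (good_via fi (@adj_sym F) (@adj_irrefl F) _ gF).
  by apply: ind_sym; apply: adj_sym.
move=> u v; rewrite -(block_adj bB) => uv; have [uB vB _] := sadj_sub uv.
rewrite -fB in uB vB; case/imsetP: uB uv => x _ ->; case/imsetP: vB => y _ -> xy.
by exists x, y; rewrite -fadj.
Qed.

Lemma exceptional_good B : block B -> exceptional_block B -> good (ind adjH (sverts B)).
Proof.
move=> bB; case=> [i|[i|[i|[i|[n n3 i]]]]]; apply: (isomorphic_good bB i).
- apply: good_complete4; [exact: adj_sym|exact: adj_irrefl|exact: card_ord].
- exact: good_K112.
- exact: good_K113.
- exact: good_K23.
- exact: good_cycle.
Qed.

Lemma good_contractible : good adjH -> contractible H.
Proof.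
move=> gH G iota ii [P [Psym Ppath Proot Plab]].
pose S u v : {set G} := if adjH u v then [set z in P u v] else set0.
have SP u v x : adjH u v -> (x \in S u v) = (x \in P u v).
  by rewrite /S => ->; rewrite inE.
have sS : scheme adjH (@adj G) iota S.
  split.
  - move=> u v; rewrite /S adj_sym; case: ifP => // vu; apply/setP=> z.
    by rewrite !inE (Psym v u) // mem_rev.
  - by move=> u v uv; rewrite SP //; apply/Proot; auto.
  - move=> u v uv; rewrite /S uv; have := Ppath u v uv; case: (P u v) => //= z p.
    by case/and4P=> _ pp _ _; apply: cset_seq pp; apply: adj_sym.
  - by move=> u v w uv; rewrite SP // => /(Proot u v uv).
  move=> x u v uv; rewrite SP // => xP.
  (* The incidence condition is stated for families of edges; the family of all edges whose path
     contains [x] yields one label for [x]. *)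
  pose es := [seq e <- enum {: H * H} | adjH e.1 e.2 && (x \in P e.1 e.2)].
  have esP e : (e \in es) = adjH e.1 e.2 && (x \in P e.1 e.2) by rewrite mem_filter mem_enum andbT.
  have [||| w Hw] := Plab es.
  - by move=> e0; have := esP (u, v); rewrite e0 /= uv xP.
  - by move=> e; rewrite esP => /andP[].
  - by exists x => e; rewrite esP => /andP[].
  exists w => u' v' uv'; rewrite SP // => xP'.
  by apply: (Hw (u', v')); rewrite esP /= uv'.
have [C mC] := gH G (@adj G) iota S (@adj_sym G) ii sS.
pose mk (X : {set G}) : subgraph G := @Subgraph G X (ind (@adj G) X)
  (ind_sym X (@adj_sym G)) (fun x y h => and3P h).
exists (fun v => mk (C v)); split=> /=.
- move=> v; split; last by move=> x y; apply: (min_con mC v).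
  by apply/set0Pn; exists (iota v); apply: (min_root mC).
- exact: (min_root mC).
- move=> u v uv; rewrite -setI_eq0; apply/eqP/setP=> x; rewrite !inE; apply/negP=> /andP[xu xv].
  by move: uv; rewrite (min_dis mC xu xv) eqxx.
exact: (min_adj mC).
Qed.
End Blocks.

Theorem corollary7p1 (H : sgraph)
  (Hblocks : forall B : subgraph H,
     block B -> ordinary_block B \/ exceptional_block B)
  (Hone : forall B1 B2 : subgraph H,
     block B1 -> block B2 -> same_component B1 B2 ->
     ~ ordinary_block B1 -> ~ ordinary_block B2 -> subgraph_eq B1 B2) :
  contractible H.
Proof.
apply: good_contractible.
(* Cores are the non-ordinary blocks rather than the exceptional ones, since a triangle is ordinary
   and also a cycle; the uniqueness hypothesis is stated for non-ordinary blocks. *)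
pose Core (X : {set H}) := exists B, [/\ block B, ~ ordinary_block B & sverts B = X].
apply: (good_cactus (adj := @adj H) (@adj_sym H) (@adj_irrefl H) (Core := Core)) => //.
- move=> X [B [bB nB <-]]; have [//|eB] := Hblocks B bB.
  exact: exceptional_good.
- move=> X [B [bB nB <-]]; split; first by apply: nonseparable_two_conn; case: bB.
  by move=> Y; apply: block_max.
- move=> X Y x y [B1 [b1 n1 <-]] [B2 [b2 n2 <-]] x1 y2 c.
  by have [] := Hone B1 B2 b1 b2 (ex_intro _ x (ex_intro _ y (And3 x1 y2 c))) n1 n2.
- move=> X tX X3; have X0 : X != set0 by apply: contraTneq X3 => ->; rewrite cards0.
  have [B bB sX] := two_conn_block X0 tX; exists (sverts B) => //; exists B; split=> //.
  have := leq_trans X3 (subset_leq_card sX) => B3.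
  by case=> i; move: B3; rewrite (isomorphic_card i) card_ord.
- exact: adj_sym.
by move=> X x y _ _ _ a b /and3P[].
Qed.
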